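(* Let $s\in\tfrac12\mathbb{Z}_{>0}$. The set $$\bigcup_{a,c=0}^{2s}\{\,x_\gamma\ :\ \gamma\in\mathcal{P}_s^{(a,c)}\,\}$$ is a basis of the algebra $\mathcal{A}_s$.
   Context: Here $q$ is an indeterminate; all algebras are unital associative over the field $\mathbb{C}(q)$. Notation: $[A,B]_q=qAB-q^{-1}BA$; $q_p=(-1)^pq^{p(p+1)}$ for integers $p$; $\chi_p=q^{2p+1}+q^{-2p-1}$ for $p\in\frac12\mathbb{Z}$. The algebra $B_3^s(q)$ is generated by $\sigma_1,\sigma_2$ subject to $\sigma_1\sigma_2\sigma_1=\sigma_2\sigma_1\sigma_2$ and $\prod_{p=0}^{2s}(\sigma_i-q_p)=0$ for $i=1,2$ (so the $\sigma_i$ are invertible). In it, for $i=1,2$ and $r=0,1,\dots,2s$, define the idempotents $$e_i^{(r)}=\prod_{0\le p\le 2s,\ p\ne r}\frac{\sigma_i-q_p}{q_r-q_p},\qquad\text{and}\qquad g_i=\sum_{r=0}^{2s}\chi_r e_i^{(r)}.$$ The Askey--Wilson braid algebra $AW\!B_3^{s}(q)$ is the quotient of $B_3^s(q)$ by the relations stating that the three elements $$\frac{[g_1,g_2]_q}{q^2-q^{-2}}+\sigma_1g_2\sigma_1^{-1},\qquad \frac{[g_2,\sigma_1g_2\sigma_1^{-1}]_q}{q^2-q^{-2}}+g_1,\qquad \frac{[\sigma_1g_2\sigma_1^{-1},g_1]_q}{q^2-q^{-2}}+g_2$$ are equal to one and the same central element, which is written $\frac{\chi_s(\kappa+\chi_s)}{q+q^{-1}}$;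 this defines the central element $\kappa$. In $AW\!B_3^s(q)$ set $$\Omega=\chi_s(\kappa+\chi_s)(qg_1+q^{-1}g_2+q\sigma_1g_2\sigma_1^{-1})-q^2g_1^2-q^{-2}g_2^2-q^2\sigma_1g_2^2\sigma_1^{-1}-q\,g_1g_2\sigma_1g_2\sigma_1^{-1}.$$ The algebra $\mathcal{A}_s$ is the quotient of $AW\!B_3^s(q)$ by the relations $\Omega=\kappa(\kappa+\chi_s^3)+3\chi_s^2-\chi_0^2$ and $e_1^{(0)}g_2e_1^{(0)}=\frac{\chi_s^2}{\chi_0}e_1^{(0)}$. The same symbols denote the images of the elements in $\mathcal{A}_s$. Paths. A path of length $N\ge0$ from $a$ to $c$ is a sequence of integers $\gamma=(\gamma_0,\dots,\gamma_N)$ with $\gamma_0=a$, $\gamma_N=c$, $0\le\gamma_i\le 2s$ and $\gamma_{i+1}\in\{\gamma_i-1,\gamma_i,\gamma_i+1\}$. To it is associated the element $$x_\gamma=e_1^{(\gamma_0)}g_2e_1^{(\gamma_1)}g_2e_1^{(\gamma_2)}\cdots e_1^{(\gamma_{N-1})}g_2e_1^{(\gamma_N)}$$ (so $x_{(a)}=e_1^{(a)}$ for the path of length $0$). If $\gamma=(\gamma_0,\dots,\gamma_M)$ and $\gamma'=(\gamma'_0,\dots,\gamma'_N)$ are paths with $\gamma_M=\gamma'_0$, their concatenation is $\gamma\cdot\gamma'=(\gamma_0,\dots,\gamma_{M-1},\gamma'_0,\gamma'_1,\dots,\gamma'_N)$, of length $M+N$. Let $\overline{\gamma}(a,c)$ be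 the unique path of length $|a-c|$ from $a$ to $c$. For an integer $0\le a\le 2s$, let $$L_a=\big((a),\,(a,a),\,(a,a-1,a),\,(a,a-1,a-1,a),\,\dots,\,(a,a-1,\dots,1,0,1,\dots,a-1,a)\big),$$ i.e. $L_a$ consists of exactly one path from $a$ to $a$ of each length $0,1,\dots,2a$: the one of length $2k$ ($0\le k\le a$) is $(a,a-1,\dots,a-k+1,a-k,a-k+1,\dots,a)$, and the one of length $2k+1$ ($0\le k<a$) is $(a,a-1,\dots,a-k,a-k,\dots,a-1,a)$. Finally, for integers $0\le a,c\le 2s$, $$\mathcal{P}_s^{(a,c)}=\begin{cases}\{\gamma\cdot\overline{\gamma}(a,c)\ :\ \gamma\in L_a \text{ of length } N\le 2s-(c-a)\},&\text{if } a\le c,\\ \{\overline{\gamma}(a,c)\cdot\gamma\ :\ \gamma\in L_c\text{ of length } N\le 2s-(a-c)\},&\text{if } a>c.\end{cases}$$ *)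

(* Defs.v *)
From HB Require Import structures.
From mathcomp Require Import all_boot all_algebra.
From mathcomp Require Import boolp classical_sets reals complex.
From mathcomp Require Import monalg.

Set Implicit Arguments.
Unset Strict Implicit.
Unset Printing Implicit Defensive.

Import GRing.Theory.
Local Open Scope ring_scope.
Local Open Scope quotient_scope.

(* C(q), with C = R[i] for a model R of the real numbers *)
Definition Cq (R : realType) : fieldType := {fraction {poly R[i]}}.
Definition qvar (R : realType) : Cq R := tofrac 'X.

(* Unital associative K-algebras on two generators.  [algType] requires
   1 != 0, which is not known a priori of an algebra given by relations; the
   type [presented rel] below, the quotient of the free algebra by the two-sided
   ideal generated by [rel], only carries its module and ring structures,
   together with [presented_scalerAl] and [presented_scalerAr]. *)
Section FreeAlgebra.
Variable K : fieldType.

Definition free_alg : Type := {malg K[{fmonom 'I_2}]}.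
HB.instance Definition _ := GRing.Lalgebra.on free_alg.

Lemma free_alg_scalerAr (k : K) (x y : free_alg) : k *: (x * y) = x * (k *: y).
Proof.
have malgCr (z : {malg K[{fmonom 'I_2}]}) : z * k%:MP = k *: z.
  rewrite malgM_def malgZ_def fgmulgU; apply/eq_bigr => m _.
  by rewrite mulm1 mulrC.
have -> : x * (k *: y) = x * (k%:MP : free_alg) * y.
  by rewrite -mulrA; congr (_ * _); rewrite [RHS]mul_malgC.
by rewrite scalerAl; congr (_ * _); rewrite [RHS]malgCr.
Qed.

HB.instance Definition _ :=
  GRing.Lalgebra_isAlgebra.Build K free_alg free_alg_scalerAr.

(* the generators sigma_1 (i = 0) and sigma_2 (i = 1) *)
Definition gen (i : 'I_2) : free_alg := mkmalgU (fmu i) 1.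

End FreeAlgebra.

Section Presented.
Variables (K : fieldType) (rel : free_alg K -> Prop).
Local Notation F := (free_alg K).

Inductive ideal_of : F -> Prop :=
| ideal_gen r : rel r -> ideal_of r
| ideal0 : ideal_of 0
| idealD x y : ideal_of x -> ideal_of y -> ideal_of (x + y)
| idealMl a x : ideal_of x -> ideal_of (a * x)
| idealMr a x : ideal_of x -> ideal_of (x * a).

Lemma idealZ k x : ideal_of x -> ideal_of (k *: x).
Proof. by move=> Ix; rewrite -[x]mul1r scalerAl; apply: idealMl. Qed.

Lemma idealN x : ideal_of x -> ideal_of (- x).
Proof. by move=> Ix; rewrite -scaleN1r; apply: idealZ. Qed.

Definition pequiv (x y : F) : bool := `[< ideal_of (x - y) >].

Lemma pequiv_is_equiv : equiv_class_of pequiv.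
Proof.
split=> [x|x y|y x z].
- by apply/asboolP; rewrite subrr; apply: ideal0.
- by apply/asboolP/asboolP => /idealN; rewrite opprB.
- move=> /asboolP Ixy /asboolP Iyz; apply/asboolP.
  by rewrite -[x](addrNK y) -addrA; apply: idealD.
Qed.

Canonical pequiv_equiv := EquivRelPack pequiv_is_equiv.
Canonical pequiv_encModRel := defaultEncModRel pequiv.

Definition presented : Type := {eq_quot pequiv}.
HB.instance Definition _ := EqQuotient.on presented.
HB.instance Definition _ := Choice.on presented.

Definition pr (x : F) : presented := \pi_presented x.

Lemma prE x y : pr x = pr y <-> ideal_of (x - y).
Proof.
split=> [/eqP|Ixy]; rewrite /pr; first by rewrite eqmodE => /asboolP.
by apply/eqP; rewrite eqmodE; apply/asboolP.
Qed.

Lemma pr_surj (u : presented) : exists x, u = pr x.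
Proof. by exists (repr u); rewrite /pr reprK. Qed.

Let pzero : presented := pr 0.
Let pone : presented := pr 1.
Let popp (u : presented) : presented := pr (- repr u).
Let padd (u v : presented) : presented := pr (repr u + repr v).
Let pmul (u v : presented) : presented := pr (repr u * repr v).
Let pscale (k : K) (u : presented) : presented := pr (k *: repr u).

Let ideal_repr x : ideal_of (repr (pr x) - x).
Proof. by apply/prE; rewrite /pr reprK. Qed.

Let proppE x : popp (pr x) = pr (- x).
Proof. by apply/prE; rewrite -opprD; exact/idealN/ideal_repr. Qed.

Let praddE x y : padd (pr x) (pr y) = pr (x + y).
Proof. by apply/prE; rewrite opprD addrACA; apply: idealD; exact: ideal_repr. Qed.

Let prmulE x y : pmul (pr x) (pr y) = pr (x * y).
Proof.
apply/prE; set x' := repr _; set y' := repr _.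
have -> : x' * y' - x * y = x' * (y' - y) + (x' - x) * y.
  by rewrite mulrBr mulrBl addrA subrK.
by apply: idealD; [apply: idealMl|apply: idealMr]; exact: ideal_repr.
Qed.

Let prscaleE k x : pscale k (pr x) = pr (k *: x).
Proof. by apply/prE; rewrite -scalerBr; exact/idealZ/ideal_repr. Qed.

Let paddA : associative padd.
Proof.
move=> u v w; have [x ->] := pr_surj u; have [y ->] := pr_surj v.
by have [z ->] := pr_surj w; rewrite !praddE addrA.
Qed.

Let paddC : commutative padd.
Proof.
move=> u v; have [x ->] := pr_surj u; have [y ->] := pr_surj v.
by rewrite !praddE addrC.
Qed.

Let padd0 : left_id pzero padd.
Proof. by move=> u; have [x ->] := pr_surj u; rewrite praddE add0r. Qed.

Let paddN : left_inverse pzero popp padd.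
Proof. by move=> u; have [x ->] := pr_surj u; rewrite proppE praddE addNr. Qed.

HB.instance Definition _ :=
  GRing.isZmodule.Build presented paddA paddC padd0 paddN.

Let pmulA : associative pmul.
Proof.
move=> u v w; have [x ->] := pr_surj u; have [y ->] := pr_surj v.
by have [z ->] := pr_surj w; rewrite !prmulE mulrA.
Qed.

Let pmul1 : left_id pone pmul.
Proof. by move=> u; have [x ->] := pr_surj u; rewrite prmulE mul1r. Qed.

Let pmulr1 : right_id pone pmul.
Proof. by move=> u; have [x ->] := pr_surj u; rewrite prmulE mulr1. Qed.

Let pmulDl : left_distributive pmul padd.
Proof.
move=> u v w; have [x ->] := pr_surj u; have [y ->] := pr_surj v.
by have [z ->] := pr_surj w; rewrite !(praddE, prmulE) mulrDl.
Qed.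

Let pmulDr : right_distributive pmul padd.
Proof.
move=> u v w; have [x ->] := pr_surj u; have [y ->] := pr_surj v.
by have [z ->] := pr_surj w; rewrite !(praddE, prmulE) mulrDr.
Qed.

HB.instance Definition _ := GRing.Zmodule_isPzRing.Build presented
  pmulA pmul1 pmulr1 pmulDl pmulDr.

Let pscaleA k l u : pscale k (pscale l u) = pscale (k * l) u.
Proof. by have [x ->] := pr_surj u; rewrite !prscaleE scalerA. Qed.

Let pscale1 : left_id 1 pscale.
Proof. by move=> u; have [x ->] := pr_surj u; rewrite prscaleE scale1r. Qed.

Let pscaleDr : right_distributive pscale +%R.
Proof.
move=> k u v; have [x ->] := pr_surj u; have [y ->] := pr_surj v.
have prDE a b : pr a + pr b = pr (a + b) := praddE a b.
by rewrite prDE !prscaleE prDE scalerDr.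
Qed.

Let pscaleDl u : {morph pscale^~ u : k l / k + l}.
Proof.
move=> k l; have [x ->] := pr_surj u.
by rewrite !prscaleE -[RHS]/(padd _ _) praddE scalerDl.
Qed.

HB.instance Definition _ := GRing.Zmodule_isLmodule.Build K presented
  pscaleA pscale1 pscaleDr pscaleDl.

Lemma pr0 : pr 0 = 0. Proof. by []. Qed.
Lemma pr1 : pr 1 = 1. Proof. by []. Qed.
Lemma prN x : pr (- x) = - pr x. Proof. exact/esym/proppE. Qed.
Lemma prD x y : pr (x + y) = pr x + pr y. Proof. exact/esym/praddE. Qed.
Lemma prM x y : pr (x * y) = pr x * pr y. Proof. exact/esym/prmulE. Qed.
Lemma prZ k x : pr (k *: x) = k *: pr x. Proof. exact/esym/prscaleE. Qed.

Lemma presented_scalerAl (k : K) (u v : presented) :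
  k *: (u * v) = (k *: u) * v.
Proof.
have [x ->] := pr_surj u; have [y ->] := pr_surj v.
by rewrite -prM -!prZ -prM scalerAl.
Qed.

Lemma presented_scalerAr (k : K) (u v : presented) :
  k *: (u * v) = u * (k *: v).
Proof.
have [x ->] := pr_surj u; have [y ->] := pr_surj v.
by rewrite -prM -!prZ -prM scalerAr.
Qed.

(* Relations presenting the quotient of [presented rel] by the two-sided ideal
   generated by [S]: all lifts of the elements of [S] are added to [rel]. *)
Definition add_rel (S : set presented) : free_alg K -> Prop :=
  fun f => rel f \/ S (pr f).

End Presented.

Lemma prod_linear (K : fieldType) (A : algType K) (x : A) (a : nat -> K) m :
  exists P : A, \prod_(0 <= p < m) (x - (a p)%:A)
    = (\prod_(0 <= p < m) - a p)%:A + P * x /\ P * x = x * P.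
Proof.
elim: m => [|m [P [defP cP]]].
  by exists 0; rewrite !big_nil scale1r mul0r mulr0 addr0.
set c := \prod_(0 <= p < m) - a p in defP.
exists (c%:A + P * x - a m *: P); split.
  rewrite !big_nat_recr //= defP -/c mulrBr -scalerAr mulr1 scalerDr scalerA.
  rewrite mulrBl -scalerAl mulrN scaleNr opprD [a m * c]mulrC.
  by rewrite [RHS]addrC addrAC !addrA.
rewrite mulrBl mulrDl mulrBr mulrDr -!scalerAl -!scalerAr mul1r mulr1.
by rewrite -cP mulrA -cP.
Qed.

(* The two-sided inverse of [x] (0 if [x] is not invertible). *)
Definition inv_of (A : pzRingType) (x : A) : A :=
  xget 0 [set y | y * x = 1 /\ x * y = 1]%classic.

Lemma inv_ofE (A : pzRingType) (x y : A) :
  y * x = 1 -> x * y = 1 -> inv_of x = y.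
Proof.
move=> yx xy; apply: xget_unique => [//|z [zx _]].
by rewrite -[z]mulr1 -xy mulrA zx mul1r.
Qed.

(* Throughout, [n] stands for 2s. *)
Section Elements.
Variables (K : fieldType) (q : K) (n : nat).

Definition qp (p : nat) : K := (-1) ^+ p * q ^+ (p * p.+1).

(* [chi m] is chi_{m/2} = q^(m+1) + q^(-m-1), so chi_r, chi_s, chi_0 are
   [chi r.*2], [chi n], [chi 0]. *)
Definition chi (m : nat) : K := q ^+ m.+1 + q ^- m.+1.

Section InPresented.
Variable rel : free_alg K -> Prop.
Local Notation A := (presented rel).

(* the scalar k in A; the notation [k%:A] is not available in [presented] *)
Definition cst (k : K) : A := k *: (1 : A).

Definition sigma1 : A := pr rel (gen K 0).
Definition sigma2 : A := pr rel (gen K 1).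

Definition idem (x : A) (r : nat) : A :=
  \prod_(0 <= p < n.+1 | p != r) ((qp r - qp p)^-1 *: (x - cst (qp p))).

Definition e1 (r : nat) : A := idem sigma1 r.
Definition e2 (r : nat) : A := idem sigma2 r.

Definition g1 : A := \sum_(0 <= r < n.+1) chi r.*2 *: e1 r.
Definition g2 : A := \sum_(0 <= r < n.+1) chi r.*2 *: e2 r.
Definition g3 : A := sigma1 * g2 * inv_of sigma1.

Definition qcomm (x y : A) : A := q *: (x * y) - q^-1 *: (y * x).

Definition AW1 : A := (q ^+ 2 - q ^- 2)^-1 *: qcomm g1 g2 + g3.
Definition AW2 : A := (q ^+ 2 - q ^- 2)^-1 *: qcomm g2 g3 + g1.
Definition AW3 : A := (q ^+ 2 - q ^- 2)^-1 *: qcomm g3 g1 + g2.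

Definition kappa : A := ((q + q^-1) / chi n) *: AW1 - cst (chi n).

Definition Omega : A :=
  chi n *: (kappa + cst (chi n)) * (q *: g1 + q^-1 *: g2 + q *: g3)
  - q ^+ 2 *: g1 ^+ 2 - q ^- 2 *: g2 ^+ 2
  - q ^+ 2 *: (sigma1 * g2 ^+ 2 * inv_of sigma1)
  - q *: (g1 * g2 * sigma1 * g2 * inv_of sigma1).

(* x_gamma for the path gamma = a :: t (paths are nonempty) *)
Definition xpath (gamma : seq nat) : A :=
  if gamma is a :: t then e1 a * \prod_(b <- t) (g2 * e1 b) else 1.

End InPresented.

(* [kappa] is the element with chi_s (kappa + chi_s) / (q + q^-1) = AW1. *)
Lemma kappaP rel : q + q^-1 != 0 -> chi n != 0 ->
  (chi n / (q + q^-1)) *: (kappa rel + cst rel (chi n)) = AW1 rel.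
Proof.
move=> nz_q nz_chi; rewrite /kappa subrK scalerA mulrA divfK //.
by rewrite divff // scale1r.
Qed.

Definition B3_rel (f : free_alg K) : Prop :=
  let s1 := gen K 0 in let s2 := gen K 1 in
  [\/ f = s1 * s2 * s1 - s2 * s1 * s2,
      f = \prod_(0 <= p < n.+1) (s1 - (qp p)%:A)
    | f = \prod_(0 <= p < n.+1) (s2 - (qp p)%:A)].
Definition B3 : Type := presented B3_rel.

Definition AWB3_rel : free_alg K -> Prop :=
  @add_rel K B3_rel (fun x : B3 =>
    [\/ x = AW1 B3_rel - AW2 B3_rel,
        x = AW1 B3_rel - AW3 B3_rel
      | exists y : B3, x = AW1 B3_rel * y - y * AW1 B3_rel]).
Definition AWB3 : Type := presented AWB3_rel.

Definition As_rel : free_alg K -> Prop :=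
  @add_rel K AWB3_rel (fun x : AWB3 =>
    let kap := kappa AWB3_rel in
    x = Omega AWB3_rel
        - (kap * (kap + cst AWB3_rel (chi n ^+ 3))
           + cst AWB3_rel (3%:R * chi n ^+ 2 - chi 0 ^+ 2))
    \/ x = e1 AWB3_rel 0 * g2 AWB3_rel * e1 AWB3_rel 0
           - (chi n ^+ 2 / chi 0) *: e1 AWB3_rel 0).
Definition As : lmodType K := presented As_rel.

Lemma qp_neq0 p : q != 0 -> qp p != 0.
Proof. by move=> nz_q; rewrite mulf_eq0 signr_eq0 expf_eq0 (negPf nz_q) andbF. Qed.

(* The inverse of sigma_1 used above is genuine as soon as [q != 0]. *)
Lemma sigma1_inv (rel : free_alg K -> Prop) :
    q != 0 -> (forall f, B3_rel f -> rel f) ->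
  inv_of (sigma1 rel) * sigma1 rel = 1 /\ sigma1 rel * inv_of (sigma1 rel) = 1.
Proof.
move=> nz_q sub_rel.
have [P [defP cP]] := prod_linear (gen K 0) qp n.+1.
set c := \prod_(0 <= p < n.+1) - qp p in defP.
have nz_c : c != 0.
  by rewrite /c prodf_seq_neq0; apply/allP => p _; rewrite oppr_eq0 qp_neq0.
pose Q : presented rel := - c^-1 *: pr rel P.
have rel0 : pr rel P * sigma1 rel = - (c *: (1 : presented rel)).
  apply/eqP; rewrite -addr_eq0 addrC -pr1 -prZ -prM -prD -pr0; apply/eqP/prE.
  by rewrite subr0 -defP; apply/ideal_gen/sub_rel; constructor 2.
have Ql : Q * sigma1 rel = 1.
  by rewrite -presented_scalerAl rel0 scaleNr scalerN opprK scalerA mulVf ?scale1r.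
have Qr : sigma1 rel * Q = 1.
  by rewrite -presented_scalerAr -prM -cP prM presented_scalerAl.
by rewrite (inv_ofE Ql Qr).
Qed.

End Elements.

(* Paths: nonempty sequences (gamma_0, ..., gamma_N), of length N. *)
Definition plen (gamma : seq nat) : nat := (size gamma).-1.

Definition step (x y : nat) : bool := [|| y.+1 == x, y == x | y == x.+1].

Definition is_path (n a c : nat) (gamma : seq nat) : bool :=
  [&& gamma != [::], head 0 gamma == a, last 0 gamma == c,
      all (fun x => x <= n)%N gamma
    & sorted step gamma].

Definition pcat (gamma gamma' : seq nat) : seq nat :=
  take (plen gamma) gamma ++ gamma'.

Definition gbar (a c : nat) : seq nat :=
  if (a <= c)%N then iota a (c - a).+1 else rev (iota c (a - c).+1).

(* The path of length N <= 2a in L_a: it descends from a to a - floor(N/2),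
   then climbs back to a, repeating the lowest vertex when N is odd. *)
Definition Lpath (a N : nat) : seq nat :=
  let d := gbar a (a - N./2) in
  if odd N then d ++ rev d else pcat d (rev d).

Lemma step_path_iota a t : path step a t ->
  (last a t <= a + size t)%N /\
  (last a t = (a + size t)%N -> a :: t = iota a (size t).+1).
Proof.
elim: t a => [|b t IH] a /=; first by rewrite addn0.
case/andP => ab /IH [le_last eq_last].
have le_ba : (b <= a.+1)%N by case/or3P: ab => /eqP <-; rewrite // -addn2 leq_addr.
split; first by rewrite addnS -addSn (leq_trans le_last) // leq_add2r.
rewrite addnS -addSn => last_t; have ba : b = a.+1.
  apply/eqP; rewrite eqn_leq le_ba /= -(leq_add2r (size t)) -last_t.
  exact: le_last.
by rewrite -ba in last_t *; rewrite eq_last.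
Qed.

(* [gbar a c] is the unique path of length |a - c| from a to c. *)
Lemma gbar_unique (n a c : nat) (gamma : seq nat) : (a <= n)%N -> (c <= n)%N ->
  (is_path n a c gamma && (plen gamma == (a - c) + (c - a))%N)
    = (gamma == gbar a c).
Proof.
have step_iota m k : sorted step (iota m k).
  case: k => //= k; elim: k m => //= k IH m.
  by rewrite /step eqxx !orbT IH.
have stepC x y : step x y = step y x.
  rewrite /step [in RHS](eq_sym x.+1) [in RHS](eq_sym x y).
  rewrite [in RHS](eq_sym x y.+1).
  by case: (y.+1 == x); case: (y == x); case: (y == x.+1).
have up u d g : (u <= n)%N -> (d <= n)%N -> (u <= d)%N ->
    (is_path n u d g && (plen g == d - u)%N) = (g == iota u (d - u).+1).
  move=> un dn ud; apply/idP/eqP => [|->].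
    case: g => [|x t] //; rewrite /is_path /plen /=.
    case/andP => /and4P [/eqP -> /eqP last_t _ /step_path_iota [_ it]] /eqP sz.
    by rewrite -sz; apply: it; rewrite last_t sz subnKC.
  have last_iota : last 0 (iota u (d - u).+1) = d.
    by rewrite -nth_last size_iota nth_iota // subnKC.
  rewrite /is_path /plen size_iota last_iota step_iota !eqxx !andbT /=.
  rewrite un /=; apply/allP => y; rewrite mem_iota addSn subnKC // ltnS.
  by case/andP => _ /leq_trans; apply.
have isrev u d g : is_path n u d g = is_path n d u (rev g).
  case: g => [|x t] //; rewrite /is_path all_rev rev_sorted.
  rewrite (@eq_sorted _ (fun y z => step z y) step) => [|y z]; last exact: stepC.
  have -> : head 0 (rev (x :: t)) = last x t by rewrite lastI rev_rcons.
  have -> : last 0 (rev (x :: t)) = x by rewrite rev_cons last_rcons.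
  by rewrite -!size_eq0 size_rev /= andbCA.
move=> an cn; rewrite /gbar; case: leqP => ac.
  by rewrite -up // (eqP (_ : a - c == 0)%N) ?subn_eq0 // add0n.
rewrite (eqP (_ : c - a == 0)%N) ?subn_eq0 ?(ltnW ac) // addn0.
rewrite isrev.
have -> : plen gamma = plen (rev gamma) by rewrite /plen size_rev.
by rewrite up // ?(ltnW ac) // -(inj_eq (can_inj revK)) revK.
Qed.

Definition L (a : nat) : seq (seq nat) := [seq Lpath a N | N <- iota 0 a.*2.+1].

Definition Pset (n a c : nat) : seq (seq nat) :=
  if (a <= c)%N
  then [seq pcat g (gbar a c) | g <- L a & (plen g <= n - (c - a))%N]
  else [seq pcat (gbar a c) g | g <- L c & (plen g <= n - (a - c))%N].

(* Bases as sets of vectors, of possibly infinite cardinality. *)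
Section Basis.
Local Open Scope classical_set_scope.
Variables (K : fieldType) (V : lmodType K).

Definition lin_indep (B : set V) : Prop :=
  forall (r : seq V) (c : V -> K), uniq r -> (forall v, v \in r -> B v) ->
    \sum_(v <- r) c v *: v = 0 -> forall v, v \in r -> c v = 0.

Definition spanning (B : set V) : Prop :=
  forall w : V, exists (r : seq V) (c : V -> K),
    (forall v, v \in r -> B v) /\ w = \sum_(v <- r) c v *: v.

Definition is_basis (B : set V) : Prop := lin_indep B /\ spanning B.

End Basis.

(* Main.v *)
From HB Require Import structures.
From mathcomp Require Import all_boot all_algebra.
From mathcomp Require Import boolp classical_sets reals complex.
From mathcomp Require Import monalg.
From mathcomp Require Import ring zify.
Require Import Defs.

Set Implicit Arguments.
Unset Strict Implicit.
Unset Printing Implicit Defensive.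

Import GRing.Theory.
Local Open Scope ring_scope.

(** Modulo backtracking, a path is determined by its ends up to a polynomial in
    the central element kappa; the theorem comes down to finding, for each
    pair of ends, the polynomial relation that kappa satisfies.

    Let e_p and f_p be the spectral idempotents of sigma_1 and sigma_2. Read
    between e_p and e_r, the first and the third Askey-Wilson relations are two
    linear equations for the entries of g_2 and g_3. They make g_2 tridiagonal
    ([awd_far]), and give e_p g_2 e_p as a multiple of (kappa + chi_s) e_p
    ([back_loop]). The second relation and the value of Omega, read between
    e_p and e_p, then determine the two backtracking terms
    e_p g_2 e_r g_2 e_p, r = p - 1 and p + 1, as quadratic polynomials in
    kappa, with known roots, times e_p ([back_up], [back_down]). Hence
    x_gamma = P (kappa) x, where x = [xg a c] is the element of the shortest
    path with the same ends ([path_red]), and the degree of P is the length of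
    gamma minus |a - c| ([size_ppoly]). The paths of P_s^(a,c) yield each degree
    0, 1, ..., d exactly once, where d = min (2a, 2c, 2s - |a - c|) is
    [maxdeg].

    Independence. For 0 <= m <= 2s, resp. 0 <= m <= s, tridiagonal matrices of
    size 2s - m + 1, resp. 2s - 2m + 1, provide a representation of A_s in which
    e_p is nonzero for m <= p <= 2s, resp. m <= p <= 2s - m, and kappa is
    chi_(s + m), resp. chi_(s - m) ([representation], [good_large],
    [good_small]). Of these values, d + 1 belong to representations where
    neither e_a nor e_c is zero; there x is not zero either, since the factors
    produced by backtracking are not. A polynomial P of degree at most d with
    P (kappa) x = 0 thus has too many roots ([small_kill]).

    Generation. On e_0 the last relation gives kappa the value chi_s, and so it
    does on f_0, which is conjugate to e_0 by sigma_1 sigma_2 sigma_1. If d is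
    2a or 2c, going from that vertex down to 0 and back yields a polynomial of
    degree d + 1 in kappa that annihilates x. Otherwise one uses
    e_a f_0 e_c = R (kappa) x, where R has degree d because it vanishes at the
    d values of kappa other than chi_s considered above, while e_a f_0 e_c
    does not vanish when kappa is chi_s ([e_f0_e]). In both cases kappa satisfies
    on x an equation of degree d + 1 ([annihilator]), so that the x_gamma in
    question span all the P (kappa) x, and these are stable under left
    multiplication ([path_elt_span]). *)

(** * Lagrange idempotents *)

Lemma horner_algZ (K : fieldType) (A : algType K) (x : A) c (P : {poly K}) :
  horner_alg x (c *: P) = c *: horner_alg x P.
Proof. by rewrite -mul_polyC rmorphM /= horner_algC -scalerAl mul1r. Qed.

Section Lagrange.
Variables (K : fieldType) (lam : nat -> K) (n : nat).

Definition nodes_poly : {poly K} := \prod_(0 <= p < n.+1) ('X - (lam p)%:P).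

(** At a root x of [nodes_poly], [lag r] takes the value of the spectral
    idempotent of x for the eigenvalue lam_r. *)
Definition lag (r : nat) : {poly K} :=
  \prod_(0 <= p < n.+1 | p != r) ((lam r - lam p)^-1 *: ('X - (lam p)%:P)).

Lemma size_lag r : (r <= n)%N -> (size (lag r) <= n.+1)%N.
Proof.
move=> rn; rewrite /lag big_mkcond /= big_mkord.
pose F (i : nat) : {poly K} :=
  if i != r then (lam r - lam i)^-1 *: ('X - (lam i)%:P) else 1.
have IH k : (size (\prod_(i < k) F i)%R <= if r < k then k else k.+1)%N.
  elim: k => [|k IH]; first by rewrite big_ord0 size_poly1.
  rewrite big_ord_recr {2}/F /=; case: eqP => [kr|/eqP kr] /=.
    by rewrite mulr1; move: IH; rewrite kr ltnn ltnSn.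
  rewrite (leq_trans (size_polyMleq _ _)) //.
  have := size_scale_leq (lam r - lam k)^-1 ('X - (lam k)%:P).
  rewrite size_XsubC ltnS; move: IH kr.
  set u := size (\prod_(i < k) F i)%R; set v := size (_ *: _ : {poly K})%R.
  by case: (ltngtP r k); lia.
by have := IH n.+1; rewrite ltnS rn.
Qed.

Hypothesis lam_inj : forall p r, (p <= n)%N -> (r <= n)%N -> lam p = lam r -> p = r.

Lemma lag_node p r : (p <= n)%N -> (lag r).[lam p] = (p == r)%:R.
Proof.
move=> pn; rewrite horner_prod; case: eqP => [pr|/eqP pr].
  rewrite -pr big_seq_cond big1 // => j; rewrite mem_index_iota => /andP[jn jp].
  rewrite hornerZ hornerXsubC mulVf // subr_eq0.
  apply: contraNneq jp => pj; apply/eqP/esym/lam_inj => //; lia.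
rewrite big_mkcond /= (bigD1_seq p) ?iota_uniq ?mem_index_iota //=.
by rewrite pr hornerZ hornerXsubC subrr mulr0 mul0r.
Qed.

(** Polynomials that agree on the nodes take the same value at every element
    whose minimal polynomial has simple roots, all of them nodes. *)
Lemma horner_alg_nodes (A : algType K) (x : A) (P Q : {poly K}) :
    horner_alg x nodes_poly = 0 ->
    (forall p, (p <= n)%N -> P.[lam p] = Q.[lam p]) ->
  horner_alg x P = horner_alg x Q.
Proof.
move=> x0 PQ; apply/eqP; rewrite -subr_eq0 -rmorphB.
have /dvdpP [D ->] : nodes_poly %| P - Q.
  have -> : nodes_poly = \prod_(z <- map lam (iota 0 n.+1)) ('X - z%:P).
    by rewrite big_map /nodes_poly /index_iota subn0.
  apply: uniq_roots_dvdp.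
    apply/allP => z /mapP [p]; rewrite mem_iota => pn zE.
    by rewrite zE /root hornerD hornerN PQ ?subrr //; lia.
  rewrite uniq_rootsE map_inj_in_uniq ?iota_uniq // => i j.
  by rewrite !mem_iota => ? ?; apply: lam_inj; lia.
by rewrite rmorphM /= x0 mulr0.
Qed.

Variables (A : algType K) (x : A).
Hypothesis x0 : horner_alg x nodes_poly = 0.
Local Notation E r := (horner_alg x (lag r)).

Lemma lag_orth p r : E p * E r = if p == r then E p else 0.
Proof.
rewrite -rmorphM; case: eqP => [<-|/eqP pr].
  apply: horner_alg_nodes => // i ile; rewrite hornerM !lag_node //.
  by rewrite -natrM mulnb andbb.
rewrite -(rmorph0 (horner_alg x)); apply: horner_alg_nodes => // i ile.
rewrite hornerM !lag_node // horner0 -natrM mulnb.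
by case: eqP => // ->; rewrite (negPf pr).
Qed.

Lemma lag_gt0 p : (n < p)%N -> E p = 0.
Proof.
move=> np; rewrite -(rmorph0 (horner_alg x)).
apply: horner_alg_nodes => // i ile; rewrite lag_node // horner0.
by case: eqP => // ?; lia.
Qed.

Lemma horner_alg_lag (P : {poly K}) :
  horner_alg x P = \sum_(0 <= r < n.+1) P.[lam r] *: E r.
Proof.
pose Q := \sum_(0 <= r < n.+1) P.[lam r] *: lag r.
rewrite (@horner_alg_nodes _ _ _ Q) // => [|p pn].
  by rewrite raddf_sum; apply: eq_bigr => r _; rewrite /= horner_algZ.
rewrite horner_sum (bigD1_seq p) ?iota_uniq ?mem_index_iota //= big1.
  by rewrite addr0 hornerZ lag_node // eqxx mulr1.
by move=> r rp; rewrite hornerZ lag_node // eq_sym (negPf rp) mulr0.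
Qed.

Lemma lag_sum1 : \sum_(0 <= r < n.+1) E r = 1.
Proof.
transitivity (horner_alg x 1); last exact: rmorph1.
rewrite horner_alg_lag.
by apply: eq_bigr => r _; rewrite hornerC scale1r.
Qed.

Lemma lag_eigen r (P : {poly K}) :
  (r <= n)%N -> horner_alg x P * E r = P.[lam r] *: E r.
Proof.
move=> rn; rewrite -rmorphM -horner_algZ; apply: horner_alg_nodes => // p pn.
rewrite hornerM hornerZ lag_node //.
by case: eqP => [->|] //; rewrite !mulr0.
Qed.

Lemma lag_eigenX r : (r <= n)%N -> x * E r = lam r *: E r.
Proof. by move=> rn; rewrite -{1}(horner_algX x) lag_eigen // hornerX. Qed.

End Lagrange.

Lemma horner_alg_comm (K : fieldType) (A : algType K) (x : A) (P Q : {poly K}) :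
  horner_alg x P * horner_alg x Q = horner_alg x Q * horner_alg x P.
Proof. by rewrite -!rmorphM mulrC. Qed.

Lemma horner_alg_rmorph (K : fieldType) (A B : algType K)
    (f : {rmorphism A -> B}) (x : A) (P : {poly K}) : scalable f ->
  f (horner_alg x P) = horner_alg (f x) P.
Proof.
move=> fZ; elim/poly_ind: P => [|P c IH]; first by rewrite !raddf0.
by rewrite !(rmorphD, rmorphM) /= IH !horner_algX !horner_algC fZ rmorph1.
Qed.

Lemma horner_alg_conj (K : fieldType) (A : algType K) (x u v : A)
    (P : {poly K}) : u * v = 1 -> v * u = 1 ->
  horner_alg (u * x * v) P = u * horner_alg x P * v.
Proof.
move=> uv vu; elim/poly_ind: P => [|P c IH].
  by rewrite !raddf0 mulr0 mul0r.
rewrite !(rmorphD, rmorphM) /= IH !horner_algX !horner_algC mulrDr mulrDl.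
congr (_ + _); last by rewrite -scalerAr mulr1 -scalerAl uv.
by rewrite !mulrA -[_ * v * u]mulrA vu mulr1.
Qed.

Lemma horner_alg_central (K : fieldType) (A : algType K) (x : A) (P : {poly K}) :
  (forall y, x * y = y * x) -> forall y, horner_alg x P * y = y * horner_alg x P.
Proof.
move=> cx y; elim/poly_ind: P => [|P c IH]; first by rewrite !raddf0 mulr0 mul0r.
rewrite !(rmorphD, rmorphM) /= !horner_algX !horner_algC mulrDr mulrDl.
rewrite -scalerAl -scalerAr mulr1 mul1r; congr (_ + _).
by rewrite -mulrA (cx y) [LHS]mulrA IH mulrA.
Qed.

Section LagSpectral.
Variables (K : fieldType) (n : nat) (lam : nat -> K).
Hypothesis lam_inj : forall p r, (p <= n)%N -> (r <= n)%N -> lam p = lam r -> p = r.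
Variables (A : algType K) (x : A).
Hypothesis x0 : horner_alg x (nodes_poly lam n) = 0.

Lemma lag_eigenl r : x * horner_alg x (lag lam n r) = lam r *: horner_alg x (lag lam n r).
Proof.
case: (leqP r n) => rn; first exact: lag_eigenX.
by rewrite (lag_gt0 lam_inj x0) // mulr0 scaler0.
Qed.

Lemma lag_eigenr r : horner_alg x (lag lam n r) * x = lam r *: horner_alg x (lag lam n r).
Proof. by rewrite -{2}(horner_algX x) horner_alg_comm horner_algX lag_eigenl. Qed.

End LagSpectral.

Section ChangeNodes.
Variables (K : fieldType) (n : nat) (lam mu : nat -> K).
Hypothesis lam_inj : forall p r, (p <= n)%N -> (r <= n)%N -> lam p = lam r -> p = r.
Hypothesis mu_inj : forall p r, (p <= n)%N -> (r <= n)%N -> mu p = mu r -> p = r.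
Variables (A : algType K) (x : A).
Hypothesis x0 : horner_alg x (nodes_poly lam n) = 0.

Definition interp : {poly K} := \sum_(0 <= r < n.+1) mu r *: lag lam n r.

Lemma interp_node p : (p <= n)%N -> interp.[lam p] = mu p.
Proof.
move=> pn; rewrite /interp horner_sum (bigD1_seq p) ?iota_uniq ?mem_index_iota //=.
rewrite hornerZ lag_node // eqxx mulr1 big1 ?addr0 // => r rp.
by rewrite hornerZ lag_node // eq_sym (negPf rp) mulr0.
Qed.

Lemma horner_interp (P : {poly K}) : horner_alg (horner_alg x interp) P
  = \sum_(0 <= r < n.+1) P.[mu r] *: horner_alg x (lag lam n r).
Proof.
have -> : horner_alg (horner_alg x interp) P = horner_alg x (P \Po interp).
  elim/poly_ind: P => [|P c IH]; first by rewrite comp_poly0 !raddf0.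
  rewrite comp_poly_MXaddC !(rmorphD, rmorphM) /= IH !horner_algC.
  by rewrite horner_algX.
rewrite (horner_alg_lag lam_inj x0); apply: eq_big_nat => r rn.
by rewrite horner_comp interp_node //; lia.
Qed.

Lemma interp_nodes0 : horner_alg (horner_alg x interp) (nodes_poly mu n) = 0.
Proof.
rewrite horner_interp big_seq big1 // => r; rewrite mem_index_iota => rn.
suff -> : (nodes_poly mu n).[mu r] = 0 by rewrite scale0r.
rewrite horner_prod (bigD1_seq r) ?iota_uniq ?mem_index_iota //=.
by rewrite hornerXsubC subrr mul0r.
Qed.

(** Passing from x to interp (x) only changes the eigenvalues. In this way each
    of sigma_i and g_i is a polynomial in the other. *)
Lemma interp_lag r :
  horner_alg (horner_alg x interp) (lag mu n r) = horner_alg x (lag lam n r).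
Proof.
rewrite horner_interp; case: (leqP r n) => rn; last first.
  rewrite (lag_gt0 lam_inj x0) // big_seq big1 // => p.
  rewrite mem_index_iota => pn; rewrite lag_node //.
  by case: eqP => [?|_]; [lia|rewrite scale0r].
rewrite (bigD1_seq r) ?iota_uniq ?mem_index_iota //= lag_node // eqxx scale1r.
rewrite big_seq_cond big1 ?addr0 // => p; rewrite mem_index_iota => /andP[pn pr].
by rewrite lag_node ?(negPf pr) ?scale0r //; lia.
Qed.

Lemma interpK : \sum_(0 <= r < n.+1) lam r *: horner_alg x (lag lam n r) = x.
Proof.
rewrite -[RHS](horner_algX x) (horner_alg_lag lam_inj x0).
by apply: eq_bigr => r _; rewrite hornerX.
Qed.

End ChangeNodes.

(** * The universal property of an algebra given by relations *)

Section FreeLift.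
Variables (K : fieldType) (B : algType K) (s : 'I_2 -> B).

Definition fmon_val (m : {fmonom 'I_2}) : B := \prod_(i <- (m : seq 'I_2)) s i.

Lemma fmon_val_mmorphism : mmorphism fmon_val.
Proof.
split=> [m1 m2|]; rewrite /fmon_val; first by rewrite fmM big_cat.
by rewrite fm1 big_nil.
Qed.

HB.instance Definition _ :=
  isMultiplicative.Build {fmonom 'I_2} B fmon_val fmon_val_mmorphism.

Definition free_lift (f : free_alg K) : B := mmap (in_alg B) fmon_val f.

Lemma free_lift_additive : additive free_lift.
Proof. exact: mmap_is_additive. Qed.

Lemma free_lift_multiplicative : multiplicative free_lift.
Proof.
apply: commr_mmap_is_multiplicative => g m m'.
by rewrite /GRing.comm /= -scalerAl -scalerAr mul1r mulr1.
Qed.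

Lemma free_lift_scalable : scalable free_lift.
Proof.
by move=> c g; rewrite /free_lift mmapZ /= -scalerAl mul1r.
Qed.

HB.instance Definition _ :=
  GRing.isAdditive.Build (free_alg K) B free_lift free_lift_additive.
HB.instance Definition _ :=
  GRing.isMultiplicative.Build (free_alg K) B free_lift free_lift_multiplicative.
HB.instance Definition _ :=
  GRing.isScalable.Build K (free_alg K) B *:%R free_lift free_lift_scalable.

Lemma free_lift_gen i : free_lift (gen K i) = s i.
Proof.
rewrite /free_lift /gen /mkmalgU mmapU /= scale1r mul1r.
by rewrite /fmon_val fmuE big_seq1.
Qed.

End FreeLift.

Section PresentedLift.
Variables (K : fieldType) (rel : free_alg K -> Prop) (B : algType K).
Variable s : 'I_2 -> B.
Hypothesis rel0 : forall f, rel f -> free_lift s f = 0.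

Lemma free_lift_ideal f : ideal_of rel f -> free_lift s f = 0.
Proof.
elim=> {f} [r /rel0 //||x y _ x0 _ y0|a x _ x0|a x _ x0].
- by rewrite raddf0.
- by rewrite raddfD /= x0 y0 addr0.
- by rewrite rmorphM /= x0 mulr0.
- by rewrite rmorphM /= x0 mul0r.
Qed.

(** The function is indexed by the proof that the relations hold, so that it
    can carry its morphism structure. *)
Definition pres_lift (_ : forall f, rel f -> free_lift s f = 0)
  (u : presented rel) : B := free_lift s (repr u).

Local Notation lift := (pres_lift rel0).

Lemma pres_lift_pr f : lift (pr rel f) = free_lift s f.
Proof.
apply/eqP; rewrite -subr_eq0 /pres_lift -raddfB; apply/eqP/free_lift_ideal/prE.
by rewrite /pr reprK.
Qed.

Lemma pres_lift_additive : additive lift.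
Proof.
move=> u v; have [x ->] := pr_surj u; have [y ->] := pr_surj v.
by rewrite -prN -prD !pres_lift_pr raddfB.
Qed.

Lemma pres_lift_multiplicative : multiplicative lift.
Proof.
split=> [u v|]; last by rewrite -pr1 pres_lift_pr rmorph1.
have [x ->] := pr_surj u; have [y ->] := pr_surj v.
by rewrite -prM !pres_lift_pr rmorphM.
Qed.

Lemma pres_lift_scalable : scalable lift.
Proof.
by move=> k u; have [x ->] := pr_surj u; rewrite -prZ !pres_lift_pr linearZ.
Qed.

HB.instance Definition _ :=
  GRing.isAdditive.Build (presented rel) B lift pres_lift_additive.
HB.instance Definition _ :=
  GRing.isMultiplicative.Build (presented rel) B lift pres_lift_multiplicative.

End PresentedLift.

Section PresentedQuotient.
Variables (K : fieldType) (rel rel' : free_alg K -> Prop).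
Hypothesis sub_rel : forall f, rel f -> rel' f.

Lemma ideal_sub f : ideal_of rel f -> ideal_of rel' f.
Proof.
elim=> {f} [r /sub_rel /ideal_gen //||x y _ Ix _ Iy|a x _ Ix|a x _ Ix].
- exact: ideal0.
- exact: idealD.
- exact: idealMl.
- exact: idealMr.
Qed.

Definition pres_quot (_ : forall f, rel f -> rel' f) (u : presented rel) :
  presented rel' := pr rel' (repr u).

Local Notation quot := (pres_quot sub_rel).

Lemma pres_quot_pr f : quot (pr rel f) = pr rel' f.
Proof. by apply/prE/ideal_sub/prE; rewrite /pr reprK. Qed.

Lemma pres_quot_additive : additive quot.
Proof.
move=> u v; have [x ->] := pr_surj u; have [y ->] := pr_surj v.
by rewrite -prN -prD !pres_quot_pr prD prN.
Qed.

Lemma pres_quot_multiplicative : multiplicative quot.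
Proof.
split=> [u v|]; last by rewrite -!pr1 pres_quot_pr.
have [x ->] := pr_surj u; have [y ->] := pr_surj v.
by rewrite -prM !pres_quot_pr prM.
Qed.

Lemma pres_quot_scalable : scalable quot.
Proof.
by move=> k u; have [x ->] := pr_surj u; rewrite -prZ !pres_quot_pr prZ.
Qed.

HB.instance Definition _ :=
  GRing.isAdditive.Build (presented rel) (presented rel') quot
    pres_quot_additive.
HB.instance Definition _ :=
  GRing.isMultiplicative.Build (presented rel) (presented rel') quot
    pres_quot_multiplicative.

End PresentedQuotient.

Lemma presented_ind (K : fieldType) (rel : free_alg K -> Prop)
    (P : presented rel -> Prop) :
    P 1 -> (forall i, P (pr rel (gen K i))) ->
    (forall u v, P u -> P v -> P (u + v)) ->
    (forall u v, P u -> P v -> P (u * v)) ->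
    (forall k u, P u -> P (k *: u)) ->
  forall u, P u.
Proof.
move=> P1 Pgen PD PM PZ u; have [f ->] := pr_surj u.
have P0 : P 0 by rewrite -(scale0r (1 : presented rel)); apply: PZ.
suff Pmon (m : {fmonom 'I_2}) : P (pr rel (mkmalgU m 1 : free_alg K)).
  rewrite (_ : f = \sum_(m <- finmap.enum_fset (msupp f)) f@_m *: (mkmalgU m 1 : free_alg K)).
    elim/big_ind: _ => [|x y Px Py|m _]; first by rewrite pr0.
      by rewrite prD; apply: PD.
    by rewrite prZ; apply/PZ/Pmon.
  rewrite {1}[f]monalgE; apply: eq_bigr => m _.
  by apply/malgP => k; rewrite [RHS]mcoeffZ !mcoeffU mulrnAr mulr1.
case: m => l; elim: l => [|i l IH].
  have -> : (mkmalgU (FMonom [::]) 1 : free_alg K) = 1.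
    congr mkmalgU; apply/val_inj; by rewrite /= fm1.
  by rewrite pr1.
have -> : (mkmalgU (FMonom (i :: l)) 1 : free_alg K)
    = gen K i * (mkmalgU (FMonom l) 1 : free_alg K).
  rewrite /gen [RHS]malgM_def fgmulUU mulr1; congr mkmalgU.
  by apply/val_inj; rewrite /= fmM fmuE.
by rewrite prM; apply: PM.
Qed.

(** * Models of the defining relations *)

Lemma conj_sqr (R : pzRingType) (s y i : R) : i * s = 1 ->
  s * (y * y) * i = (s * y * i) * (s * y * i).
Proof. by move=> il; rewrite !mulrA -[_ * i * s]mulrA il mulr1. Qed.

Lemma mul_conj (R : pzRingType) (x y s i : R) :
  x * y * s * y * i = x * y * (s * y * i).
Proof. by rewrite !mulrA. Qed.

Section Model.
Variables (K : fieldType) (q : K) (n : nat).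

(** By this choice of values, g_i = cas_poly (sigma_i). *)
Definition cas_poly : {poly K} := interp n (qp q) (fun r => chi q r.*2).

Section InAlg.
Variable B : algType K.

Definition cas (s : B) : B := horner_alg s cas_poly.

Definition awl (x y z : B) : B :=
  (q ^+ 2 - q ^- 2)^-1 *: (q *: (x * y) - q^-1 *: (y * x)) + z.

Definition kap_of (C : B) : B := ((q + q^-1) / chi q n) *: C - (chi q n)%:A.

Definition omega (x y z k : B) : B :=
  chi q n *: (k + (chi q n)%:A) * (q *: x + q^-1 *: y + q *: z)
  - q ^+ 2 *: x ^+ 2 - q ^- 2 *: y ^+ 2 - q ^+ 2 *: z ^+ 2
  - q *: (x * y * z).

(** The relations of A_s, for elements of an arbitrary algebra: what follows
    from them is thus proved once, for matrices and for A_s itself. Here i1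
    stands for the inverse of sigma_1 and k for kappa. *)
Record model (s1 s2 i1 k g3 : B) : Prop := Model {
  mdl_inv : i1 * s1 = 1 /\ s1 * i1 = 1;
  mdl_g3 : g3 = s1 * cas s2 * i1;
  mdl_kap : k = kap_of (awl (cas s1) (cas s2) g3);
  mdl_braid : s1 * s2 * s1 = s2 * s1 * s2;
  mdl_nodes1 : horner_alg s1 (nodes_poly (qp q) n) = 0;
  mdl_nodes2 : horner_alg s2 (nodes_poly (qp q) n) = 0;
  mdl_AW2 : awl (cas s2) g3 (cas s1) = awl (cas s1) (cas s2) g3;
  mdl_AW3 : awl g3 (cas s1) (cas s2) = awl (cas s1) (cas s2) g3;
  mdl_central : forall y, k * y = y * k;
  mdl_omega : omega (cas s1) (cas s2) g3 k
    = k * (k + (chi q n ^+ 3)%:A) + (3%:R * chi q n ^+ 2 - chi q 0 ^+ 2)%:A;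
  mdl_e0 : horner_alg s1 (lag (qp q) n 0) * cas s2 * horner_alg s1 (lag (qp q) n 0)
    = (chi q n ^+ 2 / chi q 0) *: horner_alg s1 (lag (qp q) n 0) }.

End InAlg.

Hypothesis q0 : q != 0.

(** A morphism theta to an algebra turns the elements of the presented algebra
    into polynomial expressions in theta (sigma_1), theta (sigma_2). It is
    carried through a term one operation at a time, by transitivity, so that the
    operations of the quotient are never unfolded. *)
Section Image.
Variables (B : algType K) (rel : free_alg K -> Prop).
Hypothesis sub_rel : forall f, B3_rel q n f -> rel f.
Variable theta : {rmorphism presented rel -> B}.
Hypothesis thetaZ : scalable theta.

Local Notation s1 := (theta (sigma1 rel)).
Local Notation s2 := (theta (sigma2 rel)).
Local Notation i1 := (theta (inv_of (sigma1 rel))).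
Local Notation G3 := (s1 * cas s2 * i1).

Lemma theta_inv : i1 * s1 = 1 /\ s1 * i1 = 1.
Proof.
by have [il ir] := sigma1_inv q0 sub_rel; rewrite -!rmorphM il ir rmorph1.
Qed.

Lemma theta_cst k : theta (cst rel k) = k%:A.
Proof. by rewrite /cst thetaZ rmorph1. Qed.

Lemma theta_idem (x : presented rel) r :
  theta (idem q n x r) = horner_alg (theta x) (lag (qp q) n r).
Proof.
rewrite /idem /lag !rmorph_prod; apply: eq_bigr => p _ /=.
by rewrite thetaZ horner_algZ !rmorphB /= horner_algX horner_algC theta_cst.
Qed.

Lemma theta_cas (x : presented rel) :
  theta (\sum_(0 <= r < n.+1) chi q r.*2 *: idem q n x r) = cas (theta x).
Proof.
rewrite /cas /cas_poly /interp !raddf_sum; apply: eq_bigr => r _ /=.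
by rewrite thetaZ horner_algZ theta_idem.
Qed.

Lemma theta_e1 r : theta (e1 q n rel r) = horner_alg s1 (lag (qp q) n r).
Proof. exact: theta_idem. Qed.

Lemma theta_g1 : theta (g1 q n rel) = cas s1. Proof. exact: theta_cas. Qed.
Lemma theta_g2 : theta (g2 q n rel) = cas s2. Proof. exact: theta_cas. Qed.

Lemma theta_g3 : theta (g3 q n rel) = G3.
Proof. by rewrite !rmorphM theta_g2. Qed.

Lemma theta_awl (x y z : presented rel) :
  theta ((q ^+ 2 - q ^- 2)^-1 *: qcomm q x y + z)
    = awl (theta x) (theta y) (theta z).
Proof.
apply: (etrans (rmorphD theta _ _)); congr (_ + _).
apply: (etrans (thetaZ _ _)); congr (_ *: _).
apply: (etrans (rmorphB theta _ _)); congr (_ - _);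
  by apply: (etrans (thetaZ _ _)); congr (_ *: _); apply: (rmorphM theta).
Qed.

Lemma theta_AW1 : theta (AW1 q n rel) = awl (cas s1) (cas s2) G3.
Proof.
apply: (etrans (theta_awl (g1 q n rel) (g2 q n rel) (g3 q n rel))).
congr awl; [exact: theta_g1|exact: theta_g2|exact: theta_g3].
Qed.

Lemma theta_AW2 : theta (AW2 q n rel) = awl (cas s2) G3 (cas s1).
Proof.
apply: (etrans (theta_awl (g2 q n rel) (g3 q n rel) (g1 q n rel))).
congr awl; [exact: theta_g2|exact: theta_g3|exact: theta_g1].
Qed.

Lemma theta_AW3 : theta (AW3 q n rel) = awl G3 (cas s1) (cas s2).
Proof.
apply: (etrans (theta_awl (g3 q n rel) (g1 q n rel) (g2 q n rel))).
congr awl; [exact: theta_g3|exact: theta_g1|exact: theta_g2].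
Qed.

Lemma theta_kappa :
  theta (kappa q n rel) = kap_of (awl (cas s1) (cas s2) G3).
Proof.
rewrite -theta_AW1 /kappa; apply: (etrans (rmorphB theta _ _)).
by congr (_ - _); [apply: thetaZ|apply: theta_cst].
Qed.

Lemma theta_omega (x y z k v w : presented rel) : w = z * z -> v = x * y * z ->
  theta (chi q n *: (k + cst rel (chi q n)) * (q *: x + q^-1 *: y + q *: z)
    - q ^+ 2 *: x ^+ 2 - q ^- 2 *: y ^+ 2 - q ^+ 2 *: w - q *: v)
  = omega (theta x) (theta y) (theta z) (theta k).
Proof.
move=> -> ->; rewrite /omega !expr2.
apply: (etrans (rmorphB theta _ _)); congr (_ - _); last first.
  apply: (etrans (thetaZ _ _)); congr (_ *: _).
  by apply: (etrans (rmorphM theta _ _)); congr (_ * _); apply: (rmorphM theta).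
apply: (etrans (rmorphB theta _ _)); congr (_ - _); last first.
  by apply: (etrans (thetaZ _ _)); congr (_ *: _); apply: (rmorphM theta).
apply: (etrans (rmorphB theta _ _)); congr (_ - _); last first.
  by apply: (etrans (thetaZ _ _)); congr (_ *: _); apply: (rmorphM theta).
apply: (etrans (rmorphB theta _ _)); congr (_ - _); last first.
  by apply: (etrans (thetaZ _ _)); congr (_ *: _); apply: (rmorphM theta).
apply: (etrans (rmorphM theta _ _)); congr (_ * _).
  apply: (etrans (thetaZ _ _)); congr (_ *: _).
  by apply: (etrans (rmorphD theta _ _)); congr (_ + _); apply: theta_cst.
apply: (etrans (rmorphD theta _ _)); congr (_ + _); last exact: thetaZ.
by apply: (etrans (rmorphD theta _ _)); congr (_ + _); apply: thetaZ.
Qed.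

Lemma theta_Omega : theta (Omega q n rel)
  = omega (cas s1) (cas s2) G3 (kap_of (awl (cas s1) (cas s2) G3)).
Proof.
have [il _] := sigma1_inv q0 sub_rel.
apply: (etrans (theta_omega (kappa q n rel) (conj_sqr (g2 q n rel) il)
  (mul_conj (g1 q n rel) _ _ _))).
congr omega; [exact: theta_g1|exact: theta_g2|exact: theta_g3|].
exact: theta_kappa.
Qed.

Lemma theta_quadratic (x k : presented rel) a b :
  theta (x - (k * (k + cst rel a) + cst rel b))
    = theta x - (theta k * (theta k + a%:A) + b%:A).
Proof.
apply: (etrans (rmorphB theta _ _)); congr (_ - _).
apply: (etrans (rmorphD theta _ _)); congr (_ + _); last exact: theta_cst.
apply: (etrans (rmorphM theta _ _)); congr (_ * _).
by apply: (etrans (rmorphD theta _ _)); congr (_ + _); apply: theta_cst.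
Qed.

Lemma theta_corner (e g : presented rel) c :
  theta (e * g * e - c *: e) = theta e * theta g * theta e - c *: theta e.
Proof.
apply: (etrans (rmorphB theta _ _)); congr (_ - _); last exact: thetaZ.
by apply: (etrans (rmorphM theta _ _)); congr (_ * _); apply: (rmorphM theta).
Qed.

Lemma theta_xpath a t : theta (xpath q n rel (a :: t))
  = horner_alg s1 (lag (qp q) n a)
    * \prod_(b <- t) (cas s2 * horner_alg s1 (lag (qp q) n b)).
Proof.
apply: (etrans (rmorphM theta _ _)); congr (_ * _); first exact: theta_e1.
apply: (etrans (rmorph_prod theta _ _ _)); apply: eq_bigr => b _.
apply: (etrans (rmorphM theta _ _)).
by congr (_ * _); [exact: theta_g2|exact: theta_e1].
Qed.

Lemma theta_nodes_poly (f : free_alg K) :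
  theta (pr rel (\prod_(0 <= p < n.+1) (f - (qp q p)%:A)))
    = horner_alg (theta (pr rel f)) (nodes_poly (qp q) n).
Proof.
have prP (I : Type) (r : seq I) (F : I -> free_alg K) :
    theta (pr rel (\prod_(p <- r) F p)) = \prod_(p <- r) theta (pr rel (F p)).
  elim: r => [|p r IH]; first by rewrite !big_nil pr1 rmorph1.
  by rewrite !big_cons -IH -rmorphM -prM.
rewrite prP /nodes_poly rmorph_prod; apply: eq_bigr => p _ /=.
rewrite rmorphB /= horner_algX horner_algC prD prN.
apply: (etrans (rmorphB theta _ _)); congr (_ - _).
by rewrite prZ; apply: theta_cst.
Qed.

Lemma theta_nodes1 : horner_alg s1 (nodes_poly (qp q) n) = 0.
Proof.
rewrite /sigma1 -theta_nodes_poly; apply: (etrans _ (rmorph0 theta)).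
congr (theta _); rewrite -pr0; apply/prE; rewrite subr0.
by apply/ideal_gen/sub_rel; constructor 2.
Qed.

Lemma theta_nodes2 : horner_alg s2 (nodes_poly (qp q) n) = 0.
Proof.
rewrite /sigma2 -theta_nodes_poly; apply: (etrans _ (rmorph0 theta)).
congr (theta _); rewrite -pr0; apply/prE; rewrite subr0.
by apply/ideal_gen/sub_rel; constructor 3.
Qed.

Lemma theta_braid : s1 * s2 * s1 = s2 * s1 * s2.
Proof.
have prM3 (f g h : free_alg K) :
    theta (pr rel f) * theta (pr rel g) * theta (pr rel h)
      = theta (pr rel (f * g * h)).
  rewrite 2!prM; apply: esym; apply: (etrans (rmorphM theta _ _)).
  by congr (_ * _); apply: rmorphM.
apply: (etrans (prM3 (gen K 0) (gen K 1) (gen K 0))); apply: esym.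
apply: (etrans (prM3 (gen K 1) (gen K 0) (gen K 1))); apply: esym.
apply: (congr1 theta).
apply: (proj2 (prE _ _ _)).
apply: ideal_gen.
apply: sub_rel.
by constructor 1.
Qed.

End Image.

End Model.

Section ModelLift.
Variables (K : fieldType) (q : K) (n : nat).
Hypothesis q0 : q != 0.

Lemma AWB3_sub f : B3_rel q n f -> AWB3_rel q n f. Proof. by left. Qed.
Lemma As_sub f : AWB3_rel q n f -> As_rel q n f. Proof. by left. Qed.
Lemma B3_As_sub f : B3_rel q n f -> As_rel q n f.
Proof. by move/AWB3_sub/As_sub. Qed.

Section Sound.
Variables (B : algType K) (s1 s2 i1 k g3 : B).
Hypothesis M : model q n s1 s2 i1 k g3.

Definition two_gen (i : 'I_2) : B := if i == 0 then s1 else s2.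
Local Notation psi := (free_lift two_gen).

Lemma psi_gen0 : psi (gen K 0) = s1. Proof. by rewrite free_lift_gen. Qed.
Lemma psi_gen1 : psi (gen K 1) = s2. Proof. by rewrite free_lift_gen. Qed.

Lemma psi_nodes (g : free_alg K) :
  psi (\prod_(0 <= p < n.+1) (g - (qp q p)%:A))
    = horner_alg (psi g) (nodes_poly (qp q) n).
Proof.
rewrite /nodes_poly !rmorph_prod; apply: eq_bigr => p _ /=.
by rewrite !rmorphB /= horner_algX horner_algC linearZ /= rmorph1.
Qed.

Lemma psi_B3 f : B3_rel q n f -> psi f = 0.
Proof.
have psiM3 (x y z : free_alg K) : psi (x * y * z) = psi x * psi y * psi z.
  by rewrite (rmorphM psi (x * y)) (rmorphM psi x).
case=> ->.
- apply: (etrans (rmorphB psi _ _)); apply/eqP; rewrite subr_eq0; apply/eqP.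
  apply: (etrans (psiM3 _ _ _)); apply: (etrans _ (esym (psiM3 _ _ _))).
  by rewrite psi_gen0 psi_gen1 (mdl_braid M).
- by rewrite psi_nodes psi_gen0 (mdl_nodes1 M).
- by rewrite psi_nodes psi_gen1 (mdl_nodes2 M).
Qed.

Section Above.
Variables (rel : free_alg K -> Prop) (rel0 : forall f, rel f -> psi f = 0).
Hypothesis sub_rel : forall f, B3_rel q n f -> rel f.
Local Notation L := (pres_lift rel0).

Lemma lift_s1 : L (sigma1 rel) = s1.
Proof. by rewrite /sigma1 pres_lift_pr psi_gen0. Qed.

Lemma lift_s2 : L (sigma2 rel) = s2.
Proof. by rewrite /sigma2 pres_lift_pr psi_gen1. Qed.

Lemma lift_i1 : L (inv_of (sigma1 rel)) = i1.
Proof.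
have [/= il _] := theta_inv q0 sub_rel (pres_lift rel0).
have [_ ir] := mdl_inv M.
rewrite -[LHS]mulr1 -ir mulrA; rewrite lift_s1 in il.
by rewrite il mul1r.
Qed.

Lemma lift_G3 : L (sigma1 rel) * cas q n (L (sigma2 rel)) * L (inv_of (sigma1 rel)) = g3.
Proof. by rewrite lift_s1 lift_s2 lift_i1 (mdl_g3 M). Qed.

Lemma lift_AW1 : L (AW1 q n rel) = awl q (cas q n s1) (cas q n s2) g3.
Proof.
apply: (etrans (theta_AW1 q n (pres_lift_scalable rel0))).
by rewrite /= lift_G3 lift_s1 lift_s2.
Qed.

Lemma lift_AW2 : L (AW2 q n rel) = awl q (cas q n s1) (cas q n s2) g3.
Proof.
apply: (etrans (theta_AW2 q n (pres_lift_scalable rel0))).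
by rewrite /= lift_G3 lift_s1 lift_s2 (mdl_AW2 M).
Qed.

Lemma lift_AW3 : L (AW3 q n rel) = awl q (cas q n s1) (cas q n s2) g3.
Proof.
apply: (etrans (theta_AW3 q n (pres_lift_scalable rel0))).
by rewrite /= lift_G3 lift_s1 lift_s2 (mdl_AW3 M).
Qed.

Lemma lift_kappa : L (kappa q n rel) = k.
Proof.
apply: (etrans (theta_kappa q n (pres_lift_scalable rel0))).
by rewrite /= lift_G3 lift_s1 lift_s2 (mdl_kap M).
Qed.

Lemma lift_Omega : L (Omega q n rel) = omega q n (cas q n s1) (cas q n s2) g3 k.
Proof.
apply: (etrans (theta_Omega q0 sub_rel (pres_lift_scalable rel0))).
by rewrite /= lift_G3 lift_s1 lift_s2 (mdl_kap M).
Qed.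

End Above.

Lemma AW1_central (y : B) : chi q n != 0 -> q + q^-1 != 0 ->
  awl q (cas q n s1) (cas q n s2) g3 * y = y * awl q (cas q n s1) (cas q n s2) g3.
Proof.
move=> c0 qq0; have := mdl_central M y; rewrite (mdl_kap M) /kap_of.
move: (awl _ _ _ _) => C; rewrite mulrBl mulrBr -!scalerAl -!scalerAr mul1r mulr1.
move/addIr/scalerI; apply; rewrite mulf_neq0 ?invr_eq0 //.
Qed.

Hypothesis c0 : chi q n != 0.
Hypothesis qq0 : q + q^-1 != 0.

Lemma psi_AWB3 f : AWB3_rel q n f -> psi f = 0.
Proof.
case=> [/psi_B3 //|Sf].
have <- : pres_lift psi_B3 (pr (B3_rel q n) f) = psi f by exact: pres_lift_pr.
have sub g : B3_rel q n g -> B3_rel q n g by [].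
case: Sf => [->|->|[y ->]].
- apply: (etrans (rmorphB (pres_lift psi_B3) _ _)); apply/eqP; rewrite subr_eq0.
  apply/eqP; exact: (etrans (lift_AW1 psi_B3 sub) (esym (lift_AW2 psi_B3 sub))).
- apply: (etrans (rmorphB (pres_lift psi_B3) _ _)); apply/eqP; rewrite subr_eq0.
  apply/eqP; exact: (etrans (lift_AW1 psi_B3 sub) (esym (lift_AW3 psi_B3 sub))).
- apply: (etrans (rmorphB (pres_lift psi_B3) _ _)); apply/eqP; rewrite subr_eq0.
  apply/eqP; apply: (etrans (rmorphM (pres_lift psi_B3) _ _)).
  apply/esym; apply: (etrans (rmorphM (pres_lift psi_B3) _ _)).
  have /= E := lift_AW1 psi_B3 sub.
  by rewrite /= E AW1_central.
Qed.

Lemma psi_As f : As_rel q n f -> psi f = 0.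
Proof.
case=> [/psi_AWB3 //|Sf].
pose L : {rmorphism presented (AWB3_rel q n) -> B} := pres_lift psi_AWB3.
have LZ : scalable L by exact: pres_lift_scalable.
have <- : L (pr (AWB3_rel q n) f) = psi f by exact: pres_lift_pr.
have Lk := lift_kappa psi_AWB3 AWB3_sub.
have Ls1 : L (sigma1 _) = s1 by exact: lift_s1.
have Ls2 : L (sigma2 _) = s2 by exact: lift_s2.
have Le : L (e1 q n (AWB3_rel q n) 0) = horner_alg s1 (lag (qp q) n 0).
  by apply: (etrans (theta_e1 q n LZ 0)); rewrite Ls1.
have Lg : L (g2 q n (AWB3_rel q n)) = cas q n s2.
  by apply: (etrans (theta_g2 q n LZ)); rewrite Ls2.
have LO := lift_Omega psi_AWB3 AWB3_sub.
case: Sf => ->.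
  have Z (u v : B) : u = omega q n (cas q n s1) (cas q n s2) g3 k -> v = k ->
      u - (v * (v + (chi q n ^+ 3)%:A) + (3%:R * chi q n ^+ 2 - chi q 0 ^+ 2)%:A) = 0.
    by move=> -> ->; rewrite (mdl_omega M) subrr.
  exact: (etrans (theta_quadratic LZ _ _ _ _) (Z _ _ LO Lk)).
have Z (u v : B) : u = horner_alg s1 (lag (qp q) n 0) -> v = cas q n s2 ->
    u * v * u - (chi q n ^+ 2 / chi q 0) *: u = 0.
  by move=> -> ->; rewrite (mdl_e0 M) subrr.
exact: (etrans (theta_corner LZ _ _ _) (Z _ _ Le Lg)).
Qed.

(** A model kills the relations of A_s. As the relations of each of the three
    quotients are elements of the previous one, this is obtained in three
    steps, each using the morphism that the previous one provides. *)
Theorem model_lift : exists phi : {rmorphism presented (As_rel q n) -> B},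
  [/\ scalable phi, phi (sigma1 _) = s1, phi (sigma2 _) = s2
    & phi (kappa q n _) = k].
Proof.
exists (pres_lift psi_As : {rmorphism presented (As_rel q n) -> B}); split.
- exact: pres_lift_scalable.
- exact: lift_s1.
- exact: lift_s2.
- exact: (lift_kappa psi_As B3_As_sub).
Qed.

End Sound.

Section Complete.
Variables (B : algType K) (theta : {rmorphism presented (As_rel q n) -> B}).
Hypothesis thetaZ : scalable theta.
Hypothesis theta_surj : forall y, exists u, y = theta u.

Local Notation s1 := (theta (sigma1 (As_rel q n))).
Local Notation s2 := (theta (sigma2 (As_rel q n))).
Local Notation i1 := (theta (inv_of (sigma1 (As_rel q n)))).
Local Notation G3 := (s1 * cas q n s2 * i1).
Local Notation C := (awl q (cas q n s1) (cas q n s2) G3).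

Section Below.
Variables (rel : free_alg K -> Prop).
Hypotheses (sub : forall f, B3_rel q n f -> rel f).
Hypotheses (sub_As : forall f, rel f -> As_rel q n f).

Definition down : {rmorphism presented rel -> B} :=
  theta \o pres_quot sub_As.

Lemma downE f : down (pr rel f) = theta (pr (As_rel q n) f).
Proof. exact: (congr1 theta (pres_quot_pr sub_As f)). Qed.

Lemma downZ : scalable down.
Proof.
move=> k u; apply: (etrans (congr1 theta (pres_quot_scalable sub_As k u))).
exact: thetaZ.
Qed.

Lemma down_s1 : down (sigma1 rel) = s1. Proof. exact: downE. Qed.
Lemma down_s2 : down (sigma2 rel) = s2. Proof. exact: downE. Qed.

Lemma down_i1 : down (inv_of (sigma1 rel)) = i1.
Proof.
have [il _] := theta_inv q0 sub down; rewrite down_s1 in il.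
have [_ ir] := theta_inv q0 B3_As_sub theta.
by rewrite -[LHS]mulr1 -ir mulrA il mul1r.
Qed.

Lemma down_rel (x : presented rel) :
  (forall f, x = pr rel f -> As_rel q n f) -> down x = 0.
Proof.
have [f ->] := pr_surj x => Rf; rewrite downE -(rmorph0 theta).
apply: (congr1 theta); rewrite -pr0; apply/prE; rewrite subr0.
by apply/ideal_gen/Rf.
Qed.

End Below.

(** The relations are pulled back to the algebras B_3^s and AWB_3^s where they
    are imposed. Surjectivity is what makes the image of kappa central. *)
Theorem As_model : model q n s1 s2 i1 (theta (kappa q n _)) G3.
Proof.
pose D1 := down B3_As_sub; pose D2 := down As_sub.
have id1 g : B3_rel q n g -> B3_rel q n g by [].
have D1Z : scalable D1 by exact: downZ.
have D2Z : scalable D2 by exact: downZ.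
have D1s1 : D1 (sigma1 _) = s1 by exact: down_s1.
have D1s2 : D1 (sigma2 _) = s2 by exact: down_s2.
have D1i1 : D1 (inv_of (sigma1 _)) = i1 by exact: down_i1.
have D2s1 : D2 (sigma1 _) = s1 by exact: down_s1.
have D2s2 : D2 (sigma2 _) = s2 by exact: down_s2.
have D2i1 : D2 (inv_of (sigma1 _)) = i1 by apply: down_i1; apply: AWB3_sub.
have A1 : D1 (AW1 q n _) = C.
  by apply: (etrans (theta_AW1 q n D1Z)); rewrite D1s1 D1s2 D1i1.
have A2 : D1 (AW2 q n _) = awl q (cas q n s2) G3 (cas q n s1).
  by apply: (etrans (theta_AW2 q n D1Z)); rewrite D1s1 D1s2 D1i1.
have A3 : D1 (AW3 q n _) = awl q G3 (cas q n s1) (cas q n s2).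
  by apply: (etrans (theta_AW3 q n D1Z)); rewrite D1s1 D1s2 D1i1.
have kC : theta (kappa q n _) = kap_of q n C by exact: theta_kappa.
have D1rel x : [\/ x = AW1 q n (B3_rel q n) - AW2 q n (B3_rel q n),
        x = AW1 q n (B3_rel q n) - AW3 q n (B3_rel q n)
      | exists y, x = AW1 q n (B3_rel q n) * y - y * AW1 q n (B3_rel q n)] ->
    D1 x = 0.
  move=> Sx; apply: down_rel => f xf; left; right; rewrite -xf.
  exact: Sx.
have Ccent y : C * y = y * C.
  have [u ->] := theta_surj y; have [f ->] := pr_surj u.
  have [g gE] : exists x, D1 x = theta (pr (As_rel q n) f).
    by exists (pr (B3_rel q n) f); apply: downE.
  apply/eqP; rewrite -gE -A1 -subr_eq0 -!rmorphM -rmorphB; apply/eqP/D1rel.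
  by constructor 3; exists g.
split=> //.
- exact: (theta_inv q0 B3_As_sub theta).
- exact: (theta_braid B3_As_sub theta).
- exact: (theta_nodes1 B3_As_sub thetaZ).
- exact: (theta_nodes2 B3_As_sub thetaZ).
- rewrite -A2 -A1; apply/esym/eqP; rewrite -subr_eq0 -rmorphB.
  by apply/eqP/D1rel; constructor 1.
- rewrite -A3 -A1; apply/esym/eqP; rewrite -subr_eq0 -rmorphB.
  by apply/eqP/D1rel; constructor 2.
- move=> y; rewrite kC /kap_of mulrBl mulrBr -!scalerAl -!scalerAr Ccent.
  by rewrite mul1r mulr1.
- have D2k : D2 (kappa q n _) = theta (kappa q n _).
    rewrite kC; apply: (etrans (theta_kappa q n D2Z)).
    by rewrite D2s1 D2s2 D2i1.
  have O2 : D2 (Omega q n _)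
      = omega q n (cas q n s1) (cas q n s2) G3 (theta (kappa q n _)).
    rewrite kC; apply: (etrans (theta_Omega q0 AWB3_sub D2Z)).
    by rewrite D2s1 D2s2 D2i1.
  apply/eqP; rewrite -O2 -D2k -subr_eq0 -(theta_quadratic D2Z); apply/eqP.
  by apply: down_rel => f xf; right; left; rewrite -xf.
- have E0 : D2 (e1 q n _ 0) = horner_alg s1 (lag (qp q) n 0).
    by apply: (etrans (theta_e1 q n D2Z 0)); rewrite D2s1.
  have G2 : D2 (g2 q n _) = cas q n s2.
    by apply: (etrans (theta_g2 q n D2Z)); rewrite D2s2.
  apply/eqP; rewrite -E0 -G2 -subr_eq0 -(theta_corner D2Z); apply/eqP.
  by apply: down_rel => f xf; right; right; rewrite -xf.
Qed.

End Complete.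

End ModelLift.

(** * Powers of q *)

(** The eigenvalues q_p, as well as the chi_p, are then distinct, and the
    denominators met below do not vanish. *)
Definition qfree (K : fieldType) (q : K) : Prop :=
  [/\ q != 0, 2%:R != 0 :> K & forall m, (0 < m)%N -> q ^+ m != 1].

Section QArith.
Variables (K : fieldType) (q : K).
Hypothesis qf : qfree q.

Lemma qf0 : q != 0. Proof. by have [] := qf. Qed.

Lemma qX0 m : q ^+ m != 0. Proof. by rewrite expf_neq0 // qf0. Qed.

Lemma qX_eq i j : (q ^+ i == q ^+ j) = (i == j).
Proof.
have wlg a b : (a < b)%N -> q ^+ a != q ^+ b.
  move=> ab; rewrite -[b](subnK (ltnW ab)) exprD eq_sym.
  rewrite -subr_eq0 -{2}[q ^+ a]mul1r -mulrBl mulf_neq0 ?qX0 //.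
  by rewrite subr_eq0; case: qf => _ _; apply; rewrite subn_gt0.
by case: (ltngtP i j) => [/wlg /negPf//|/wlg|->]; rewrite ?eqxx // eq_sym => /negPf.
Qed.

Lemma qX_sub i j : i != j -> q ^+ i - q ^+ j != 0.
Proof. by rewrite subr_eq0 qX_eq. Qed.

Lemma qX1_sub i : (0 < i)%N -> q ^+ i - 1 != 0.
Proof. by move=> i0; rewrite -(expr0 q) qX_sub //; case: i i0. Qed.

Lemma qX1_add i : q ^+ i + 1 != 0.
Proof.
case: i => [|i]; first by rewrite expr0; case: qf.
have := @qX1_sub (i.+1 * 2); rewrite muln_gt0 exprM => /(_ isT).
by rewrite subr_sqr_1 mulf_eq0 negb_or => /andP[].
Qed.

Lemma chiE m : chi q m = (q ^+ (m.+1 * 2) + 1) / q ^+ m.+1.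
Proof.
by rewrite /chi mulrDl mul1r exprM expr2 mulfK // qX0.
Qed.

Lemma chi0 m : chi q m != 0.
Proof. by rewrite chiE mulf_neq0 ?invr_eq0 ?qX0 // qX1_add. Qed.

Lemma chi0E : chi q 0 = q + q^-1. Proof. by rewrite /chi !expr1. Qed.

Lemma chi_inj i j : chi q i = chi q j -> i = j.
Proof.
have Q a := qX0 a; move=> cij; apply/eqP.
have : (q ^+ i.+1 - q ^+ j.+1) * (q ^+ (i.+1 + j.+1) - 1) == 0.
  rewrite exprD; apply/eqP; move: cij; rewrite /chi.
  move: (q ^+ i.+1) (q ^+ j.+1) (Q i.+1) (Q j.+1) => x y x0 y0 cxy.
  transitivity (x * y * ((x + x^-1) - (y + y^-1))); first by field; apply/andP.
  by rewrite cxy subrr mulr0.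
by rewrite mulf_eq0 (negPf (qX1_sub _)) // orbF subr_eq0 qX_eq eqSS.
Qed.

Lemma q2_sub : q ^+ 2 - q ^- 2 != 0.
Proof.
have -> : q ^+ 2 - q ^- 2 = (q ^+ 4 - 1) / q ^+ 2 by field; rewrite qf0.
by rewrite mulf_neq0 ?invr_eq0 ?qX0 // qX1_sub.
Qed.

Lemma qp_inj p r : qp q p = qp q r -> p = r.
Proof.
move/(congr1 (fun x => x ^+ 2)); rewrite /qp !exprMn !sqrr_sign !mul1r.
by rewrite -!exprM => /eqP; rewrite (qX_eq) => /eqP; nia.
Qed.

End QArith.

Arguments qX_sub {K q} qf {i j}.
Arguments qX1_sub {K q} qf {i}.
Arguments qX1_add {K q} qf i.

(** * Tridiagonal pairs *)

(** Only two of the Askey-Wilson relations are kept, those that are linear in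
    the pair (y, z); they are to be read between the spectral idempotents e
    of x. The rotation of (x, y, z) gives other instances. *)
Record awdata (K : fieldType) (q : K) (n : nat) (A : algType K)
    (e : nat -> A) (x y z C : A) : Prop := AWData {
  awd_orth : forall p r, e p * e r = if p == r then e p else 0;
  awd_out : forall p, (n < p)%N -> e p = 0;
  awd_sum : \sum_(0 <= p < n.+1) e p = 1;
  awd_xe : forall p, x * e p = chi q p.*2 *: e p;
  awd_ex : forall p, e p * x = chi q p.*2 *: e p;
  awd_C : forall u, C * u = u * C;
  awd_1 : awl q x y z = C;
  awd_3 : awl q z x y = C;
  awd_corner : e 0 * y * e 0 = e 0 * z * e 0 }.

Section Tridiagonal.
Variables (K : fieldType) (q : K) (n : nat) (A : algType K).
Variables (e : nat -> A) (x y z C : A).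
Hypothesis qf : qfree q.
Hypothesis D : awdata q n e x y z C.

Local Notation w := (q ^+ 2 - q ^- 2).
Local Notation th p := (chi q p.*2).

Lemma awd_eq (u v : A) :
  (forall p r, e p * u * e r = e p * v * e r) -> u = v.
Proof.
move=> uv; have split t : t = \sum_(0 <= p < n.+1) \sum_(0 <= r < n.+1) e p * t * e r.
  rewrite -[LHS]mul1r -[LHS]mulr1 -{1}(awd_sum D) -(awd_sum D) mulr_suml mulr_suml.
  by apply: eq_bigr => p _; rewrite mulr_sumr.
rewrite [u]split [v]split; apply: eq_bigr => p _; apply: eq_bigr => r _.
exact: uv.
Qed.

Lemma awd_eC p r : e p * C * e r = if p == r then C * e p else 0.
Proof.
by rewrite -(awd_C D) -mulrA (awd_orth D); case: eqP; rewrite ?mulr0.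
Qed.

Lemma awd_entry1 p r :
  (w^-1 * (q * th p - q^-1 * th r)) *: (e p * y * e r) + e p * z * e r
    = if p == r then C * e p else 0.
Proof.
rewrite -awd_eC -(awd_1 D) /awl [in RHS]mulrDr [in RHS]mulrDl; congr (_ + _).
rewrite -[LHS]scalerA -[X in _ = X * _]scalerAr -[RHS]scalerAl; congr (_ *: _).
rewrite scalerBl mulrBr mulrBl -!scalerAr -!scalerAl !mulrA (awd_ex D).
by rewrite -[e p * y * x * e r]mulrA (awd_xe D) -!scalerAl -scalerAr !scalerA.
Qed.

Lemma awd_entry3 p r :
  (w^-1 * (q * th r - q^-1 * th p)) *: (e p * z * e r) + e p * y * e r
    = if p == r then C * e p else 0.
Proof.
rewrite -awd_eC -(awd_3 D) /awl [in RHS]mulrDr [in RHS]mulrDl; congr (_ + _).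
rewrite -[LHS]scalerA -[X in _ = X * _]scalerAr -[RHS]scalerAl; congr (_ *: _).
rewrite scalerBl mulrBr mulrBl -!scalerAr -!scalerAl !mulrA (awd_ex D).
by rewrite -[e p * z * x * e r]mulrA (awd_xe D) -!scalerAl -scalerAr !scalerA.
Qed.

(** The two equations on the entries at (p, r) are independent unless
    |p - r| = 1 or p = r = 0: their determinant factors. *)
Lemma aw_det p r : (w^-1 * (q * th p - q^-1 * th r)) * (w^-1 * (q * th r - q^-1 * th p)) - 1
  = (q ^+ (p + r + 2).*2 - 1) * (q ^+ (p + r).*2 - 1)
    * (q ^+ p.+1.*2 - q ^+ r.*2) * (q ^+ r.+1.*2 - q ^+ p.*2)
    / (w ^+ 2 * q ^+ (p.*2 + r.*2 + p.*2 + r.*2 + 4)).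
Proof.
have w0 := q2_sub qf; have Q := qX0 qf; have q0 := qf0 qf.
have -> : w = (q ^+ 4 - 1) / q ^+ 2 by field; rewrite q0.
have d0 : q ^+ 4 - 1 != 0 by apply: qX1_sub.
rewrite /chi !doubleD !doubleS !exprD !exprS !expr0 !mulr1.
move: (Q p.*2) (Q r.*2); move: (q ^+ p.*2) (q ^+ r.*2) => a b a0 b0.
by field; rewrite ?a0 ?b0 ?q0 /=; move: d0; rewrite !exprS expr0 mulr1.
Qed.

Lemma awd_far p r : p != r -> p.+1 != r -> r.+1 != p -> e p * y * e r = 0.
Proof.
move=> pr p1 r1; have := awd_entry1 p r; have := awd_entry3 p r.
rewrite (negPf pr) => /eqP; rewrite addrC addr_eq0 => /eqP ->.
rewrite scalerN scalerA addrC -{1}[_ * z * _]scale1r -scalerBl => /eqP.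
rewrite scaler_eq0 => /orP[|/eqP ->]; last by rewrite scaler0 oppr0.
rewrite -oppr_eq0 opprB aw_det mulf_eq0 invr_eq0 !mulf_eq0.
rewrite !expf_eq0 (negPf (q2_sub qf)) (negPf (qf0 qf)) !andbF !orbF.
rewrite !(negPf (qX1_sub qf _)); last by lia.
  by rewrite !(negPf (qX_sub qf _)) //; lia.
by lia.
Qed.

Lemma awd_far3 p r : p != r -> p.+1 != r -> r.+1 != p -> e p * z * e r = 0.
Proof.
move=> pr p1 r1; have := awd_entry1 p r.
by rewrite awd_far // scaler0 add0r (negPf pr).
Qed.

Lemma awd_up p : e p * z * e p.+1 = (- q ^- p.+1.*2) *: (e p * y * e p.+1).
Proof.
have := awd_entry1 p p.+1; rewrite ltn_eqF //.
rewrite addrC => /eqP; rewrite addr_eq0 -scaleNr => /eqP ->.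
congr (- _ *: _); have w0 := qX1_sub qf (isT : (0 < 4)%N).
have -> : w = (q ^+ 4 - 1) / q ^+ 2 by field; rewrite (qf0 qf).
have Q := qX0 qf p.*2; rewrite /chi !doubleS !exprS; move: (q ^+ p.*2) Q => a a0.
by field; rewrite a0 (qf0 qf) /=; move: w0; rewrite !exprS expr0 mulr1.
Qed.

Lemma awd_down p : e p.+1 * z * e p = (- q ^+ p.+1.*2) *: (e p.+1 * y * e p).
Proof.
have := awd_entry1 p.+1 p; rewrite gtn_eqF //.
rewrite addrC => /eqP; rewrite addr_eq0 -scaleNr => /eqP ->.
congr (- _ *: _); have w0 := qX1_sub qf (isT : (0 < 4)%N).
have -> : w = (q ^+ 4 - 1) / q ^+ 2 by field; rewrite (qf0 qf).
have Q := qX0 qf p.*2; rewrite /chi !doubleS !exprS; move: (q ^+ p.*2) Q => a a0.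
by field; rewrite a0 (qf0 qf) /=; move: w0; rewrite !exprS expr0 mulr1.
Qed.

Lemma w_factor : w = (q - q^-1) * chi q 0.
Proof. by rewrite chi0E; field; rewrite (qf0 qf). Qed.

Lemma qVq : q - q^-1 != 0.
Proof. by have := q2_sub qf; rewrite w_factor mulf_eq0 negb_or => /andP[]. Qed.

Lemma awd_diag_coef p : w^-1 * (q * th p - q^-1 * th p) = th p / chi q 0.
Proof.
rewrite w_factor -mulrBl; have := qVq; move: (q - q^-1) => v v0.
by rewrite invfM; field; rewrite v0 chi0.
Qed.

(** On the diagonal the difference of the two relations determines y - z, except
    at 0, where its coefficient vanishes. *)
Lemma awd_diag p : e p * z * e p = e p * y * e p.
Proof.
case: p => [|p]; first by rewrite (awd_corner D).
have := awd_entry1 p.+1 p.+1; rewrite -(awd_entry3 p.+1 p.+1) awd_diag_coef.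
set a := _ * y * _; set b := _ * z * _ => /eqP; rewrite -subr_eq0.
have -> : (th p.+1 / chi q 0) *: a + b - ((th p.+1 / chi q 0) *: b + a)
    = (th p.+1 / chi q 0 - 1) *: (a - b).
  by rewrite scalerBl scale1r scalerBr opprB opprD addrACA.
rewrite scaler_eq0 => /orP[|]; last by rewrite subr_eq0 => /eqP.
rewrite subr_eq0 => /eqP H; exfalso.
suff /(chi_inj qf) : chi q p.+1.*2 = chi q 0 by [].
by rewrite -[LHS](divfK (chi0 qf 0)) H mul1r.
Qed.

Lemma awd_diagC p : (1 + th p / chi q 0) *: (e p * y * e p) = C * e p.
Proof.
have := awd_entry1 p p; rewrite awd_diag eqxx awd_diag_coef => <-.
by rewrite scalerDl scale1r addrC.
Qed.

(** Next to the diagonal the entries of z are those of y up to the factor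
    q_p / q_r, and conjugation by s multiplies them by the same factor. *)
Lemma awd_rotation (s : A) :
  (forall p, s * e p = qp q p *: e p) -> (forall p, e p * s = qp q p *: e p) ->
  s * y = z * s.
Proof.
move=> se es; apply: awd_eq => p r.
rewrite !mulrA es -[_ * z * s * _]mulrA se -!scalerAl -scalerAr.
case: (eqVneq p r) => [->|pr]; first by rewrite awd_diag.
have q0 := qf0 qf.
have adj m : qp q m = - q ^- m.+1.*2 * qp q m.+1.
  rewrite /qp exprSr (_ : (m.+1 * m.+2 = m.+1.*2 + m * m.+1)%N); last by lia.
  rewrite exprD mulrN1 mulrA !(mulrN, mulNr) opprK.
  by move: (qX0 qf m.+1.*2) ((-1) ^+ m : K) => Q a; field.
case: (eqVneq p.+1 r) => [<-|p1].
  by rewrite awd_up scalerA {1}adj mulrC.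
case: (eqVneq r.+1 p) => [<-|r1]; last by rewrite awd_far // awd_far3 // !scaler0.
rewrite awd_down scalerA (adj r); congr (_ *: _).
by move: (qX0 qf r.+1.*2) (qp q r.+1) => Q a; field.
Qed.

End Tridiagonal.

(** * Three tridiagonal matrices *)

Section TridiagonalMatrix.
Variables (K : fieldType) (q : K) (N : nat).
Hypothesis q0 : q != 0.

(** Identities between tridiagonal matrices are checked on sequences indexed by
    the integers, whose positions are all alike; Q stands for q^z. *)
Definition tri_op (l d u : K -> K) (x : int -> K) (z : int) : K :=
  l (q ^ z) * x (z - 1) + d (q ^ z) * x z + u (q ^ z) * x (z + 1).

Definition tri_mx (l d u : K -> K) : 'M[K]_N.+1 :=
  \matrix_(i, j) (if i == j then d (q ^+ i)
    else if i == j.+1 :> nat then l (q ^+ i)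
    else if j == i.+1 :> nat then u (q ^+ i) else 0).

Definition agree (v : 'cV[K]_N.+1) (x : int -> K) : Prop :=
  forall i : 'I_N.+1, v i 0 = x (i : nat)%:Z.

Definition ext (v : 'cV[K]_N.+1) (z : int) : K :=
  if z is Posz k then if (k <= N)%N then v (inord k) 0 else 0 else 0.

Lemma agree_ext v : agree v (ext v).
Proof. by move=> i; rewrite /ext -ltnS ltn_ord inord_val. Qed.

(** The outer coefficients vanish at both ends, so that the values of x out of
    the range of indices do not matter. *)
Lemma agree_tri l d u v x : l 1 = 0 -> u (q ^+ N) = 0 -> agree v x ->
  agree (tri_mx l d u *m v) (tri_op l d u x).
Proof.
move=> l0 uN vx i; rewrite mxE (bigD1 i) //= mxE eqxx /tri_op vx.
rewrite addrC addrAC; congr (_ + _); rewrite -exprnP.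
have lower : l (q ^+ i) * x ((i : nat)%:Z - 1)
    = \sum_(j < N.+1 | (i == j.+1 :> nat)) l (q ^+ i) * v j 0.
  case: (posnP i) => [i0|i0].
    rewrite i0 expr0 l0 mul0r big1 // => j /eqP ij.
  have ji : (i.-1 < N.+1)%N by rewrite (leq_ltn_trans (leq_pred _)).
  rewrite (big_pred1 (Ordinal ji)) => [|j].
    by rewrite vx /= predn_int.
  by apply/eqP/eqP => [ij|->]; [apply/val_inj => /=; lia|rewrite /= prednK].
have upper : u (q ^+ i) * x ((i : nat)%:Z + 1)
    = \sum_(j < N.+1 | (j == i.+1 :> nat)) u (q ^+ i) * v j 0.
  case: (ltnP i N) => [iN|Ni].
    have ji : (i.+1 < N.+1)%N by [].
    rewrite (big_pred1 (Ordinal ji)) => [|j]; last first.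
      by apply/eqP/eqP => [ij|->]; [apply/val_inj|].
    by rewrite vx /= -[in RHS](addn1 i) PoszD.
  have -> : q ^+ i = q ^+ N by congr (_ ^+ _); have := ltn_ord i; lia.
  by rewrite uN mul0r big1 // => j _; rewrite mul0r.
rewrite lower upper [LHS]big_mkcond [X in _ = X + _]big_mkcond.
rewrite [X in _ = _ + X]big_mkcond -big_split /=.
apply: eq_bigr => j _; rewrite mxE -!val_eqE /=.
case: (ltngtP i j) => ij /=.
- have -> : (i == j.+1 :> nat) = false by lia.
  by case: eqP; rewrite ?mul0r add0r.
- have -> : (j == i.+1 :> nat) = false by lia.
  by case: eqP; rewrite ?mul0r addr0.
- have -> : (i == j.+1 :> nat) = false by lia.
  have -> : (j == i.+1 :> nat) = false by lia.
  by rewrite addr0.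
Qed.

End TridiagonalMatrix.

Section Operators.
Variables (K : fieldType) (q a b : K).
Hypotheses (q0 : q != 0) (a0 : a != 0) (b0 : b != 0).
Hypotheses (q4 : q ^+ 4 - 1 != 0) (q2 : q ^+ 2 + 1 != 0).

(** The actions of g1, g2, g3 on a basis of N + 1 vectors, for a = q^m and
    b = q^N: g1 is lower bidiagonal with eigenvalues chi_m, ..., chi_(m + N),
    g2 is g1 for the reversed basis, and g3 is given by the first Askey-Wilson
    relation. The scalars cs and ks are chi_(m + N/2) and chi_(N/2), and Cs is
    the common value of the three relations. *)
Definition th (Q : K) := Q ^+ 2 * a ^+ 2 * q + (Q ^+ 2 * a ^+ 2 * q)^-1.
Definition al (Q : K) := (Q - Q^-1) * (Q * a - (Q * a)^-1).
Definition cs := a ^+ 2 * b * q + (a ^+ 2 * b * q)^-1.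
Definition ks := b * q + (b * q)^-1.
Definition Cs := cs * (ks + cs) / (q + q^-1).
Definition wq := q ^+ 2 - q ^- 2.
Definition l3 (Q : K) := - ((a * b * q / Q) ^+ 2) * al Q.
Definition u3 (Q : K) := - ((a * Q * q) ^- 2) * al (b / Q).
Definition d3 (Q : K) := Cs - wq^-1 * ((q - q^-1) * th Q * th (b / Q)
  + q * al Q * al (b / Q * q) - q^-1 * al (b / Q) * al (Q * q)).

Definition op1 := tri_op q al th (fun=> 0).
Definition op2 := tri_op q (fun=> 0) (fun Q => th (b / Q)) (fun Q => al (b / Q)).
Definition op3 := tri_op q l3 d3 u3.

Lemma wqE : wq = (q ^+ 4 - 1) / q ^+ 2. Proof. by rewrite /wq; field. Qed.

Lemma qVqE : q + q^-1 = (q ^+ 2 + 1) / q. Proof. by field. Qed.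

Let shiftE z : (q ^ (z - 1) = q ^ z / q) * (q ^ (z + 1) = q ^ z * q)
  * (z - 1 + 1 = z) * (z + 1 - 1 = z).
Proof.
by rewrite !expfzDr // expr1z exprN1 subrK addrK.
Qed.

Let Q0 z : q ^ z != 0. Proof. exact: expfz_neq0. Qed.

Lemma op_AW1 x z :
  wq^-1 * (q * op1 (op2 x) z - q^-1 * op2 (op1 x) z) + op3 x z = Cs * x z.
Proof.
rewrite /op1 /op2 /op3 /tri_op !shiftE /u3 /l3 /d3 /th /al /Cs /cs /ks.
rewrite wqE qVqE; move: (q ^ z) (Q0 z) => Q zQ.
by field; rewrite ?zQ ?a0 ?b0 ?q0 ?q4 ?q2.
Qed.

Lemma op_AW2 x z :
  wq^-1 * (q * op2 (op3 x) z - q^-1 * op3 (op2 x) z) + op1 x z = Cs * x z.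
Proof.
rewrite /op1 /op2 /op3 /tri_op !shiftE /u3 /l3 /d3 /th /al /Cs /cs /ks.
rewrite wqE qVqE; move: (q ^ z) (Q0 z) => Q zQ.
by field; rewrite ?zQ ?a0 ?b0 ?q0 ?q4 ?q2.
Qed.

Lemma op_AW3 x z :
  wq^-1 * (q * op3 (op1 x) z - q^-1 * op1 (op3 x) z) + op2 x z = Cs * x z.
Proof.
rewrite /op1 /op2 /op3 /tri_op !shiftE /u3 /l3 /d3 /th /al /Cs /cs /ks.
rewrite wqE qVqE; move: (q ^ z) (Q0 z) => Q zQ.
by field; rewrite ?zQ ?a0 ?b0 ?q0 ?q4 ?q2.
Qed.

Lemma op_omega x z :
  cs * (ks + cs) * (q * op1 x z + q^-1 * op2 x z + q * op3 x z)
  - q ^+ 2 * op1 (op1 x) z - q ^- 2 * op2 (op2 x) z - q ^+ 2 * op3 (op3 x) z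
  - q * op1 (op2 (op3 x)) z
  = (ks * (ks + cs ^+ 3) + (3%:R * cs ^+ 2 - (q + q^-1) ^+ 2)) * x z.
Proof.
rewrite /op1 /op2 /op3 /tri_op !shiftE /u3 /l3 /d3 /th /al /Cs /cs /ks.
rewrite wqE qVqE; move: (q ^ z) (Q0 z) => Q zQ.
by field; rewrite ?zQ ?a0 ?b0 ?q0 ?q4 ?q2.
Qed.

End Operators.

Lemma mulmx_inj (K : fieldType) (N : nat) (A B : 'M[K]_N.+1) :
  (forall v : 'cV_N.+1, A *m v = B *m v) -> A = B.
Proof.
move=> AB; apply/matrixP => i j.
by have /colP/(_ i) := AB (delta_mx j 0); rewrite -!colE !mxE.
Qed.

Lemma horner_alg_mx (K : fieldType) (N : nat) (A : 'M[K]_N.+1) P :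
  horner_alg A P = horner_mx A P.
Proof.
elim/poly_ind: P => [|P c IH]; first by rewrite !raddf0.
by rewrite !(rmorphD, rmorphM) /= IH horner_algX horner_algC horner_mx_X horner_mx_C scalemx1.
Qed.

Section Representation.
Variables (K : fieldType) (q : K) (m N : nat).
Hypothesis qf : qfree q.

Local Notation a := (q ^+ m).
Local Notation b := (q ^+ N).
Local Notation q0 := (qf0 qf).

Definition G1 : 'M[K]_N.+1 := tri_mx q N (al a) (th q a) (fun=> 0).
Definition G2 : 'M[K]_N.+1 :=
  tri_mx q N (fun=> 0) (fun Q => th q a (b / Q)) (fun Q => al a (b / Q)).
Definition G3 : 'M[K]_N.+1 := tri_mx q N (l3 q a b) (d3 q a b) (u3 q a b).

Let q4 : q ^+ 4 - 1 != 0. Proof. exact: qX1_sub. Qed.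
Let q2 : q ^+ 2 + 1 != 0. Proof. exact: (qX1_add qf 2). Qed.
Let a0 : a != 0. Proof. exact: qX0. Qed.
Let b0 : b != 0. Proof. exact: qX0. Qed.

Lemma al1 : al a 1 = 0. Proof. by rewrite /al invr1 subrr mul0r. Qed.

Lemma agree1 v x : agree v x -> agree (G1 *m v) (op1 q a x).
Proof. by apply: agree_tri; rewrite ?q0 ?al1. Qed.

Lemma agree2 v x : agree v x -> agree (G2 *m v) (op2 q a b x).
Proof. by apply: agree_tri; rewrite ?q0 ?divff ?al1. Qed.

Lemma agree3 v x : agree v x -> agree (G3 *m v) (op3 q a b x).
Proof. by apply: agree_tri; rewrite ?q0 /l3 /u3 ?divff ?al1 ?mulr0. Qed.

Lemma G_AW1 : awl q G1 G2 G3 = (Cs q a b)%:A.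
Proof.
apply: mulmx_inj => v; have vx := agree_ext v.
rewrite /awl mulmxDl -scalemxAl mulmxBl -!scalemxAl -!mulmxE -!mulmxA mul1mx.
have := agree1 (agree2 vx); have := agree2 (agree1 vx); have := agree3 vx.
move: (G1 *m (G2 *m v)) (G2 *m (G1 *m v)) (G3 *m v) => u1 u2 u3 e3 e2 e1.
apply/colP => i; rewrite !mxE e1 e2 e3 vx.
exact: (op_AW1 q0 a0 b0 q4 q2).
Qed.

Lemma G_AW2 : awl q G2 G3 G1 = (Cs q a b)%:A.
Proof.
apply: mulmx_inj => v; have vx := agree_ext v.
rewrite /awl mulmxDl -scalemxAl mulmxBl -!scalemxAl -!mulmxE -!mulmxA mul1mx.
have := agree2 (agree3 vx); have := agree3 (agree2 vx); have := agree1 vx.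
move: (G2 *m (G3 *m v)) (G3 *m (G2 *m v)) (G1 *m v) => u1 u2 u3 e3 e2 e1.
apply/colP => i; rewrite !mxE e1 e2 e3 vx.
exact: (op_AW2 q0 a0 b0 q4 q2).
Qed.

Lemma G_AW3 : awl q G3 G1 G2 = (Cs q a b)%:A.
Proof.
apply: mulmx_inj => v; have vx := agree_ext v.
rewrite /awl mulmxDl -scalemxAl mulmxBl -!scalemxAl -!mulmxE -!mulmxA mul1mx.
have := agree3 (agree1 vx); have := agree1 (agree3 vx); have := agree2 vx.
move: (G3 *m (G1 *m v)) (G1 *m (G3 *m v)) (G2 *m v) => u1 u2 u3 e3 e2 e1.
apply/colP => i; rewrite !mxE e1 e2 e3 vx.
exact: (op_AW3 q0 a0 b0 q4 q2).
Qed.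

Lemma G_omega : let c := cs q a b in let k := ks q b in
  (c * (k + c)) *: (q *: G1 + q^-1 *: G2 + q *: G3)
  - q ^+ 2 *: G1 ^+ 2 - q ^- 2 *: G2 ^+ 2 - q ^+ 2 *: G3 ^+ 2
  - q *: (G1 * G2 * G3)
  = (k * (k + c ^+ 3) + (3%:R * c ^+ 2 - (q + q^-1) ^+ 2))%:A.
Proof.
move=> c k; apply: mulmx_inj => v; have vx := agree_ext v.
rewrite !expr2 !mulmxBl -!scalemxAl !mulmxDl -!scalemxAl -!mulmxE -!mulmxA mul1mx.
have := agree1 (agree1 vx); have := agree2 (agree2 vx).
have := agree3 (agree3 vx); have := agree1 (agree2 (agree3 vx)).
have := agree1 vx; have := agree2 vx; have := agree3 vx.
move: (G1 *m (G2 *m (G3 *m v))) => u123.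
move: (G1 *m (G1 *m v)) (G2 *m (G2 *m v)) (G3 *m (G3 *m v)) => u11 u22 u33.
move: (G1 *m v) (G2 *m v) (G3 *m v) => u1 u2 u3.
move=> e3 e2 e1 e123 e33 e22 e11.
apply/colP => i; rewrite !mxE e1 e2 e3 e123 e11 e22 e33 vx.
exact: (op_omega q0 a0 b0 q4 q2).
Qed.

Lemma G1_entry i j : G1 i j = if i == j then chi q (m + i).*2
  else if i == j.+1 :> nat then al a (q ^+ i) else 0.
Proof.
rewrite mxE; case: eqP => _; last by case: eqP => // _; case: eqP.
rewrite /th /chi -!exprM -exprD -exprSr; congr (q ^+ _ + q ^- _); lia.
Qed.

Definition rev_mx : 'M[K]_N.+1 := \matrix_(i, j) (j == rev_ord i)%:R.

Lemma rev_mxE (M : 'M[K]_N.+1) i j : (rev_mx *m M *m rev_mx) i j = M (rev_ord i) (rev_ord j).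
Proof.
rewrite mxE (bigD1 (rev_ord j)) //= mxE (bigD1 (rev_ord i)) //= !mxE eqxx mul1r.
rewrite big1 => [|k /negPf ki]; last by rewrite mxE ki mul0r.
rewrite addr0 rev_ordK eqxx mulr1 big1 ?addr0 // => k kj.
by rewrite !mxE -(inj_eq rev_ord_inj) rev_ordK eq_sym (negPf kj) mulr0.
Qed.

Lemma rev_mxK : rev_mx * rev_mx = 1.
Proof.
apply/matrixP => i j; have := rev_mxE 1%:M i j; rewrite mulmx1 => ->.
by rewrite !mxE (inj_eq rev_ord_inj).
Qed.

(** Hence g1 and g2 have the same spectrum. *)
Lemma G2_rev : G2 = rev_mx * G1 * rev_mx.
Proof.
apply/matrixP => i j; rewrite rev_mxE !mxE (inj_eq rev_ord_inj).
have Qi : q ^+ N / q ^+ i = q ^+ rev_ord i.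
  rewrite /= subSS; have iN : (i <= N)%N by rewrite -ltnS.
  by rewrite -{1}(subnK iN) exprD mulfK // qX0.
case: eqP => [_|ij]; rewrite Qi //=.
have ne : (i : nat) <> j by move/val_inj.
have := ltn_ord i; have := ltn_ord j => jN iN.
case: (eqVneq (j : nat) i.+1) => [jE|ji].
  have -> : (i == j.+1 :> nat) = false by lia.
  by have -> : (N.+1 - i.+1 == (N.+1 - j.+1).+1)%N by lia.
have -> : (N.+1 - i.+1 == (N.+1 - j.+1).+1)%N = false by lia.
by case: eqP => _ //; case: eqP.
Qed.

End Representation.

(** At the eigenvalue chi_0 the coefficient of y in the relation is 1, so that
    the entries of y and z have sum c + c: they are equal as soon as one of them
    is c. *)
Section HalfCorner.
Variables (K : fieldType) (q : K) (A : algType K) (e x y z : A) (c : K).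
Hypotheses (qf : qfree q) (ee : e * e = e).
Hypotheses (xe : x * e = chi q 0 *: e) (ex : e * x = chi q 0 *: e).
Hypothesis eye : e * y * e = c *: e.

Let wE : (q ^+ 2 - q ^- 2)^-1 * (q * chi q 0 - q^-1 * chi q 0) = 1.
Proof. by rewrite (awd_diag_coef qf 0) divff // chi0. Qed.

Lemma half_corner1 : awl q x y z = (c + c)%:A -> e * z * e = c *: e.
Proof.
move/(congr1 (fun u => e * u * e)); rewrite -scalerAr -scalerAl mulr1 ee.
rewrite /awl mulrDr mulrDl -scalerAr -scalerAl mulrBr mulrBl -!scalerAr -!scalerAl.
rewrite !mulrA ex -[e * y * x * e]mulrA xe -!scalerAl -scalerAr eye !scalerA.
rewrite -scalerBl scalerA -mulrBl mulrA wE mul1r scalerDl.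
by move/addrI.
Qed.

Lemma half_corner2 : awl q y x z = (c + c)%:A -> e * z * e = c *: e.
Proof.
move/(congr1 (fun u => e * u * e)); rewrite -scalerAr -scalerAl mulr1 ee.
rewrite /awl mulrDr mulrDl -scalerAr -scalerAl mulrBr mulrBl -!scalerAr -!scalerAl.
rewrite !mulrA ex -[e * y * x * e]mulrA xe -!scalerAl -scalerAr eye !scalerA.
rewrite -scalerBl scalerA -mulrBl mulrA wE mul1r scalerDl.
by move/addrI.
Qed.

End HalfCorner.

Section LowerTriangular.
Variables (K : fieldType) (N : nat) (G : 'M[K]_N.+1).
Hypothesis Gtrig : is_trig_mx G.

Lemma lower_left_eigen (M : 'M[K]_N.+1) c (j : 'I_N.+1) : M * G = c *: M ->
  (forall k : 'I_N.+1, (j <= k)%N -> G k k != c) -> forall i, M i j = 0.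
Proof.
move=> MG Gc i; have [d] := ubnP (N - j); elim: d j Gc => // d IH j Gc jd.
have /matrixP/(_ i j) := MG; rewrite !mxE (bigD1 j) //= big1.
  rewrite addr0 mulrC => /eqP; rewrite -subr_eq0 -mulrBl mulf_eq0 subr_eq0.
  by rewrite (negPf (Gc j _)) // => /eqP.
move=> k kj; case: (ltngtP k j) => [lt_kj|lt_jk|/val_inj/eqP]; last by rewrite (negPf kj).
  by rewrite (is_trig_mxP Gtrig) ?mulr0.
rewrite IH ?mul0r // => [l kl|]; first by apply: Gc; lia.
by have := ltn_ord k; lia.
Qed.

Lemma lower_horner (P : {poly K}) :
  is_trig_mx (horner_alg G P) /\ forall i, (horner_alg G P) i i = P.[G i i].
Proof.
elim/poly_ind: P => [|P c [IHt IHd]].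
  rewrite raddf0; split=> [|i]; last by rewrite horner0 mxE.
  by apply/is_trig_mxP => i j _; rewrite mxE.
rewrite rmorphD rmorphM /= horner_algX horner_algC; split=> [|i].
  apply/is_trig_mxP => i j ij; rewrite !mxE big1 => [|k _].
    have -> : (i == j) = false by apply/eqP => e; move: ij; rewrite e ltnn.
    by rewrite mulr0n mulr0 addr0.
  case: (ltnP i k) => ik; first by rewrite (is_trig_mxP IHt) ?mul0r.
  by rewrite (is_trig_mxP Gtrig) ?mulr0 //; lia.
rewrite hornerMXaddC !mxE eqxx mulr1 (bigD1 i) //= IHd big1 ?addr0 // => k ki.
case: (ltngtP i k) => [ik|ki'|/val_inj/eqP]; last by rewrite eq_sym (negPf ki).
  by rewrite (is_trig_mxP IHt) ?mul0r.
by rewrite (is_trig_mxP Gtrig) ?mulr0.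
Qed.

End LowerTriangular.

Section ModelRep.
Variables (K : fieldType) (q : K) (m N n : nat).
Hypotheses (qf : qfree q) (mN : (m + N <= n)%N).

Local Notation lam := (fun p : nat => chi q p.*2).
Local Notation a := (q ^+ m).
Local Notation b := (q ^+ N).
Local Notation G1 := (G1 q m N).
Local Notation G2 := (G2 q m N).
Local Notation G3 := (G3 q m N).
Local Notation c := (chi q (m.*2 + N)).

Lemma chi2_inj p r : (p <= n)%N -> (r <= n)%N -> lam p = lam r -> p = r.
Proof. by move=> _ _ /(chi_inj qf) /double_inj. Qed.

Lemma qp_inj' p r : (p <= n)%N -> (r <= n)%N -> qp q p = qp q r -> p = r.
Proof. by move=> _ _ /(qp_inj qf). Qed.

Lemma csE : cs q a b = c.
Proof.
rewrite /cs /chi -!exprM -!exprD -exprSr; congr (q ^+ _ + q ^- _); lia.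
Qed.

Lemma ksE : ks q b = chi q N. Proof. by rewrite /ks /chi -exprSr. Qed.

Lemma G1_trig : is_trig_mx G1.
Proof.
apply/is_trig_mxP => i j ij; rewrite G1_entry //.
have -> : (i == j.+1 :> nat) = false by lia.
by case: eqP => // e; move: ij; rewrite e ltnn.
Qed.

Lemma G1_diag (i : 'I_N.+1) : G1 i i = lam (m + i)%N.
Proof. by rewrite G1_entry // eqxx. Qed.

(** The characteristic polynomial of the triangular matrix divides the
    polynomial of the nodes. *)
Lemma G1_nodes : horner_alg G1 (nodes_poly lam n) = 0.
Proof.
have /dvdpP [D ->] : char_poly G1 %| nodes_poly lam n.
  rewrite char_poly_trig ?G1_trig //.
  rewrite (eq_bigr (fun i : 'I_N.+1 => 'X - (lam (m + i)%N)%:P)); last first.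
    by move=> i _; rewrite G1_diag.
  rewrite (_ : \prod_(i < N.+1) _ = \prod_(z <- [seq lam (m + i)%N | i <- iota 0 N.+1])
     ('X - z%:P)); last by rewrite big_map -val_enum_ord big_map big_enum.
  apply: uniq_roots_dvdp.
    apply/allP => z /mapP [p]; rewrite mem_iota => pN zE; rewrite zE.
    rewrite /root horner_prod (bigD1_seq (m + p)) ?iota_uniq ?mem_index_iota //=.
      by rewrite hornerXsubC subrr mul0r.
    by lia.
  rewrite uniq_rootsE map_inj_in_uniq ?iota_uniq // => i j.
  by rewrite !mem_iota => ? ? /(chi_inj qf) /double_inj; lia.
by rewrite rmorphM /= [horner_alg _ (char_poly _)]horner_alg_mx Cayley_Hamilton mulr0.
Qed.

Local Notation R := (rev_mx K N).

Lemma G2_horner P : horner_alg G2 P = R * horner_alg G1 P * R.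
Proof. by rewrite (G2_rev m N qf) horner_alg_conj // rev_mxK. Qed.

Lemma G2_nodes : horner_alg G2 (nodes_poly lam n) = 0.
Proof. by rewrite G2_horner G1_nodes mulr0 mul0r. Qed.

Local Notation E r := (horner_alg G1 (lag lam n r)).
Local Notation F r := (horner_alg G2 (lag lam n r)).

Lemma G1_G2 : R * G2 * R = G1.
Proof.
rewrite (G2_rev m N qf) !mulrA rev_mxK mul1r -mulrA rev_mxK mulr1 //.
Qed.

Lemma E0_col (i j : 'I_N.+1) : (0 < m + j)%N -> E 0 i j = 0.
Proof.
move=> mj; apply: (lower_left_eigen G1_trig (lag_eigenr chi2_inj G1_nodes 0)).
move=> l jl; rewrite G1_diag; apply/negP => /eqP /(chi_inj qf) /eqP.
by rewrite -(inj_eq double_inj) => /eqP/double_inj; lia.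
Qed.

Lemma E0_col0 (i j : 'I_N.+1) : j != 0 -> E 0 i j = 0.
Proof. by move=> j0; apply: E0_col; rewrite addn_gt0 [(0 < j)%N]lt0n j0 orbT. Qed.

Lemma E0_0 : (0 < m)%N -> E 0 = 0.
Proof. by move=> m0; apply/matrixP => i j; rewrite E0_col ?mxE //; lia. Qed.

Lemma E_neq0 p : (m <= p <= m + N)%N -> E p != 0.
Proof.
move=> mpN; have pm : (p - m < N.+1)%N by lia.
apply/negP => /eqP /matrixP /(_ (Ordinal pm) (Ordinal pm)).
have [_ ->] := lower_horner G1_trig (lag lam n p).
rewrite G1_diag /= subnKC; last by lia.
rewrite lag_node ?eqxx ?mxE //; last by lia.
  by apply/eqP; rewrite oner_eq0.
exact: chi2_inj.
Qed.

Let EE p r := lag_orth chi2_inj G1_nodes p r.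

(** Only the column 0 of E_0 is nonzero, hence E_0 has rank at most one. *)
Lemma E0_prime X Y : m = 0 -> X * E 0 * Y = 0 -> X * E 0 = 0 \/ E 0 * Y = 0.
Proof.
move=> m0 XEY.
have H i j : (X * E 0) i 0 * (E 0 * Y) 0 j = 0.
  have /matrixP/(_ i j) : X * E 0 * (E 0 * Y) = 0.
    by rewrite -mulrA [E 0 * _]mulrA EE /= mulrA.
  rewrite mxE (bigD1 0) //= big1 ?addr0 ?mxE // => l l0.
  rewrite [X in X * _](_ : _ = 0) ?mul0r // mxE big1 // => r _.
  by rewrite E0_col0 ?mulr0.
have [X0|] := boolP [forall i, (X * E 0) i 0 == 0]; last first.
  rewrite negb_forall => /existsP [i Xi].
  right; apply/matrixP => i' j; rewrite -[E 0 in LHS](EE 0 0) /= -mulrA mxE.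
  rewrite [RHS]mxE big1 // => r _; case: (eqVneq r 0) => [->|r0].
    by have /eqP := H i j; rewrite mulf_eq0 (negPf Xi) => /eqP ->; rewrite mulr0.
  by rewrite E0_col0 ?mul0r.
left; apply/matrixP => i j; rewrite [RHS]mxE.
case: (eqVneq j 0) => [->|j0]; first by have /forallP/(_ i)/eqP := X0.
by rewrite mxE big1 // => r _; rewrite E0_col0 ?mulr0.
Qed.

Local Notation cc := (c ^+ 2 / chi q 0).

(** The column 0 of E_0 is an eigenvector of g1, whence the ratio of its first
    two entries; the row 0 of g2 involves no other. *)
Lemma corner_scalar : m = 0 -> (G2 * E 0) 0 0 = cc * E 0 0 0.
Proof.
move=> m0; have a1 : a = 1 by rewrite m0.
pose v : 'cV_N.+1 := col 0 (E 0); have vx := agree_ext v.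
have v0 : E 0 0 0 = ext v 0%:Z by rewrite -(vx 0) mxE.
have c2 : (G2 * E 0) 0 0 = (G2 *m v) 0 0.
  by rewrite !mxE; apply: eq_bigr => j _; rewrite [v _ _]mxE.
rewrite c2 (agree2 m qf vx 0) v0.
rewrite /op2 /tri_op mul0r add0r expr0z divr1.
have q0 := qf0 qf; have Q1 : chi q 0 - th q a q != 0.
  rewrite a1 /th expr1n mulr1; apply/negP; rewrite subr_eq0.
  by rewrite -exprSr -[_ + _]/(chi q 2) => /eqP /(chi_inj qf).
have top : al a b * ext v 1 = al a b * (al a q * ext v 0 / (chi q 0 - th q a q)).
  case: (posnP N) => [N0|N0].
    have b1 : b = 1 by rewrite N0.
    by rewrite b1 al1 !mul0r.
  congr (_ * _); apply: (canRL (mulfK Q1)).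
  have N1 : (1 < N.+1)%N by [].
  have := agree1 m qf vx (Ordinal N1).
  have -> : (G1 *m v) (Ordinal N1) 0 = (G1 * E 0) (Ordinal N1) 0.
    by rewrite !mxE; apply: eq_bigr => j _; rewrite [v _ _]mxE.
  rewrite (lag_eigenl chi2_inj G1_nodes) mxE.
  have -> : E 0 (Ordinal N1) 0 = ext v 1 by rewrite -(vx (Ordinal N1)) mxE.
  rewrite /op1 /tri_op mul0r addr0 subrr expr1z => e1.
  by rewrite mulrBr mulrC e1 [_ * th _ _ _]mulrC addrK.
rewrite add0r top; move: (ext v 0) => t.
have -> : c = b * q + (b * q)^-1 by rewrite -[RHS]/(ks q b) ksE m0.
have b0 := qX0 qf N; have q4 := qX1_sub qf (isT : (0 < 4)%N).
have q2 := qX1_add qf 2; have q2' := qX1_sub qf (isT : (0 < 2)%N).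
rewrite a1 chi0E -/(q ^+ N); move: b b0 => b b0.
have -> : q + q^-1 - th q 1 q = - ((q ^+ 4 - 1) * (q ^+ 2 - 1) / q ^+ 3).
  by rewrite /th; field.
rewrite /th /al; have -> : q + q^-1 = (q ^+ 2 + 1) / q by field.
by field; rewrite ?b0 ?q0 ?q2 /= ?andbT ?oppr_eq0; apply: mulf_neq0.
Qed.

Lemma E0_corner : E 0 * G2 * E 0 = cc *: E 0.
Proof.
case: (posnP m) => [m0|/E0_0 ->]; last by rewrite mulr0 scaler0.
apply/matrixP => i j; rewrite -mulrA mxE (bigD1 0) //= big1 => [|r r0]; last first.
  by rewrite E0_col0 ?mul0r.
rewrite addr0 [RHS]mxE; case: (eqVneq j 0) => [->|j0]; last first.
  rewrite (E0_col0 i j0) mulr0 mxE big1 ?mulr0 // => r _.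
  by rewrite E0_col0 ?mulr0.
rewrite corner_scalar // mulrCA; congr (_ * _).
have EE0 : E 0 * E 0 = E 0 by exact: (EE 0 0).
have /matrixP/(_ i 0) := EE0; rewrite mxE (bigD1 0) //= big1 ?addr0 // => r r0.
by rewrite E0_col0 ?mul0r.
Qed.

Lemma F0_corner : F 0 * G1 * F 0 = cc *: F 0.
Proof.
have RRR (X Y Z : 'M[K]_N.+1) : R * X * R * (R * Y * R) * (R * Z * R) = R * (X * Y * Z) * R.
  have RR (U : 'M[K]_N.+1) : R * (R * U) = U by rewrite mulrA rev_mxK mul1r.
  by rewrite -!mulrA !RR.
rewrite !G2_horner -[X in _ * X * _]G1_G2 RRR E0_corner.
by rewrite -scalerAr -scalerAl.
Qed.

Local Notation C := (Cs q a b).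

Lemma C_half : m = 0 -> C = cc + cc.
Proof.
by move=> m0; rewrite /Cs csE ksE chi0E -mulrDl mulrDr m0 -expr2.
Qed.

Lemma G_awdata : awdata q n (fun r => E r) G1 G2 G3 C%:A.
Proof.
split.
- exact: EE.
- exact: (lag_gt0 chi2_inj G1_nodes).
- exact: (lag_sum1 chi2_inj G1_nodes).
- exact: (lag_eigenl chi2_inj G1_nodes).
- exact: (lag_eigenr chi2_inj G1_nodes).
- by move=> u; rewrite -scalerAl -scalerAr mul1r mulr1.
- exact: G_AW1.
- exact: G_AW3.
case: (posnP m) => [m0|/E0_0 ->]; last by rewrite !mulr0.
rewrite E0_corner; apply/esym; apply: (half_corner1 qf _ _ _ E0_corner).
- by rewrite EE.
- exact: (lag_eigenl chi2_inj G1_nodes 0).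
- exact: (lag_eigenr chi2_inj G1_nodes 0).
by rewrite G_AW1 // C_half.
Qed.

Lemma F_awdata : awdata q n (fun r => F r) G2 G3 G1 C%:A.
Proof.
split.
- exact: (lag_orth chi2_inj G2_nodes).
- exact: (lag_gt0 chi2_inj G2_nodes).
- exact: (lag_sum1 chi2_inj G2_nodes).
- exact: (lag_eigenl chi2_inj G2_nodes).
- exact: (lag_eigenr chi2_inj G2_nodes).
- by move=> u; rewrite -scalerAl -scalerAr mul1r mulr1.
- exact: G_AW2.
- exact: G_AW1.
case: (posnP m) => [m0|/E0_0 F0]; last first.
  by rewrite [horner_alg G2 _]G2_horner F0 mulr0 mul0r !mulr0.
rewrite F0_corner; apply: (half_corner2 qf _ _ _ F0_corner).
- by rewrite (lag_orth chi2_inj G2_nodes).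
- exact: (lag_eigenl chi2_inj G2_nodes 0).
- exact: (lag_eigenr chi2_inj G2_nodes 0).
by rewrite G_AW1 // C_half.
Qed.

Local Notation h := (interp n lam (qp q)).
Local Notation s1 := (horner_alg G1 h).
Local Notation s2 := (horner_alg G2 h).
Local Notation hV := (interp n lam (fun r => (qp q r)^-1)).

Lemma h_inv (x : 'M[K]_N.+1) : horner_alg x (nodes_poly lam n) = 0 ->
  horner_alg x hV * horner_alg x h = 1.
Proof.
move=> x0; rewrite -rmorphM -[RHS](rmorph1 (horner_alg x)).
apply: (horner_alg_nodes chi2_inj x0) => p pn.
rewrite hornerM !interp_node //; try exact: chi2_inj.
by rewrite hornerC mulVf // qp_neq0 // (qf0 qf).
Qed.

Lemma s1_rotation : s1 * G2 = G3 * s1.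
Proof.
apply: (awd_rotation qf G_awdata) => p.
  case: (leqP p n) => pn.
    by rewrite (lag_eigen chi2_inj G1_nodes) // interp_node //; apply: chi2_inj.
  by rewrite (lag_gt0 chi2_inj G1_nodes) // mulr0 scaler0.
rewrite horner_alg_comm; case: (leqP p n) => pn.
  by rewrite (lag_eigen chi2_inj G1_nodes) // interp_node //; apply: chi2_inj.
by rewrite (lag_gt0 chi2_inj G1_nodes) // mulr0 scaler0.
Qed.

Lemma s2_rotation : s2 * G3 = G1 * s2.
Proof.
apply: (awd_rotation qf F_awdata) => p.
  case: (leqP p n) => pn.
    by rewrite (lag_eigen chi2_inj G2_nodes) // interp_node //; apply: chi2_inj.
  by rewrite (lag_gt0 chi2_inj G2_nodes) // mulr0 scaler0.
rewrite horner_alg_comm; case: (leqP p n) => pn.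
  by rewrite (lag_eigen chi2_inj G2_nodes) // interp_node //; apply: chi2_inj.
by rewrite (lag_gt0 chi2_inj G2_nodes) // mulr0 scaler0.
Qed.

(** Both s1 s2 s1^-1 and s2^-1 s1 s2 are the value at g3 of the polynomial that
    expresses sigma_i in terms of g_i. *)
Lemma s_braid : s1 * s2 * s1 = s2 * s1 * s2.
Proof.
have V1 := h_inv G1_nodes; have V2 := h_inv G2_nodes.
have W1 : s1 * horner_alg G1 hV = 1 by rewrite horner_alg_comm.
have W2 : s2 * horner_alg G2 hV = 1 by rewrite horner_alg_comm.
have g3l : s1 * G2 * horner_alg G1 hV = G3 by rewrite s1_rotation -mulrA W1 mulr1.
have g3r : horner_alg G2 hV * G1 * s2 = G3.
  by rewrite -mulrA -s2_rotation mulrA V2 mul1r.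
have l : s1 * s2 * horner_alg G1 hV = horner_alg G2 hV * s1 * s2.
  by rewrite -(horner_alg_conj _ _ W1 V1) g3l -(horner_alg_conj _ _ V2 W2) g3r.
transitivity (s2 * (s1 * s2 * horner_alg G1 hV) * s1); last first.
  by rewrite -!mulrA V1 mulr1.
by rewrite l !mulrA W2 mul1r.
Qed.

Lemma cas_s (x : 'M[K]_N.+1) : horner_alg x (nodes_poly lam n) = 0 ->
  cas q n (horner_alg x h) = x.
Proof.
move=> x0; rewrite /cas /cas_poly /interp raddf_sum /= -[RHS](interpK chi2_inj x0).
apply: eq_bigr => r _; rewrite horner_algZ interp_lag //.
  exact: chi2_inj.
exact: qp_inj'.
Qed.

(** The matrices satisfy the relations with chi_(m + N/2) and chi_(N/2) in place
    of chi_s and kappa. The next two equations on k identify the resulting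
    central scalars with those of A_s. *)
Variable k : K.
Hypothesis k_C : chi q n * (k + chi q n) = c * (chi q N + c).
Hypothesis k_omega : k * (k + chi q n ^+ 3) + (3%:R * chi q n ^+ 2 - chi q 0 ^+ 2)
  = chi q N * (chi q N + c ^+ 3) + (3%:R * c ^+ 2 - chi q 0 ^+ 2).
Hypothesis m0_nN : m = 0 -> n = N.

Lemma rep_is_model : model q n s1 s2 (horner_alg G1 hV) k%:A G3.
Proof.
have W1 : s1 * horner_alg G1 hV = 1 by rewrite horner_alg_comm h_inv // G1_nodes.
have c0 := chi0 qf n; have c00 := chi0 qf 0; rewrite chi0E in c00.
have kC : k = (q + q^-1) / chi q n * C - chi q n.
  rewrite /Cs csE ksE -[c * (_ + c)]k_C.
  by move: (q + q^-1) c00 (chi q n) c0 => t t0 d d0; field; rewrite t0 d0.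
split; rewrite ?(cas_s G1_nodes) ?(cas_s G2_nodes).
- by split; [exact/h_inv/G1_nodes|].
- by rewrite s1_rotation -mulrA W1 mulr1.
- by rewrite /kap_of G_AW1 // kC scalerBl scalerA.
- exact: s_braid.
- by apply: interp_nodes0; [exact: chi2_inj|exact: G1_nodes].
- by apply: interp_nodes0; [exact: chi2_inj|exact: G2_nodes].
- by rewrite G_AW1 // G_AW2.
- by rewrite G_AW1 // G_AW3.
- by move=> u; rewrite -scalerAl -scalerAr mul1r mulr1.
- rewrite /omega -!scalerDl -scalerAl -scalerAl mul1r scalerA.
  rewrite k_C -csE -ksE G_omega // csE ksE -chi0E.
  by rewrite -k_omega -scalerAl mul1r scalerA -scalerDl.
rewrite (interp_lag chi2_inj qp_inj' G1_nodes) E0_corner.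
case: (posnP m) => [m0|/E0_0 ->]; last by rewrite !scaler0.
by rewrite m0 -(m0_nN m0).
Qed.

End ModelRep.

(** The matrices s1, s2 are the polynomials in G1, G2 that take the value q_p at
    chi_p; so s1 has the eigenvalues q_m, ..., q_(m + N). *)
Theorem representation (K : fieldType) (q : K) (m N n : nat) (k : K) :
    let c := chi q (m.*2 + N) in
    qfree q -> (m + N <= n)%N ->
    chi q n * (k + chi q n) = c * (chi q N + c) ->
    k * (k + chi q n ^+ 3) + (3%:R * chi q n ^+ 2 - chi q 0 ^+ 2)
      = chi q N * (chi q N + c ^+ 3) + (3%:R * c ^+ 2 - chi q 0 ^+ 2) ->
    (m = 0 -> n = N) ->
  exists s1 s2 i1 g3 : 'M[K]_N.+1, let f := horner_alg s2 (lag (qp q) n 0) in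
    [/\ model q n s1 s2 i1 k%:A g3,
        forall p, (m <= p <= m + N)%N -> horner_alg s1 (lag (qp q) n p) != 0,
        (0 < m)%N -> f = 0 &
        m = 0 -> f != 0 /\ forall X Y, X * f * Y = 0 -> X * f = 0 \/ f * Y = 0].
Proof.
move=> c qf mN k_C k_omega m0_nN.
have M := rep_is_model qf mN k_C k_omega m0_nN.
have ci := @chi2_inj K q n qf; have qi := @qp_inj' K q n qf.
have n1 := G1_nodes qf mN; have n2 := G2_nodes qf mN.
do 4 eexists; split; first exact: M.
- move=> p mp; rewrite (interp_lag ci qi n1); exact: E_neq0 mN _ mp.
- move=> m0; rewrite (interp_lag ci qi n2) (G2_horner _ _ qf).
  by rewrite (E0_0 qf mN m0) mulr0 mul0r.
move=> m0; rewrite (interp_lag ci qi n2) (G2_horner _ _ qf).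
have RR := rev_mxK K N; set E := horner_alg _ _; set R := rev_mx K N in RR *.
have RE (X : 'M[K]_N.+1) : R * X = 0 -> X = 0.
  by move/(congr1 (fun u => R * u)); rewrite mulrA RR mul1r mulr0.
have ER (X : 'M[K]_N.+1) : X * R = 0 -> X = 0.
  by move/(congr1 (fun u => u * R)); rewrite -mulrA RR mulr1 mul0r.
have E0 : E != 0 by apply: (E_neq0 qf mN); lia.
split=> [|X Y XY].
  by apply: contraNneq E0 => /ER/RE ->.
have [|XE|EY] := @E0_prime K q m N n qf mN (X * R) (R * Y) m0.
- by rewrite -!mulrA; move: XY; rewrite -!mulrA.
- by left; move: XE; rewrite -/E => XE; rewrite !mulrA XE mul0r.
- by right; move: EY; rewrite -/E => EY; rewrite -!mulrA EY mulr0.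
Qed.

(** * Backtracking in A_s *)

(** The polynomial [upol q n l] in kappa is the factor that a step between l - 1
    and l, followed by the step back, produces; its roots are chi_(s + l) and
    chi_(s - l). In the same way [dpol] is the factor of a step from p to p. *)
Definition ucoef (K : fieldType) (q : K) (n l : nat) : K :=
  let S := q ^+ n.+1 in let L := q ^+ l.*2 in
  - ((S ^+ 2 - L) * (S ^+ 2 * L - 1) * L ^+ 2 * q ^+ 2)
    / (S ^+ 2 * (L ^+ 2 - q ^+ 2) * (L ^+ 2 * q ^+ 2 - 1) * (L + 1) ^+ 2).

Definition uroot1 (K : fieldType) (q : K) (n l : nat) : K :=
  q ^+ n.+1 * q ^+ l.*2 + (q ^+ n.+1 * q ^+ l.*2)^-1.
Definition uroot2 (K : fieldType) (q : K) (n l : nat) : K :=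
  q ^+ n.+1 / q ^+ l.*2 + q ^+ l.*2 / q ^+ n.+1.

Definition upol (K : fieldType) (q : K) (n l : nat) : {poly K} :=
  ucoef q n l *: (('X - (uroot1 q n l)%:P) * ('X - (uroot2 q n l)%:P)).

Definition dcoef (K : fieldType) (q : K) (n p : nat) : K :=
  chi q n / (chi q 0 + chi q p.*2).

Definition dpol (K : fieldType) (q : K) (n p : nat) : {poly K} :=
  dcoef q n p *: ('X + (chi q n)%:P).

Lemma sum_near (V : zmodType) (F : nat -> V) (p n : nat) :
    (forall r : nat, p != r -> p.+1 != r -> r.+1 != p -> F r = 0) ->
    (forall r, (n < r)%N -> F r = 0) ->
  \sum_(0 <= r < n.+1) F r = (if p is p'.+1 then F p' else 0) + F p + F p.+1.
Proof.
move=> far out; have -> : \sum_(0 <= r < n.+1) F r = \sum_(0 <= r < n.+1 + p.+2) F r.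
  rewrite [RHS](big_cat_nat (n := n.+1)) ?leq_addr //= [X in _ + X]big_nat.
  by rewrite [X in _ + X]big1 ?addr0 // => r /andP[nr _]; apply: out.
transitivity (\sum_(0 <= r < p.+2) F r).
  rewrite (big_cat_nat (n := p.+2)) ?leq_addl //= [X in _ + X]big_nat.
  by rewrite [X in _ + X]big1 ?addr0 // => r /andP[pr _]; apply: far; lia.
rewrite big_nat_recr //= big_nat_recr //=; congr (_ + _ + _).
case: p far => [|p'] far; first by rewrite big_geq.
rewrite big_nat_recr //= big_nat big1 ?add0r // => r pr.
by apply: far; lia.
Qed.

Lemma quad_expand (K : fieldType) (V : lmodType K) (c t t' : K) (v2 v1 v0 : V) :
  c *: (v2 - t' *: v1 - t *: (v1 - t' *: v0))
    = c *: v2 + (- (c * (t + t'))) *: v1 + (c * (t * t')) *: v0.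
Proof.
rewrite !scalerBr !scalerA opprB [_ *: v0 - _]addrC addrA mulrA; congr (_ + _).
by rewrite -addrA -opprD -scalerDl -mulrDr scaleNr [t' + t]addrC.
Qed.

Section Structure.
Variables (K : fieldType) (q : K) (n : nat) (A : algType K).
Variables (s1 s2 i1 k g3 : A).
Hypotheses (qf : qfree q) (M : model q n s1 s2 i1 k g3).

Local Notation e p := (horner_alg s1 (lag (qp q) n p)).
Local Notation f p := (horner_alg s2 (lag (qp q) n p)).
Local Notation g1 := (cas q n s1).
Local Notation g2 := (cas q n s2).
Local Notation y := (k + (chi q n)%:A).
Local Notation C := ((chi q n / chi q 0) *: y).
Local Notation ev := (horner_alg k).

Let qi p r : (p <= n)%N -> (r <= n)%N -> qp q p = qp q r -> p = r.
Proof. by move=> _ _ /(qp_inj qf). Qed.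
Let n1 := mdl_nodes1 M.
Let n2 := mdl_nodes2 M.

Lemma cas_eigen (x : A) p : horner_alg x (nodes_poly (qp q) n) = 0 ->
  cas q n x * horner_alg x (lag (qp q) n p) = chi q p.*2 *: horner_alg x (lag (qp q) n p).
Proof.
move=> x0; case: (leqP p n) => pn.
  rewrite (lag_eigen qi x0) //; congr (_ *: _).
  exact: (interp_node (fun r => chi q r.*2) qi pn).
by rewrite (lag_gt0 qi x0) // mulr0 scaler0.
Qed.

Lemma mdl_C : awl q g1 g2 g3 = C.
Proof.
rewrite (mdl_kap M) /kap_of; move: (awl _ _ _ _) => c.
rewrite subrK scalerA -chi0E mulrA divfK ?divff ?scale1r ?chi0 //.
Qed.

Lemma k_comm u : k * u = u * k. Proof. exact: (mdl_central M). Qed.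

Lemma y_comm u : y * u = u * y.
Proof. by rewrite mulrDl mulrDr k_comm -scalerAl -scalerAr mul1r mulr1. Qed.

(** Conjugation by sigma_1, whose eigenvalue on e_0 is 1, maps g_2 to g_3. *)
Lemma mdl_corner : e 0 * g2 * e 0 = e 0 * g3 * e 0.
Proof.
have se : e 0 * s1 = e 0.
  by rewrite (lag_eigenr qi n1) /qp mulr1 expr0 scale1r.
have ie : i1 * e 0 = e 0.
  have [il ir] := mdl_inv M.
  have /(congr1 (fun u => i1 * u)) := lag_eigenl qi n1 0.
  by rewrite mulrA il mul1r /qp mulr1 expr0 scale1r.
by rewrite (mdl_g3 M) !mulrA se -[_ * i1 * _]mulrA ie.
Qed.

Lemma mdl_awdata : awdata q n (fun p => e p) g1 g2 g3 C.
Proof.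
split.
- exact: (lag_orth qi n1).
- exact: (lag_gt0 qi n1).
- exact: (lag_sum1 qi n1).
- by move=> p; apply: cas_eigen.
- by move=> p; rewrite horner_alg_comm; apply: cas_eigen.
- by move=> u; rewrite -scalerAl -scalerAr y_comm.
- exact: mdl_C.
- by rewrite (mdl_AW3 M) mdl_C.
- exact: mdl_corner.
Qed.
Let D := mdl_awdata.

Lemma chi_sumE p : chi q 0 + chi q p.*2
  = (q ^+ p.*2 + 1) * (q ^+ p.+1.*2 + 1) / (q ^+ p.*2 * q).
Proof.
have := qX0 qf p.*2; have q0 := qf0 qf; rewrite chi0E /chi doubleS !exprS.
by move: (q ^+ p.*2) => Q Q0; field; rewrite Q0 q0.
Qed.

Lemma chi_sum0 p : chi q 0 + chi q p.*2 != 0.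
Proof.
rewrite chi_sumE; do 2 ?[apply: mulf_neq0]; rewrite ?invr_eq0 ?(qX1_add qf) //.
by rewrite mulf_neq0 ?(qX0 qf) // (qf0 qf).
Qed.

Lemma step_loop p : e p * g2 * e p = dcoef q n p *: (y * e p).
Proof.
have := awd_diagC qf D p; rewrite -scalerAl => /(congr1 (fun u =>
  (chi q 0 / (chi q 0 + chi q p.*2)) *: u)).
have c0 := chi0 qf 0; have s0 := chi_sum0 p; rewrite !scalerA.
have -> : chi q 0 / (chi q 0 + chi q p.*2) * (1 + chi q p.*2 / chi q 0) = 1.
  by field; rewrite ?c0 ?s0.
rewrite scale1r => ->; congr (_ *: _); rewrite /dcoef.
by field; rewrite ?c0 ?s0.
Qed.

(** The relation on e_0 g_2 e_0 fixes the value of the loop at 0, in which kappa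
    occurs with degree one. *)
Lemma kappa_e0 : k * e 0 = chi q n *: e 0.
Proof.
have := step_loop 0; rewrite (mdl_e0 M) /dcoef => H.
have c0 := chi0 qf 0; have cn := chi0 qf n; have s0 := chi_sum0 0.
have : y * e 0 = (chi q n + chi q n) *: e 0.
  rewrite /= in s0 H; have := congr1 (fun u => ((chi q 0 + chi q 0) / chi q n) *: u) H.
  rewrite !scalerA [X in _ = X *: _](_ : _ = 1); last first.
    by move: (chi q 0 + chi q 0) s0 (chi q n) cn => a a0 b b0; field; rewrite a0.
  rewrite scale1r => <-; congr (_ *: _).
  by move: (chi q 0) c0 (chi q n) cn => a a0 b b0; field; rewrite a0.
move=> ye; apply: (addIr (chi q n *: e 0)).
by rewrite -scalerDl -ye mulrDl -scalerAl mul1r.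
Qed.

(** The half twist exchanges the two generators, hence the families e and f. *)
Definition twist : A := s1 * s2 * s1.
Definition twistV : A :=
  i1 * horner_alg s2 (interp n (qp q) (fun r => (qp q r)^-1)) * i1.

Lemma twistK : twist * twistV = 1 /\ twistV * twist = 1.
Proof.
have [il ir] := mdl_inv M; rewrite /twist /twistV.
set i2 := horner_alg s2 _; have i2l : i2 * s2 = 1.
  rewrite -[X in _ * X](horner_algX s2) -rmorphM -[RHS](rmorph1 (horner_alg s2)).
  apply: (horner_alg_nodes qi n2) => p pn; rewrite hornerM hornerX interp_node //.
  by rewrite hornerC mulVf // qp_neq0 // (qf0 qf).
have i2r : s2 * i2 = 1.
  by rewrite -[X in X * _](horner_algX s2) horner_alg_comm horner_algX.
split; rewrite !mulrA.
  by rewrite -[_ * s1 * i1]mulrA ir mulr1 -[_ * s2 * i2]mulrA i2r mulr1.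
by rewrite -[_ * i1 * s1]mulrA il mulr1 -[_ * i2 * s2]mulrA i2l mulr1.
Qed.

Lemma twist_s1 : twist * s1 * twistV = s2.
Proof.
have [TV _] := twistK; rewrite -[RHS]mulr1 -TV mulrA; congr (_ * _).
by rewrite /twist !mulrA -(mdl_braid M).
Qed.

Lemma twist_s2 : twist * s2 * twistV = s1.
Proof.
have [TV _] := twistK; rewrite -[RHS]mulr1 -TV mulrA; congr (_ * _).
by rewrite /twist [in RHS](mdl_braid M) !mulrA.
Qed.

Lemma twist_horner1 P : horner_alg s2 P = twist * horner_alg s1 P * twistV.
Proof. by have [TV VT] := twistK; rewrite -twist_s1 horner_alg_conj. Qed.

Lemma twist_horner2 P : horner_alg s1 P = twist * horner_alg s2 P * twistV.
Proof. by have [TV VT] := twistK; rewrite -twist_s2 horner_alg_conj. Qed.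

Lemma kappa_f0 : k * f 0 = chi q n *: f 0.
Proof.
rewrite twist_horner1 -[twist * _ * _]mulrA [k * _]mulrA (k_comm twist) -mulrA.
by rewrite [k * _]mulrA kappa_e0 -scalerAl -scalerAr.
Qed.

Section Backtrack.
Variable p : nat.

Let u := e p * g2 * e p.+1 * g2 * e p.
Let v := if p is p'.+1 then e p * g2 * e p' * g2 * e p else 0.
(** The entries at (p, p) of the remaining relations are combinations of five
    elements: the two backtracking terms u and v, and e_p with coefficients
    of degree at most two in kappa, that is in y. *)
Let L5 (c0 c1 c2 c3 c4 : K) : A :=
  c0 *: u + c1 *: v + c2 *: (y * (y * e p)) + c3 *: (y * e p) + c4 *: e p.

Let L5Z a c0 c1 c2 c3 c4 :
  a *: L5 c0 c1 c2 c3 c4 = L5 (a * c0) (a * c1) (a * c2) (a * c3) (a * c4).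
Proof. by rewrite /L5 !scalerDr !scalerA. Qed.

Let L5D c0 c1 c2 c3 c4 d0 d1 d2 d3 d4 : L5 c0 c1 c2 c3 c4 + L5 d0 d1 d2 d3 d4
  = L5 (c0 + d0) (c1 + d1) (c2 + d2) (c3 + d3) (c4 + d4).
Proof.
by rewrite /L5 !scalerDl; do 4 (rewrite addrACA; congr (_ + _)).
Qed.

Let L5B c0 c1 c2 c3 c4 d0 d1 d2 d3 d4 : L5 c0 c1 c2 c3 c4 - L5 d0 d1 d2 d3 d4
  = L5 (c0 - d0) (c1 - d1) (c2 - d2) (c3 - d3) (c4 - d4).
Proof. by rewrite -scaleN1r L5Z L5D !mulN1r. Qed.

Let dd := dcoef q n p ^+ 2.
Let Q := q ^+ p.*2.

Let row (x : A) : (forall r, p != r -> p.+1 != r -> r.+1 != p -> e p * x * e r = 0) ->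
  e p * x = (if p is p'.+1 then e p * x * e p' else 0) + e p * x * e p + e p * x * e p.+1.
Proof.
move=> far; rewrite -(@sum_near _ (fun r => e p * x * e r) p n far) => [|r rn].
  by rewrite -mulr_sumr (awd_sum D) mulr1.
by rewrite (awd_out D rn) mulr0.
Qed.

Let row2 := row (fun r => awd_far qf D (p := p) (r := r)).
Let row3 := row (fun r => awd_far3 qf D (p := p) (r := r)).

Let diag2 : e p * g2 * e p * g2 * e p = dd *: (y * (y * e p)).
Proof.
rewrite step_loop -scalerAl -scalerAl -[y * e p * g2 * e p]mulrA -mulrA.
by rewrite [e p * (_ * _)]mulrA step_loop -scalerAr scalerA.
Qed.

Let p22 : e p * g2 * g2 * e p = L5 1 1 dd 0 0.
Proof.
rewrite row2 !mulrDl diag2 /L5 !scale0r !addr0 !scale1r -/u.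
rewrite addrAC [X in X + _]addrC; congr (_ + _ + _).
by rewrite /v; case: (p) => //; rewrite !mul0r.
Qed.

Let mul5 (a b c d h : A) : a * b * c * d * h = a * b * (c * d * h).
Proof. by rewrite !mulrA. Qed.

Let step_up3 : e p * g2 * e p.+1 * g3 * e p = (- (Q * q ^+ 2)) *: u.
Proof.
rewrite mul5 (awd_down qf D) -scalerAr -mul5; congr (- _ *: _).
by rewrite /Q doubleS !exprS; ring.
Qed.

Let step_up3' : e p * g3 * e p.+1 * g2 * e p = (- (Q * q ^+ 2)^-1) *: u.
Proof.
rewrite (awd_up qf D) -!scalerAl /u; congr (- _^-1 *: _).
by rewrite /Q doubleS !exprS; ring.
Qed.

Let p23 : e p * g2 * g3 * e p = L5 (- (Q * q ^+ 2)) (- Q^-1) dd 0 0.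
Proof.
rewrite row2 !mulrDl /L5 !scale0r !addr0 step_up3.
have -> : e p * g2 * e p * g3 * e p = dd *: (y * (y * e p)).
  by rewrite -diag2 [LHS]mul5 (awd_diag qf D) -mul5.
rewrite addrC addrA; congr (_ + _ + _).
rewrite /v /Q; case: (p) => [|p']; first by rewrite !mul0r scaler0.
by rewrite mul5 (awd_up qf D) -scalerAr -mul5.
Qed.

Let p32 : e p * g3 * g2 * e p = L5 (- (Q * q ^+ 2)^-1) (- Q) dd 0 0.
Proof.
rewrite row3 !mulrDl /L5 !scale0r !addr0 step_up3' (awd_diag qf D) diag2.
rewrite addrC addrA; congr (_ + _ + _).
rewrite /v /Q; case: (p) => [|p']; first by rewrite !mul0r scaler0.
by rewrite (awd_down qf D) -!scalerAl.
Qed.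

Let p33 : e p * g3 * g3 * e p = L5 1 1 dd 0 0.
Proof.
have Q0 := qX0 qf p.*2; have q0 := qf0 qf.
rewrite row3 !mulrDl /L5 !scale0r !addr0 !scale1r.
have -> : e p * g3 * e p * g3 * e p = dd *: (y * (y * e p)).
  by rewrite (awd_diag qf D) -diag2 [LHS]mul5 (awd_diag qf D) -mul5.
have -> : e p * g3 * e p.+1 * g3 * e p = u.
  rewrite (awd_up qf D) -!scalerAl step_up3 scalerA mulrNN doubleS !exprS.
  by rewrite /Q (_ : _ * _ = 1) ?scale1r //; field; rewrite Q0 q0.
rewrite addrC addrA; congr (_ + _ + _).
rewrite /v; case: (p) => [|p']; first by rewrite !mul0r.
rewrite (awd_down qf D) -!scalerAl mul5 (awd_up qf D) -scalerAr scalerA mulrNN.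
by rewrite mulfV ?scale1r ?(qX0 qf) // -mul5.
Qed.

Let xp := chi q p.*2.
Let ch := chi q n.

Let pC : e p * C * e p = L5 0 0 0 (ch / chi q 0) 0.
Proof.
rewrite /L5 !scale0r !add0r addr0 -scalerAr -scalerAl -y_comm -mulrA.
by rewrite (awd_orth D) eqxx.
Qed.

Let p1 : e p * g1 * e p = L5 0 0 0 0 xp.
Proof. by rewrite /L5 !scale0r !add0r (awd_ex D) -scalerAl (awd_orth D) eqxx. Qed.

Let eq_AW2 : L5 ((q ^+ 2 - q ^- 2)^-1 * (q * - (Q * q ^+ 2) - q^-1 * - (Q * q ^+ 2)^-1))
    ((q ^+ 2 - q ^- 2)^-1 * (q * - Q^-1 - q^-1 * - Q))
    ((q ^+ 2 - q ^- 2)^-1 * (q * dd - q^-1 * dd)) (- (ch / chi q 0)) xp = 0.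
Proof.
have /= H := congr1 (fun u => e p * u * e p) (etrans (mdl_AW2 M) mdl_C).
rewrite pC /awl mulrDr mulrDl -scalerAr -scalerAl mulrBr mulrBl -!scalerAr in H.
rewrite -!scalerAl !mulrA p23 p32 p1 !L5Z L5B L5Z L5D in H.
move/eqP: H; rewrite -subr_eq0 L5B => /eqP <-.
by congr L5; rewrite ?(oppr0, mulr0, subr0, addr0, add0r, sub0r).
Qed.

Let eq_omega : L5 (- (q ^+ 2 + q ^- 2) + q * xp * (Q * q ^+ 2))
    (- (q ^+ 2 + q ^- 2) + q * xp * Q^-1)
    (ch * (q + q^-1) * dcoef q n p - (q ^+ 2 + q ^- 2 + q * xp) * dd - 1)
    (ch * (q * xp) - (ch ^+ 3 - 2%:R * ch))
    (- (q ^+ 2 * xp ^+ 2) - (4%:R * ch ^+ 2 - ch ^+ 4 - chi q 0 ^+ 2)) = 0.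
Proof.
pose S (x : A) := e p * x * e p.
have SB x z : S (x - z) = S x - S z by rewrite /S mulrBr mulrBl.
have SD x z : S (x + z) = S x + S z by rewrite /S mulrDr mulrDl.
have SZ a x : S (a *: x) = a *: S x by rewrite /S -scalerAr -scalerAl.
have Sy x : S (y * x) = y * S x by rewrite /S mulrA -y_comm !mulrA.
have Sy' : S y = L5 0 0 0 1 0.
  rewrite -[y]mulr1 Sy /S mulr1 (awd_orth D) eqxx.
  by rewrite /L5 !scale0r !add0r addr0 scale1r.
have S1 : S 1 = L5 0 0 0 0 1.
  by rewrite /S mulr1 (awd_orth D) eqxx /L5 !scale0r !add0r scale1r.
have Syy : S (y * y) = L5 0 0 1 0 0.
  by rewrite Sy Sy' /L5 !scale0r !add0r !addr0 !scale1r.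
have S11 : S (g1 ^+ 2) = L5 0 0 0 0 (xp ^+ 2).
  rewrite /S expr2 !mulrA (awd_ex D) -!scalerAl (awd_ex D) -scalerAl.
  by rewrite (awd_orth D) eqxx scalerA /L5 !scale0r !add0r.
have S22 : S (g2 ^+ 2) = L5 1 1 dd 0 0 by rewrite /S expr2 mulrA p22.
have S33 : S (g3 ^+ 2) = L5 1 1 dd 0 0 by rewrite /S expr2 mulrA p33.
have S123 : S (g1 * g2 * g3) = L5 (xp * - (Q * q ^+ 2)) (xp * - Q^-1) (xp * dd) 0 0.
  have -> : S (g1 * g2 * g3) = e p * g1 * g2 * g3 * e p by rewrite /S !mulrA.
  by rewrite (awd_ex D) -!scalerAl p23 L5Z !mulr0.
have Sy1 : S (y * g1) = L5 0 0 0 xp 0.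
  by rewrite Sy /S p1 /L5 !scale0r !add0r addr0 -scalerAr.
have Sy2 : S (y * g2) = L5 0 0 (dcoef q n p) 0 0.
  by rewrite Sy /S step_loop /L5 !scale0r !add0r !addr0 -scalerAr.
have Sy3 : S (y * g3) = L5 0 0 (dcoef q n p) 0 0.
  by rewrite -Sy2 !Sy /S (awd_diag qf D).
have yM a b (z : A) : (z - a%:A) * (z + b%:A) = z * z + (b - a) *: z - (a * b)%:A.
  rewrite mulrDl !mulrDr -scalerAr mulr1 mulNr -scalerAl mul1r.
  by rewrite mulNr -scalerAl mul1r scalerA scalerBl -!addrA.
have kE : k * (k + (ch ^+ 3)%:A)
    = y * y + (ch ^+ 3 - ch - ch) *: y - (ch * (ch ^+ 3 - ch))%:A.
  rewrite -yM addrK; congr (_ * _); rewrite scalerBl -[RHS]addrA; congr (_ + _).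
  by rewrite addrC subrK.
have H := congr1 S (mdl_omega M).
have yD z : z * (q *: g1 + q^-1 *: g2 + q *: g3)
    = q *: (z * g1) + q^-1 *: (z * g2) + q *: (z * g3).
  by rewrite !mulrDr -!scalerAr.
rewrite kE /omega -scalerAl yD in H; move: Sy1 Sy2 Sy3 Sy' Syy H.
move: (k + (chi q n)%:A) => z Sy1 Sy2 Sy3 Sy' Syy H.
rewrite !(SB, SD, SZ) Sy1 Sy2 Sy3 Sy' S1 Syy S11 S22 S33 S123 in H.
rewrite !(L5Z, L5D, L5B) in H.
move/eqP: H; rewrite -subr_eq0 L5B => /eqP <-.
by congr L5; rewrite -?/ch; ring.
Qed.

Let S := q ^+ n.+1.
Let S0 : S != 0. Proof. exact: qX0. Qed.
Let Q0 : Q != 0. Proof. exact: qX0. Qed.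
Let q0 := qf0 qf.
Let Q1 : Q + 1 != 0. Proof. exact: qX1_add. Qed.
Let Q2 : Q * q ^+ 2 + 1 != 0.
Proof. by rewrite /Q -exprD addn2 -doubleS (qX1_add qf). Qed.
Let Q3 : Q ^+ 2 * q ^+ 2 - 1 != 0.
Proof. by rewrite /Q -exprM -exprD (qX1_sub qf) // addnS. Qed.
Let Q4 : Q ^+ 2 * q ^+ 6 - 1 != 0.
Proof. by rewrite /Q -exprM -exprD (qX1_sub qf) // addnS. Qed.
Let Q5 : Q ^+ 2 - q ^+ 2 != 0.
Proof. by rewrite /Q -exprM (qX_sub qf) //; lia. Qed.
Let q4 : q ^+ 4 - 1 != 0. Proof. exact: qX1_sub. Qed.
Let q2 : q ^+ 2 + 1 != 0. Proof. exact: (qX1_add qf 2). Qed.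

Let Q3' : (Q * q) ^+ 2 - 1 != 0. Proof. by rewrite exprMn. Qed.
Let Q4' : Q ^+ 2 * q ^+ 4 * q ^+ 2 - 1 != 0. Proof. by rewrite -mulrA -exprD. Qed.
Let Q3'' : (Q * q ^+ 2) ^+ 2 - q ^+ 2 != 0.
Proof.
have -> : (Q * q ^+ 2) ^+ 2 - q ^+ 2 = q ^+ 2 * (Q ^+ 2 * q ^+ 2 - 1) by ring.
by rewrite mulf_neq0 ?expf_neq0.
Qed.

Let xpE : xp = Q * q + (Q * q)^-1.
Proof. by rewrite /xp /chi exprSr. Qed.
Let chE : ch = S + S^-1. Proof. by []. Qed.

Let ddE : dcoef q n p = ch * (Q * q) / ((Q + 1) * (Q * q ^+ 2 + 1)).
Proof.
have Qp : q ^+ p.+1.*2 = Q * q ^+ 2 by rewrite doubleS -(addn2 p.*2) exprD.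
by rewrite /dcoef chi_sumE Qp invf_div !mulrA.
Qed.

Let quad_L5 (c r r' : K) : horner_alg k (c *: (('X - r%:P) * ('X - r'%:P))) * e p
  = L5 0 0 c (- (c * (ch + r + (ch + r')))) (c * ((ch + r) * (ch + r'))).
Proof.
rewrite horner_algZ rmorphM !rmorphB /= horner_algX !horner_algC -scalerAl -mulrA.
have kr t (x : A) : (k - t%:A) * x = y * x - (ch + t) *: x.
  by rewrite mulrBl mulrDl -!scalerAl !mul1r (scalerDl x ch t) opprD addrA addrK.
rewrite kr kr mulrBr -scalerAr /L5 !scale0r !add0r.
exact: quad_expand.
Qed.

(** The second Askey-Wilson relation and the value of Omega are two linear
    equations for u and v over the polynomials in kappa. *)
Lemma step_up : u = horner_alg k (upol q n p.+1) * e p.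
Proof.
pose r := (Q ^+ 2 * q ^+ 6 - 1) * (Q ^+ 2 * q ^+ 2 - 1).
(* a and a' eliminate v and give u the coefficient 1. *)
pose a := (q ^+ 2 - q ^- 2) * (Q * q ^+ 3) / r.
pose a' := (Q * q) * (Q * q ^+ 3) / r.
have /= H := congr2 (fun x x' => a *: x + a' *: x') eq_AW2 eq_omega.
rewrite !scaler0 addr0 !L5Z L5D in H.
apply/eqP; rewrite quad_L5 -[X in X == _]addr0 -[X in _ + X]oppr0 -H.
rewrite (_ : u = L5 1 0 0 0 0); last by rewrite /L5 scale1r !scale0r !addr0.
rewrite L5B -subr_eq0 L5B; apply/eqP.
transitivity (L5 0 0 0 0 0); last by rewrite /L5 !scale0r !addr0.
have Qp : q ^+ p.+1.*2 = Q * q ^+ 2 by rewrite doubleS -(addn2 p.*2) exprD.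
rewrite /ucoef /uroot1 /uroot2 Qp -/S /a /a' /dd ddE xpE chE chi0E.
have -> : q ^+ 2 - q ^- 2 = (q ^+ 4 - 1) / q ^+ 2 by field.
have -> : q + q^-1 = (q ^+ 2 + 1) / q by field.
congr L5; rewrite /r; field;
  by rewrite ?Q0 ?q0 ?S0 ?Q1 ?Q2 ?Q3' ?Q4 ?Q4' ?Q3'' ?q4 ?q2.
Qed.

Lemma step_down : v = horner_alg k (upol q n p) * e p.
Proof.
pose r := (Q ^+ 2 - q ^+ 2) * (Q ^+ 2 * q ^+ 2 - 1).
(* a and a' eliminate u and give v the coefficient 1. *)
pose a := (q ^+ 2 - q ^- 2) * (Q * q) * (Q * q) ^+ 2 / r.
pose a' := (Q * q) ^+ 2 / r.
have /= H := congr2 (fun x x' => a *: x + a' *: x') eq_AW2 eq_omega.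
rewrite !scaler0 addr0 !L5Z L5D in H.
apply/eqP; rewrite quad_L5 -[X in X == _]addr0 -[X in _ + X]oppr0 -H.
rewrite (_ : v = L5 0 1 0 0 0); last by rewrite /L5 scale1r !scale0r add0r !addr0.
rewrite L5B -subr_eq0 L5B; apply/eqP.
transitivity (L5 0 0 0 0 0); last by rewrite /L5 !scale0r !addr0.
rewrite /ucoef /uroot1 /uroot2 -/Q -/S /a /a' /dd ddE xpE chE chi0E.
have -> : q ^+ 2 - q ^- 2 = (q ^+ 4 - 1) / q ^+ 2 by field.
have -> : q + q^-1 = (q ^+ 2 + 1) / q by field.
congr L5; rewrite /r; field;
  by rewrite ?Q0 ?q0 ?S0 ?Q1 ?Q2 ?Q3' ?Q5 ?q4 ?q2.
Qed.

End Backtrack.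

Lemma back_up p : e p * g2 * e p.+1 * g2 * e p = ev (upol q n p.+1) * e p.
Proof. exact: step_up. Qed.

Lemma back_down p : e p.+1 * g2 * e p * g2 * e p.+1 = ev (upol q n p.+1) * e p.+1.
Proof. exact: step_down p.+1. Qed.

Lemma back_loop p : e p * g2 * e p = ev (dpol q n p) * e p.
Proof.
by rewrite step_loop horner_algZ rmorphD /= horner_algX horner_algC -scalerAl.
Qed.

Lemma back_far p r : p != r -> p.+1 != r -> r.+1 != p -> e p * g2 * e r = 0.
Proof. exact: (awd_far qf D). Qed.

Lemma twistM u v : (twist * u * twistV) * (twist * v * twistV) = twist * (u * v) * twistV.
Proof.
have conjM (t t' : A) : t' * t = 1 -> (t * u * t') * (t * v * t') = t * (u * v) * t'.
  by move=> tt; rewrite !mulrA -[_ * t' * t]mulrA tt mulr1.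
by have [_ /conjM] := twistK.
Qed.

Lemma f_far p r : p != r -> p.+1 != r -> r.+1 != p -> f p * g1 * f r = 0.
Proof.
move=> pr p1 r1; rewrite !(twist_horner1 (lag _ _ _)) /cas.
rewrite (twist_horner2 (cas_poly q n)) !twistM.
by rewrite back_far // mulr0 mul0r.
Qed.

Lemma f_back_down p :
  f p.+1 * g1 * f p * g1 * f p.+1 = ev (upol q n p.+1) * f p.+1.
Proof.
rewrite !(twist_horner1 (lag _ _ _)) /cas.
rewrite (twist_horner2 (cas_poly q n)) !twistM back_down.
have out (t t' u : A) : t * (ev (upol q n p.+1) * u) * t' = ev (upol q n p.+1) * (t * u * t').
  by rewrite !mulrA (horner_alg_central _ k_comm).
exact: out.
Qed.

End Structure.

(** * Paths *)

Definition dist (a c : nat) : nat := (a - c) + (c - a).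

Lemma gbar_diag a : gbar a a = [:: a].
Proof. by rewrite /gbar leqnn subnn. Qed.

Lemma gbar_lt a c : (a < c)%N -> gbar a c = a :: gbar a.+1 c.
Proof. by move=> ac; rewrite /gbar (ltnW ac) ac subnSK. Qed.

Lemma gbar_gt a c : (c <= a)%N -> gbar a.+1 c = a.+1 :: gbar a c.
Proof.
move=> ca; have gE b : (c <= b)%N -> gbar b c = rev (iota c (b - c).+1).
  move=> cb; rewrite /gbar; case: (leqP b c) => // bc.
  by have -> : b = c; [lia|rewrite subnn].
rewrite !gE ?leqW // subSn // -[in LHS]addn1 iotaD rev_cat /=.
by rewrite addnS subnKC.
Qed.

Section StepFactor.
Variables (K : fieldType) (q : K) (n : nat).
Hypothesis qf : qfree q.

(** The factor by which a path from b to c gets multiplied, modulo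
    backtracking, when the step from a to b is put in front of it. *)
Definition stepf (c a b : nat) : {poly K} :=
  if a == b then dpol q n a
  else if (a < b)%N then (if (c <= a)%N then upol q n b else 1)
  else (if (a <= c)%N then upol q n a else 1).

Fixpoint ppoly (c : nat) (g : seq nat) : {poly K} :=
  if g is a :: t then (if t is b :: _ then stepf c a b * ppoly c t else 1) else 1.

Lemma size_dpol p : size (dpol q n p) = 2.
Proof.
rewrite size_scale; first by rewrite size_XaddC.
by rewrite mulf_neq0 ?invr_eq0 ?(chi0 qf) ?(chi_sum0 qf).
Qed.

Lemma ucoef_neq0 l : (0 < l <= n)%N -> ucoef q n l != 0.
Proof.
move=> ln; have Q := qX0 qf; have q0 := qf0 qf.
rewrite /ucoef mulf_neq0 ?oppr_eq0 ?invr_eq0 //; repeat apply: mulf_neq0;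
  rewrite ?expf_neq0 // -?exprM -?exprD ?(qX1_sub qf) ?(qX_sub qf) ?(qX1_add qf) //.
all: try lia.
Qed.

Lemma size_upol l : (0 < l <= n)%N -> size (upol q n l) = 3.
Proof.
move=> ln; rewrite size_scale ?ucoef_neq0 // size_mul ?polyXsubC_eq0 //.
by rewrite !size_XsubC.
Qed.

Lemma size_stepf a b c : (a <= n)%N -> (b <= n)%N -> step a b ->
  (size (stepf c a b) + dist a c = dist b c + 2)%N.
Proof.
move=> an bn; rewrite /stepf /step /dist.
case: (eqVneq a b) => [<- _|ab]; first by rewrite size_dpol addnC.
case: (ltnP a b) => ltab st; case: leqP => ca;
  rewrite ?size_poly1 ?size_upol; lia.
Qed.

Lemma stepf_neq0 a b c : (a <= n)%N -> (b <= n)%N -> step a b -> stepf c a b != 0.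
Proof.
move=> an bn ab; rewrite -size_poly_gt0; have := size_stepf c an bn ab.
by move: ab; rewrite /step /dist; lia.
Qed.

Lemma ppoly_neq0 c a t : all (fun x => x <= n)%N (a :: t) -> path step a t ->
  ppoly c (a :: t) != 0.
Proof.
elim: t a => [|b t IH] a; first by rewrite oner_neq0.
move=> /andP[an bt] /andP[ab pt]; have bn : (b <= n)%N by case/andP: bt.
by rewrite mulf_neq0 ?stepf_neq0 //; apply: IH.
Qed.

(** A step adds to the degree what it adds to the length minus the distance to
    the end: 0 towards the end, 1 for a loop, 2 away from it. *)
Lemma size_ppoly c a t : all (fun x => x <= n)%N (a :: t) -> path step a t ->
  last a t = c -> (size (ppoly c (a :: t)) + dist a c = (size t).+1)%N.
Proof.
elim: t a => [|b t IH] a; first by move=> _ _ /= ->; rewrite size_poly1 /dist subnn.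
move=> /andP[an bt] /andP[ab pt] lc; have bn : (b <= n)%N by case/andP: bt.
have sP := IH b bt pt lc; have sS := size_stepf c an bn ab.
have P0 := ppoly_neq0 c bt pt; have S0 := stepf_neq0 c an bn ab.
rewrite -[ppoly c _]/(stepf c a b * ppoly c (b :: t)) [size (b :: t)]/=.
set P := ppoly c (b :: t) in sP P0 *; set S := stepf c a b in sS S0 *.
rewrite size_mul //; move: S0 P0 sS sP; rewrite -!size_poly_gt0.
move: (size S) (size P) (size t) (dist a c) (dist b c) => x y z u v.
by clear; lia.
Qed.

End StepFactor.

Section Paths.
Variables (K : fieldType) (q : K) (n : nat) (A : algType K).
Variables (s1 s2 i1 k g3 : A).
Hypotheses (qf : qfree q) (M : model q n s1 s2 i1 k g3).

Local Notation e p := (horner_alg s1 (lag (qp q) n p)).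
Local Notation f p := (horner_alg s2 (lag (qp q) n p)).
Local Notation g2 := (cas q n s2).
Local Notation ev := (horner_alg k).
Let D := mdl_awdata qf M.

Definition xp (g : seq nat) : A :=
  if g is a :: t then e a * \prod_(b <- t) (g2 * e b) else 1.

Definition xg (a c : nat) : A := xp (gbar a c).

Lemma xp_cons a b t : xp (a :: b :: t) = e a * g2 * xp (b :: t).
Proof. by rewrite /xp big_cons !mulrA. Qed.

Lemma e_idem a : e a * e a = e a.
Proof. by rewrite (awd_orth D) eqxx. Qed.

Lemma e_xp a t : e a * xp (a :: t) = xp (a :: t).
Proof. by rewrite /xp mulrA e_idem. Qed.

Lemma xp_e a t : xp (a :: t) * e (last a t) = xp (a :: t).
Proof.
case: (lastP t) => [|t' c]; first by rewrite /xp big_nil mulr1 e_idem.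
by rewrite last_rcons /xp -cats1 big_cat big_seq1 /= -!mulrA e_idem.
Qed.

Lemma xg_diag a : xg a a = e a.
Proof. by rewrite /xg gbar_diag /xp big_nil mulr1. Qed.

Lemma gbar_cons a c : exists t, gbar a c = a :: t /\ last a t = c.
Proof.
have [d] := ubnP (dist a c); elim: d a => // d IH a; rewrite /dist => dac.
case: (ltngtP a c) => [ac|ca|<-]; last by exists [::]; rewrite gbar_diag.
  have [|t [gE lE]] := IH a.+1; first by rewrite /dist; lia.
  by exists (gbar a.+1 c); rewrite gbar_lt // gE.
case: a ca dac => // a ca dac; have [|t [gE lE]] := IH a; first by rewrite /dist; lia.
by exists (gbar a c); rewrite gbar_gt // gE.
Qed.

Lemma e_xg a c : e a * xg a c = xg a c.
Proof. by rewrite /xg; have [t [-> _]] := gbar_cons a c; apply: e_xp. Qed.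

Lemma xg_e a c : xg a c * e c = xg a c.
Proof. by rewrite /xg; have [t [-> lt]] := gbar_cons a c; rewrite -{1}lt xp_e. Qed.

Lemma xg_lt a c : (a < c)%N -> xg a c = e a * g2 * xg a.+1 c.
Proof.
by move=> ac; rewrite /xg gbar_lt //; have [t [-> _]] := gbar_cons a.+1 c; apply: xp_cons.
Qed.

Lemma xg_gt a c : (c <= a)%N -> xg a.+1 c = e a.+1 * g2 * xg a c.
Proof.
by move=> ac; rewrite /xg gbar_gt //; have [t [-> _]] := gbar_cons a c; apply: xp_cons.
Qed.

Lemma step_red a b c : step a b -> e a * g2 * xg b c = ev (stepf q n c a b) * xg a c.
Proof.
rewrite /stepf /step; case: (eqVneq a b) => [<- _|ab].
  by rewrite -{1}(e_xg a c) mulrA (back_loop qf M) -mulrA e_xg.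
case: (ltnP a b) => [ltab|geab] st.
  have -> : b = a.+1 by lia.
  case: leqP => ca; last by rewrite rmorph1 mul1r [xg a c]xg_lt.
  by rewrite [xg a.+1 c]xg_gt // -{1}(e_xg a c) !mulrA (back_up qf M) -mulrA e_xg.
have aE : a = b.+1 by lia.
rewrite aE; case: (leqP b.+1 c) => ca; last by rewrite rmorph1 mul1r [xg b.+1 c]xg_gt.
by rewrite [xg b c]xg_lt // -{1}(e_xg b.+1 c) !mulrA (back_down qf M) -mulrA e_xg.
Qed.

(** Repeated cancellation of backtracking, starting from the end of the path. *)
Lemma path_red c a t : path step a t -> last a t = c ->
  xp (a :: t) = ev (ppoly q n c (a :: t)) * xg a c.
Proof.
elim: t a => [|b t IH] a; first by move=> _ /= <-; rewrite xg_diag rmorph1 mul1r /xp big_nil mulr1.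
move=> /andP[ab pt] lc; rewrite xp_cons (IH b pt lc) [ppoly _ _ _ _]/=.
set P := (match t with [::] => _ | _ :: _ => _ end).
have kc := horner_alg_central _ (k_comm M).
by rewrite mulrA -kc -mulrA step_red // rmorphM /= mulrA [ev P * _]kc.
Qed.

Lemma e_row a : e a * g2
  = (if a is b.+1 then e a * g2 * e b else 0) + e a * g2 * e a + e a * g2 * e a.+1.
Proof.
rewrite -(@sum_near _ (fun r => e a * g2 * e r) a n) => [|r ar a1 r1|r rn].
- by rewrite -mulr_sumr (awd_sum D) mulr1.
- exact: (back_far qf M).
- by rewrite (awd_out D rn) mulr0.
Qed.

(** By tridiagonality this is a sum over the paths with j steps from a to c. *)
Lemma power_red c j a : (a <= n)%N -> exists2 R : {poly K},
  (size R <= j.+1 - dist a c)%N & e a * g2 ^+ j * e c = ev R * xg a c.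
Proof.
elim: j a => [|j IH] a an.
  rewrite expr0 mulr1 (awd_orth D); case: eqP => [<-|ac].
    by exists 1; rewrite ?size_poly1 /dist ?subnn // xg_diag rmorph1 mul1r.
  by exists 0; rewrite ?size_poly0 // rmorph0 mul0r.
have near b : step a b -> exists2 R : {poly K}, (size R <= j.+2 - dist a c)%N
    & e a * g2 * e b * (g2 ^+ j * e c) = ev R * xg a c.
  move=> ab; case: (leqP b n) => bn; last first.
    exists 0; first by rewrite size_poly0.
    by rewrite (awd_out D bn) mulr0 !rmorph0 !mul0r.
  have [R sR RE] := IH b bn; exists (stepf q n c a b * R).
    have sS := size_stepf qf c an bn ab.
    have := size_polyMleq (stepf q n c a b) R.
    case: (posnP (size R)) => [/eqP|Rpos]; last by lia.
    by rewrite size_poly_eq0 => /eqP ->; rewrite mulr0 size_poly0.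
  have kc := horner_alg_central R (k_comm M).
  rewrite -[e a * g2 * e b * _]mulrA [e b * _]mulrA RE mulrA -kc -mulrA step_red //.
  by rewrite rmorphM /= mulrA kc.
rewrite exprS mulrA -mulrA e_row !mulrDl.
have [R1 s1' ->] : exists2 R : {poly K}, (size R <= j.+2 - dist a c)%N
    & (if a is b.+1 then e a * g2 * e b else 0) * (g2 ^+ j * e c) = ev R * xg a c.
  case: (a) near => [_|b near]; first by exists 0; rewrite ?size_poly0 ?rmorph0 ?mul0r.
  by apply: near; rewrite /step eqxx ?orbT.
have st0 : step a a by apply/or3P; constructor 2.
have st1 : step a a.+1 by rewrite /step eqxx !orbT.
have [R2 s2' ->] := near a st0; have [R3 s3' ->] := near a.+1 st1.
exists (R1 + R2 + R3); last by rewrite !rmorphD /= !mulrDl.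
rewrite (leq_trans (size_polyD _ _)) // geq_max s3' andbT.
by rewrite (leq_trans (size_polyD _ _)) // geq_max s1'.
Qed.

Lemma poly_red (P : {poly K}) a c : (a <= n)%N -> exists2 R : {poly K},
  (size R <= size P - dist a c)%N & e a * horner_alg g2 P * e c = ev R * xg a c.
Proof.
move=> an.
have PE : horner_alg g2 P = \sum_(j < size P) P`_j *: g2 ^+ j.
  rewrite -{1}[P]coefK poly_def raddf_sum; apply: eq_bigr => j _ /=.
  by rewrite horner_algZ rmorphXn /= horner_algX.
rewrite PE mulr_sumr mulr_suml.
pose G m := exists2 R : {poly K}, (size R <= size P - dist a c)%N & m = ev R * xg a c.
apply: (big_ind G) => [|x y [R sR ->] [R' sR' ->]|j _].
- by exists 0; rewrite ?size_poly0 // rmorph0 mul0r.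
- exists (R + R'); last by rewrite rmorphD mulrDl.
  by rewrite (leq_trans (size_polyD _ _)) // geq_max sR.
have [R sR RE] := power_red c j an; exists (P`_j *: R).
  rewrite (leq_trans (size_scale_leq _ _)) // (leq_trans sR) //.
  by rewrite leq_sub2r.
by rewrite -scalerAr -scalerAl RE horner_algZ -scalerAl.
Qed.

Lemma f_horner p : f p = horner_alg g2 (lag (fun r => chi q r.*2) n p).
Proof.
apply/esym; apply: (interp_lag _ _ (mdl_nodes2 M)) => x y _ _.
  by move/(qp_inj qf).
by move/(chi_inj qf)/double_inj.
Qed.

(** f_0 is a polynomial of degree n in g_2. *)
Lemma f0_red a c : (a <= n)%N -> exists2 R : {poly K},
  (size R <= n.+1 - dist a c)%N & e a * f 0 * e c = ev R * xg a c.
Proof.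
move=> an; rewrite f_horner.
have [R sR ->] := poly_red (lag (fun r => chi q r.*2) n 0) c an; exists R => //.
by rewrite (leq_trans sR) // leq_sub2r // size_lag.
Qed.

(** Going from a down to 0 and back multiplies e_a by the product of the [upol],
    and at 0 kappa is chi_s. *)
Definition bottom_poly (a : nat) : {poly K} :=
  ('X - (chi q n)%:P) * \prod_(1 <= l < a.+1) upol q n l.

Lemma bottom_kill a : ev (bottom_poly a) * e a = 0.
Proof.
have kc P := horner_alg_central P (k_comm M).
elim: a => [|a IH].
  rewrite /bottom_poly big_geq // mulr1 rmorphB /= horner_algX horner_algC.
  by rewrite mulrBl (kappa_e0 qf M) -scalerAl mul1r subrr.
have -> : bottom_poly a.+1 = bottom_poly a * upol q n a.+1.
  by rewrite /bottom_poly big_nat_recr //= mulrA.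
rewrite rmorphM /= -mulrA -(back_down qf M) !mulrA.
rewrite -[_ * g2 * e a * _ * _]mulrA -[_ * e a * _]mulrA.
rewrite -[ev _ * e a.+1 * g2]mulrA kc -mulrA [ev _ * (e a * _)]mulrA IH.
by rewrite mul0r mulr0.
Qed.

Lemma size_bottom a : (a <= n)%N -> size (bottom_poly a) = a.*2.+2.
Proof.
move=> an; have prodE m : (m <= n)%N ->
    size (\prod_(1 <= l < m.+1) upol q n l) = m.*2.+1.
  elim: m => [|m IH] mn; first by rewrite big_geq ?size_poly1.
  rewrite big_nat_recr //= size_mul; last 2 first.
  - by rewrite -size_poly_gt0 IH //; lia.
  - by rewrite -size_poly_gt0 size_upol //; lia.
  by rewrite IH ?size_upol //; lia.
have P0 : \prod_(1 <= l < a.+1) upol q n l != 0 by rewrite -size_poly_gt0 prodE.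
by rewrite /bottom_poly size_mul ?polyXsubC_eq0 // size_XsubC prodE.
Qed.

Lemma bottom_kill_xg a c : ev (bottom_poly (minn a c)) * xg a c = 0.
Proof.
have kc P := horner_alg_central P (k_comm M).
case: (leqP a c) => ac; first by rewrite -(e_xg a c) mulrA bottom_kill mul0r.
by rewrite -(xg_e a c) mulrA kc -mulrA bottom_kill mulr0.
Qed.

(** On f_0, too, kappa is chi_s. *)
Lemma top_kill_xg a c R : e a * f 0 * e c = ev R * xg a c ->
  ev (('X - (chi q n)%:P) * R) * xg a c = 0.
Proof.
move=> RE; rewrite rmorphM /= -mulrA -RE rmorphB /= horner_algX horner_algC.
rewrite mulrBl -scalerAl mul1r !mulrA (k_comm M) -[e a * k * _]mulrA.
by rewrite (kappa_f0 qf M) -scalerAr -scalerAl subrr.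
Qed.

End Paths.

(** * The algebra A_s and its representations *)

Section Representations.
Variables (K : fieldType) (q : K) (n : nat).
Hypothesis qf : qfree q.
Local Notation As := (presented (As_rel q n)).

Let q0 := qf0 qf.

(** m, ..., h are the vertices through which the paths of a representation with
    kappa = k run. The last clause is what is needed of f_0 having rank
    one. *)
Definition good (k : K) (m h : nat) : Prop :=
  exists (B : algType K) (phi : {rmorphism As -> B}),
    let f := horner_alg (phi (sigma2 _)) (lag (qp q) n 0) in
    [/\ scalable phi, phi (kappa q n _) = k%:A,
        forall p, (m <= p <= h)%N ->
          horner_alg (phi (sigma1 _)) (lag (qp q) n p) != 0,
        (0 < m)%N -> f = 0 &
        m = 0 -> f != 0 /\ forall X Y, X * f * Y = 0 -> X * f = 0 \/ f * Y = 0].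

Lemma good_rep (m N : nat) (k : K) : let c := chi q (m.*2 + N) in
    (m + N <= n)%N ->
    chi q n * (k + chi q n) = c * (chi q N + c) ->
    k * (k + chi q n ^+ 3) + (3%:R * chi q n ^+ 2 - chi q 0 ^+ 2)
      = chi q N * (chi q N + c ^+ 3) + (3%:R * c ^+ 2 - chi q 0 ^+ 2) ->
    (m = 0 -> n = N) ->
  good k m (m + N).
Proof.
move=> c mN k_C k_omega m0.
have [s1 [s2 [i1 [g3 [M eN fm f0]]]]] := representation qf mN k_C k_omega m0.
have qq0 : q + q^-1 != 0 by rewrite -chi0E chi0.
have [phi [phiZ p1 p2 pk]] := model_lift q0 M (chi0 qf n) qq0.
by exists _, phi; split; rewrite ?p1 ?p2.
Qed.

(** The dimension is n - m + 1, and kappa is chi_(s + m). *)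
Lemma good_large m : (m <= n)%N -> good (chi q (n + m.*2)) m n.
Proof.
move=> mn; have Q i := qX0 qf i; rewrite -{2}(subnKC mn).
have a0 := Q m; have b0 := Q (n - m)%N.
have E1 : chi q n = q ^+ m * q ^+ (n - m) * q + (q ^+ m * q ^+ (n - m) * q)^-1.
  by rewrite -exprD subnKC // -exprSr.
have E2 : chi q (n + m.*2)
    = q ^+ m ^+ 3 * q ^+ (n - m) * q + (q ^+ m ^+ 3 * q ^+ (n - m) * q)^-1.
  by rewrite -exprM -exprD -exprSr; congr (q ^+ _ + q ^- _); lia.
have E3 : chi q (m.*2 + (n - m))
    = q ^+ m ^+ 2 * q ^+ (n - m) * q + (q ^+ m ^+ 2 * q ^+ (n - m) * q)^-1.
  by rewrite -exprM -exprD -exprSr; congr (q ^+ _ + q ^- _); lia.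
have E4 : chi q (n - m) = q ^+ (n - m) * q + (q ^+ (n - m) * q)^-1.
  by rewrite -exprSr.
apply: good_rep; rewrite ?E1 ?E2 ?E3 ?E4; first by lia.
- by move: (q ^+ m) (q ^+ (n - m)) a0 b0 => a b a0 b0; field; rewrite ?a0 ?b0 ?q0.
- move: (chi q 0) (q ^+ m) (q ^+ (n - m)) a0 b0 => t a b a0 b0.
  by field; rewrite ?a0 ?b0 ?q0.
by move=> ->; rewrite subn0.
Qed.

(** The dimension is n - 2m + 1, and kappa is chi_(s - m). *)
Lemma good_small m : (m.*2 <= n)%N -> good (chi q (n - m.*2)) m (n - m).
Proof.
move=> mn; have -> : (n - m = m + (n - m.*2))%N by lia.
by apply: good_rep; rewrite ?subnKC //; lia.
Qed.

Lemma As_nontrivial : (1 : As) != 0.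
Proof.
have [B [phi _]] := good_large (leq0n n).
by apply/eqP => /(congr1 phi); rewrite rmorph1 rmorph0 => /eqP; rewrite oner_eq0.
Qed.

End Representations.

(** The analogue of [good] for an algebra with elements s1, s2, k. *)
Definition has_rep (K : fieldType) (q : K) (n : nat) (A : algType K)
    (s1 s2 k : A) (x : K) (m h : nat) : Prop :=
  exists (B : algType K) (psi : {rmorphism A -> B}),
    let f := horner_alg (psi s2) (lag (qp q) n 0) in
    [/\ scalable psi, psi k = x%:A,
        forall p, (m <= p <= h)%N -> horner_alg (psi s1) (lag (qp q) n p) != 0,
        (0 < m)%N -> f = 0 &
        m = 0 -> f != 0 /\ forall X Y, X * f * Y = 0 -> X * f = 0 \/ f * Y = 0].

(** A type of its own for A_s, to carry the structure of a nontrivial algebra,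
    which depends on the hypothesis on q. *)
Definition As_alg (K : fieldType) (q : K) (n : nat) (_ : qfree q) : Type :=
  presented (As_rel q n).

Section AsAlgebra.
Variables (K : fieldType) (q : K) (n : nat) (qf : qfree q).
Local Notation A := (@As_alg K q n qf).

HB.instance Definition _ := GRing.PzRing.on A.
HB.instance Definition _ := GRing.Lmodule.on A.
HB.instance Definition _ :=
  GRing.PzSemiRing_isNonZero.Build A (As_nontrivial n qf).
HB.instance Definition _ := GRing.Lmodule_isLalgebra.Build K A
  (@presented_scalerAl K (As_rel q n)).
HB.instance Definition _ := GRing.Lalgebra_isAlgebra.Build K A
  (@presented_scalerAr K (As_rel q n)).

Local Notation P := (presented (As_rel q n)).

Definition to_alg (u : P) : A := u.

HB.instance Definition _ :=
  GRing.isAdditive.Build P A to_alg (fun x y => erefl).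
HB.instance Definition _ :=
  GRing.isMultiplicative.Build P A to_alg ((fun x y => erefl), erefl).

Lemma to_alg_scalable : scalable to_alg. Proof. by []. Qed.

Definition of_alg (u : A) : P := u.

HB.instance Definition _ :=
  GRing.isAdditive.Build A P of_alg (fun x y => erefl).
HB.instance Definition _ :=
  GRing.isMultiplicative.Build A P of_alg ((fun x y => erefl), erefl).

Local Notation s1 := (to_alg (sigma1 (As_rel q n))).
Local Notation s2 := (to_alg (sigma2 (As_rel q n))).
Local Notation i1 := (to_alg (inv_of (sigma1 (As_rel q n)))).
Local Notation k := (to_alg (kappa q n (As_rel q n))).
Local Notation g3 := (s1 * cas q n s2 * i1).

Lemma As_is_model : model q n s1 s2 i1 k g3.
Proof.
apply: (As_model (qf0 qf) to_alg_scalable) => y; by exists y.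
Qed.

Lemma good_has_rep x m h : good q n x m h -> has_rep q n s1 s2 k x m h.
Proof.
case=> B [phi [phiZ phik phie f0 fprime]].
pose psi : {rmorphism A -> B} := phi \o of_alg.
by exists B, psi; split=> // t u; apply: phiZ.
Qed.

End AsAlgebra.

(** * Values of kappa *)

Section KappaValues.
Variables (K : fieldType) (q : K) (n : nat).
Hypothesis qf : qfree q.

Let recip_sub (x y : K) : x != 0 -> y != 0 ->
  (x + x^-1) - (y + y^-1) = (x - y) * (x * y - 1) / (x * y).
Proof. by move=> x0 y0; field; rewrite x0 y0. Qed.

(** chi_(j/2) differs from chi_(s + l) and from chi_(s - l), the roots of
    [upol q n l]. *)
Lemma upol_root l (j : nat) : (0 < l <= n)%N -> (j + l.*2 != n)%N ->
    (j != n + l.*2)%N -> (j + n + 2 != l.*2)%N ->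
  (upol q n l).[chi q j] != 0.
Proof.
move=> ln jl jn jnl; have Q := qX0 qf.
rewrite /upol hornerZ hornerM !hornerXsubC; apply: mulf_neq0; first exact: ucoef_neq0.
apply: mulf_neq0.
  rewrite /uroot1 -exprD addSn -/(chi q _) subr_eq0.
  by apply/eqP => /(chi_inj qf) /eqP; apply/negP.
have -> : uroot2 q n l = q ^+ n.+1 / q ^+ l.*2 + (q ^+ n.+1 / q ^+ l.*2)^-1.
  by rewrite /uroot2 invf_div.
have Y0 : q ^+ n.+1 / q ^+ l.*2 != 0 by rewrite mulf_neq0 ?invr_eq0 ?Q.
rewrite /chi recip_sub ?Q //.
have d1 : q ^+ j.+1 - q ^+ n.+1 / q ^+ l.*2 != 0.
  rewrite -[q ^+ j.+1](mulfK (Q l.*2)) -mulrBl -exprD mulf_neq0 ?invr_eq0 ?Q //.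
  by apply: (qX_sub qf); lia.
have d2 : q ^+ j.+1 * (q ^+ n.+1 / q ^+ l.*2) - 1 != 0.
  rewrite mulrA -exprD -[X in _ - X](divff (Q l.*2)) -mulrBl.
  by rewrite mulf_neq0 ?invr_eq0 ?Q //; apply: (qX_sub qf); lia.
by rewrite !(mulf_neq0, invr_eq0) ?Q.
Qed.

(** The values chi_(j/2) of kappa on the representations in which neither e_a nor
    e_c vanishes: j = n + 2m with m <= a, c, and j = n - 2m with
    m <= a, c <= n - m. The value m = 0 is common to both families. *)
Definition kappas (a c : nat) : seq nat :=
  [seq (n + m.*2)%N | m <- iota 0 (minn a c).+1]
  ++ [seq (n - m.*2)%N | m <- iota 1 (minn (minn a c) (n - maxn a c))].

(** The greatest length of the loops occurring in P_s^(a,c). *)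
Definition maxdeg (a c : nat) : nat := minn (minn a c).*2 (n - dist a c).

Lemma size_kappas a c : (a <= n)%N -> (c <= n)%N ->
  size (kappas a c) = (maxdeg a c).+1.
Proof. by move=> an cn; rewrite size_cat !size_map !size_iota /maxdeg /dist; lia. Qed.

Lemma uniq_kappas a c : (a <= n)%N -> (c <= n)%N -> uniq (kappas a c).
Proof.
move=> an cn; rewrite cat_uniq; apply/and3P; split.
- by rewrite map_inj_in_uniq ?iota_uniq // => x y _ _; lia.
- apply/hasPn => z /mapP[x]; rewrite mem_iota => xl ->.
  by apply/negP => /mapP[y]; rewrite mem_iota; lia.
- by rewrite map_inj_in_uniq ?iota_uniq // => x y; rewrite !mem_iota; lia.
Qed.

End KappaValues.

Section Evaluation.
Variables (K : fieldType) (q : K) (n : nat) (A : algType K).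
Variables (s1 s2 i1 k g3 : A).
Hypotheses (qf : qfree q) (M : model q n s1 s2 i1 k g3).
Hypothesis large : forall m, (m <= n)%N ->
  has_rep q n s1 s2 k (chi q (n + m.*2)) m n.
Hypothesis small : forall m, (m.*2 <= n)%N ->
  has_rep q n s1 s2 k (chi q (n - m.*2)) m (n - m).

Local Notation e p := (horner_alg s1 (lag (qp q) n p)).
Local Notation f p := (horner_alg s2 (lag (qp q) n p)).
Local Notation g2 := (cas q n s2).
Local Notation ev := (horner_alg k).
Local Notation xg := (xg q n s1 s2).

Section OneRep.
Variables (B : algType K) (psi : {rmorphism A -> B}) (psiZ : scalable psi).
Variables (j m h : nat).
Hypothesis psik : psi k = (chi q j)%:A.
Hypothesis psie : forall p, (m <= p <= h)%N -> psi (e p) != 0.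
Hypothesis psiU : forall l, (m < l <= h)%N -> (upol q n l).[chi q j] != 0.

Lemma psi_ev Q : psi (ev Q) = Q.[chi q j]%:A.
Proof.
rewrite horner_alg_rmorph // psik; elim/poly_ind: Q => [|Q c IH].
  by rewrite raddf0 horner0 scale0r.
rewrite rmorphD rmorphM /= horner_algX horner_algC IH hornerMXaddC.
by rewrite -scalerAl mul1r scalerA -scalerDl.
Qed.

(** Retracing the first step of the shortest path multiplies the rest of it by a
    nonzero factor, and the rest is not zero by induction. *)
Lemma psi_xg a c : (m <= a <= h)%N -> (m <= c <= h)%N -> psi (xg a c) != 0.
Proof.
move=> ah ch; have [d] := ubnP (dist a c); elim: d a ah => // d IH a ah dac.
case: (ltngtP a c) => [ac|ca|->]; last by rewrite xg_diag psie.
  have ah' : (m <= a.+1 <= h)%N by lia.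
  have dac' : (dist a.+1 c < d)%N by move: dac; rewrite /dist; lia.
  apply: contra (IH _ ah' dac') => /eqP x0.
  have st : step a.+1 a by rewrite /step eqxx.
  have := congr1 psi (step_red qf M c st); rewrite !rmorphM x0 mulr0 psi_ev.
  have -> : stepf q n c a.+1 a = upol q n a.+1.
    by rewrite /stepf gtn_eqF // ltnNge leqnSn /= ac.
  rewrite -scalerAl mul1r => /esym/eqP; rewrite scaler_eq0.
  by rewrite (negPf (psiU _)) //; lia.
case: a ah ca dac => // a ah ca dac; have ah' : (m <= a <= h)%N by lia.
have dac' : (dist a c < d)%N by move: dac; rewrite /dist; lia.
apply: contra (IH _ ah' dac') => /eqP x0.
have st : step a a.+1 by rewrite /step eqxx !orbT.
have := congr1 psi (step_red qf M c st); rewrite !rmorphM x0 mulr0 psi_ev.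
have -> : stepf q n c a a.+1 = upol q n a.+1.
  by rewrite /stepf ltn_eqF // ltnSn -ltnS ca.
rewrite -scalerAl mul1r => /esym/eqP; rewrite scaler_eq0.
by rewrite (negPf (psiU _)) //; lia.
Qed.

Lemma psi_kill Q a c : (m <= a <= h)%N -> (m <= c <= h)%N ->
  psi (ev Q * xg a c) = 0 -> Q.[chi q j] = 0.
Proof.
move=> ah ch; rewrite rmorphM psi_ev -scalerAl mul1r => /eqP.
by rewrite scaler_eq0 (negPf (psi_xg ah ch)) orbF => /eqP.
Qed.

End OneRep.

Lemma good_kill (j m h : nat) : has_rep q n s1 s2 k (chi q j) m h ->
    (forall l, (m < l <= h)%N -> (upol q n l).[chi q j] != 0) ->
  forall a c, (m <= a <= h)%N -> (m <= c <= h)%N ->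
    (forall Q, ev Q * xg a c = 0 -> Q.[chi q j] = 0) /\
    ((0 < m)%N -> forall R, e a * f 0 * e c = ev R * xg a c -> R.[chi q j] = 0).
Proof.
case=> B [psi [psiZ psik pe pf _]] U a c ah ch.
have psie p : (m <= p <= h)%N -> psi (e p) != 0.
  by move=> ph; rewrite horner_alg_rmorph //; apply: pe.
split=> [Q Q0|m0 R RE].
  by apply: (psi_kill psiZ psik psie U ah ch); rewrite Q0 rmorph0.
apply: (psi_kill psiZ psik psie U ah ch); rewrite -RE !rmorphM.
by rewrite [psi (f 0)]horner_alg_rmorph // pf // mulr0 mul0r.
Qed.

Lemma kappas_kill a c j : (a <= n)%N -> (c <= n)%N -> j \in kappas n a c ->
  (forall Q, ev Q * xg a c = 0 -> Q.[chi q j] = 0) /\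
  (j != n -> forall R, e a * f 0 * e c = ev R * xg a c -> R.[chi q j] = 0).
Proof.
move=> an cn; rewrite mem_cat => /orP[|] /mapP[m]; rewrite mem_iota => mI ->.
  have mn : (m <= n)%N by lia.
  have [|||k1 k2] := @good_kill (n + m.*2) m n (large mn) _ a c.
  - by move=> l lI; apply: (upol_root qf); lia.
  - by lia.
  - by lia.
  by split=> // jn; apply: k2; lia.
have mn : (m.*2 <= n)%N by lia.
have [|||k1 k2] := @good_kill (n - m.*2) m (n - m) (small mn) _ a c.
- by move=> l lI; apply: (upol_root qf); lia.
- by lia.
- by lia.
by split=> // jn; apply: k2; lia.
Qed.

(** The values of kappa on maxdeg + 1 representations are roots of Q. *)
Lemma small_kill a c Q : (a <= n)%N -> (c <= n)%N ->
  ev Q * xg a c = 0 -> (size Q <= (maxdeg n a c).+1)%N -> Q = 0.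
Proof.
move=> an cn Q0 sQ; apply/eqP; apply: contraLR sQ => Qn0; rewrite -ltnNge.
rewrite -size_kappas // -(size_map (chi q)); apply: max_poly_roots => //.
  by apply/allP => _ /mapP[j jk ->]; apply/eqP; have [-> //] := kappas_kill an cn jk.
by rewrite map_inj_uniq ?uniq_kappas // => x y /(chi_inj qf).
Qed.

(** The action of g_1 is tridiagonal relatively to the f_p, with nonzero entries
    next to the diagonal: an eigenvector of g_1 is determined by its component
    on f_0. *)
Lemma f_chain (B : algType K) (psi : {rmorphism A -> B}) (psiZ : scalable psi)
    (j : nat) (y : B) (t : K) : psi k = (chi q j)%:A ->
    (forall l, (0 < l <= n)%N -> (upol q n l).[chi q j] != 0) ->
  (y * psi (cas q n s1) = t *: y -> y * psi (f 0) = 0 -> y = 0) /\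
  (psi (cas q n s1) * y = t *: y -> psi (f 0) * y = 0 -> y = 0).
Proof.
move=> psik psiU; set G := psi (cas q n s1); pose F p := psi (f p).
have sumF : \sum_(0 <= p < n.+1) F p = 1.
  rewrite -raddf_sum /= -[RHS](rmorph1 psi); congr (psi _).
  apply: (lag_sum1 _ (mdl_nodes2 M)) => ? ? _ _; exact: (qp_inj qf).
have F_gt p : (n < p)%N -> F p = 0.
  move=> np; rewrite /F (lag_gt0 _ (mdl_nodes2 M)) ?rmorph0 // => ? ? _ _.
  exact: (qp_inj qf).
have far p r : p != r -> p.+1 != r -> r.+1 != p -> F p * G * F r = 0.
  by move=> pr p1 r1; rewrite -!rmorphM (f_far qf M) // rmorph0.
have back p : F p.+1 * G * F p * G * F p.+1 = (upol q n p.+1).[chi q j] *: F p.+1.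
  by rewrite -!rmorphM (f_back_down qf M) rmorphM (psi_ev psiZ psik) -scalerAl mul1r.
split=> yG y0.
  have yF p : (p <= n)%N -> y * F p = 0.
    elim/ltn_ind: p => -[|p] IH pn; first exact: y0.
    have : \sum_(0 <= r < n.+1) y * F r * G * F p = 0.
      by rewrite -!mulr_suml -mulr_sumr sumF mulr1 yG -scalerAl IH ?scaler0 //; lia.
    rewrite (@sum_near _ (fun r => y * F r * G * F p) p) => [|r pr p1 r1|r rn]; last 2 first.
    - by rewrite -!mulrA [F r * _]mulrA far ?mulr0 // eq_sym.
    - by rewrite F_gt // mulr0 !mul0r.
    have -> : (if p is p'.+1 then y * F p' * G * F p else 0) = 0.
      by case: p IH pn => // p IH pn; rewrite IH ?mul0r //; lia.
    rewrite [y * F p]IH ?mul0r ?add0r; try lia.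
    move/(congr1 (fun u => u * G * F p.+1)); rewrite !mul0r.
    have -> : y * F p.+1 * G * F p * G * F p.+1
              = y * (F p.+1 * G * F p * G * F p.+1) by rewrite !mulrA.
    rewrite back -scalerAr => /eqP.
    by rewrite scaler_eq0 (negPf (psiU _ _)) //= => /eqP.
  by rewrite -[y]mulr1 -sumF mulr_sumr big_nat big1 // => p /andP[_ pn]; apply: yF.
have Fy p : (p <= n)%N -> F p * y = 0.
  elim/ltn_ind: p => -[|p] IH pn; first exact: y0.
  have : \sum_(0 <= r < n.+1) F p * G * (F r * y) = 0.
    by rewrite -mulr_sumr -mulr_suml sumF mul1r -mulrA yG -scalerAr IH ?scaler0 //; lia.
  rewrite (@sum_near _ (fun r => F p * G * (F r * y)) p) => [|r pr p1 r1|r rn]; last 2 first.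
  - by rewrite mulrA far ?mul0r.
  - by rewrite (F_gt r) // mul0r mulr0.
  have -> : (if p is p'.+1 then F p * G * (F p' * y) else 0) = 0.
    by case: p IH pn => // p IH pn; rewrite IH ?mulr0 //; lia.
  rewrite [F p * y]IH ?mulr0 ?add0r; try lia.
  move/(congr1 (fun u => F p.+1 * G * u)); rewrite mulr0 !mulrA back -scalerAl => /eqP.
  by rewrite scaler_eq0 (negPf (psiU _ _)) //= => /eqP.
by rewrite -[y]mul1r -sumF mulr_suml big_nat big1 // => p /andP[_ pn]; apply: Fy.
Qed.

(** This is seen in the representation with kappa = chi_s: as f_0 has rank one
    there, e_a f_0 or f_0 e_c would vanish, and then e_a or e_c. *)
Lemma e_f0_e a c : (a <= n)%N -> (c <= n)%N -> e a * f 0 * e c != 0.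
Proof.
move=> an cn; have [B [psi [psiZ psik pe _ pf]]] := large (leq0n n).
rewrite double0 addn0 in psik.
have [_ fprime] := pf erefl.
have psie p : (p <= n)%N -> psi (e p) != 0.
  by move=> pn; rewrite horner_alg_rmorph //; apply: pe.
have psiF : psi (f 0) = horner_alg (psi s2) (lag (qp q) n 0).
  by rewrite horner_alg_rmorph.
have U l : (0 < l <= n)%N -> (upol q n l).[chi q n] != 0.
  by move=> ln; apply: (upol_root qf); lia.
have D := mdl_awdata qf M.
apply/eqP => /(congr1 psi); rewrite !rmorphM rmorph0 psiF => /fprime.
rewrite -psiF => -[X0|Y0].
  have [chain _] := f_chain psiZ (psi (e a)) (chi q a.*2) psik U.
  have /eqP := psie a an; apply; apply: chain => //.
  by rewrite -rmorphM (awd_ex D) psiZ.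
have [_ chain] := f_chain psiZ (psi (e c)) (chi q c.*2) psik U.
have /eqP := psie c cn; apply; apply: chain => //.
by rewrite -rmorphM (awd_xe D) psiZ.
Qed.

(** Two factorizations lead to a point where kappa is chi_s: through e_0, and
    through f_0. The one of lower degree is taken. For the second the degree of R
    must be exact: R is not zero, and it vanishes at all the values of kappa
    but chi_s, because f_0 = 0 in the corresponding representations. *)
Lemma annihilator a c : (a <= n)%N -> (c <= n)%N ->
  exists2 P : {poly K}, size P = (maxdeg n a c).+2 & ev P * xg a c = 0.
Proof.
move=> an cn; case: (leqP (minn a c).*2 (n - dist a c)) => le.
  exists (bottom_poly q n (minn a c)); last exact: (bottom_kill_xg qf M).
  rewrite (size_bottom qf); last by lia.
  by rewrite /maxdeg; lia.
have [R sR RE] := f0_red qf M c an.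
have R0 : R != 0.
  by apply: contraNneq (e_f0_e an cn) => R0; rewrite RE R0 rmorph0 mul0r.
exists (('X - (chi q n)%:P) * R); last exact: (top_kill_xg qf M RE).
rewrite size_mul ?polyXsubC_eq0 // size_XsubC.
have -> : maxdeg n a c = (n - dist a c)%N by rewrite /maxdeg (minn_idPr (ltnW le)).
suff lR : (n - dist a c < size R)%N.
  have dn : (dist a c <= n)%N by clear - an cn; rewrite /dist; lia.
  by congr _.+1; apply/eqP; rewrite eqn_leq lR -subSn // sR.
have sz : size (rem n (kappas n a c)) = (n - dist a c)%N.
  rewrite size_rem ?size_kappas //.
    by rewrite /maxdeg (minn_idPr (ltnW le)).
  by rewrite mem_cat; apply/orP; left; apply/mapP; exists 0%N; rewrite ?mem_iota // addn0.
rewrite -sz -(size_map (chi q)); apply: max_poly_roots => //.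
  apply/allP => z /mapP[j]; rewrite mem_rem_uniq ?uniq_kappas // => /andP[jn jk] ->.
  by apply/eqP; have [_ kf] := kappas_kill an cn jk; apply: kf.
by rewrite map_inj_uniq ?rem_uniq ?uniq_kappas // => x y /(chi_inj qf).
Qed.

End Evaluation.

(** * The paths of the basis *)

Definition walk (n a c N : nat) (g : seq nat) : bool :=
  is_path n a c g && (plen g == N).

Lemma walkP n a c N g : reflect
  (exists t, [/\ g = a :: t, last a t = c, all (fun x => x <= n)%N (a :: t),
                 path step a t & size t = N])
  (walk n a c N g).
Proof.
apply: (iffP idP) => [|[t [-> lt nt pt st]]]; last first.
  by rewrite /walk /is_path nt /plen /= lt st pt !eqxx.
case: g => // x t /andP[/and5P[_ /eqP /= -> /eqP lt nt pt] /eqP st].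
by exists t; split.
Qed.

Lemma gbar_walk n a c : (a <= n)%N -> (c <= n)%N -> walk n a c (dist a c) (gbar a c).
Proof. by move=> an cn; rewrite /walk gbar_unique. Qed.

Lemma rev_gbar a b : (b <= a)%N -> rev (gbar a b) = gbar b a.
Proof.
rewrite leq_eqVlt => /orP[/eqP->|ba]; first by rewrite gbar_diag.
by rewrite /gbar (ltnW ba) leqNgt ba /= revK.
Qed.

Lemma pcat_walk n a b c N N' g g' :
  walk n a b N g -> walk n b c N' g' -> walk n a c (N + N') (pcat g g').
Proof.
move=> /walkP[t [-> lt nt pt <-]] /walkP[t' [-> lt' nt' pt' <-]].
have -> : pcat (a :: t) (b :: t') = a :: (t ++ t').
  rewrite /pcat /plen [(size _).-1]/= lastI -cats1 take_size_cat ?size_belast //.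
  by rewrite -cat_rcons -[in LHS]lt -lastI.
apply/walkP; exists (t ++ t'); split=> //; rewrite ?last_cat ?lt ?size_cat //.
- by rewrite -cat_cons all_cat nt; case/andP: nt'.
- by rewrite cat_path pt lt.
Qed.

Lemma cat_walk n a b b' c N N' g g' :
    walk n a b N g -> walk n b' c N' g' -> step b b' ->
  walk n a c (N + N').+1 (g ++ g').
Proof.
move=> /walkP[t [-> lt nt pt <-]] /walkP[t' [-> lt' nt' pt' <-]] st.
apply/walkP; exists (t ++ b' :: t'); split=> //.
- by rewrite last_cat.
- by rewrite -cat_cons all_cat nt.
- by rewrite cat_path pt lt /= st.
- by rewrite size_cat /= addnS.
Qed.

Lemma Lpath_walk n a N : (a <= n)%N -> (N <= a.*2)%N -> walk n a a N (Lpath a N).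
Proof.
move=> an Na; have hN : (N./2 <= a)%N by lia.
have bn : (a - N./2 <= n)%N by lia.
rewrite /Lpath rev_gbar ?leq_subr //.
have down := gbar_walk an bn; have up := gbar_walk bn an.
have d1 : dist a (a - N./2) = N./2 by rewrite /dist; lia.
have d2 : dist (a - N./2) a = N./2 by rewrite /dist; lia.
rewrite d1 in down; rewrite d2 in up.
case: ifP => oN.
  have NE : (N./2.*2).+1 = N by have := odd_double_half N; rewrite oN.
  by have := cat_walk down up; rewrite /step eqxx orbT addnn NE; apply.
have NE : N./2.*2 = N by have := odd_double_half N; rewrite oN.
by have := pcat_walk down up; rewrite addnn NE.
Qed.

(** The path of P_s^(a,c) built on the loop of length N. *)
Definition bpath (a c N : nat) : seq nat :=
  if (a <= c)%N then pcat (Lpath a N) (gbar a c) else pcat (gbar a c) (Lpath c N).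

Lemma bpath_walk n a c N : (a <= n)%N -> (c <= n)%N -> (N <= (minn a c).*2)%N ->
  walk n a c (N + dist a c) (bpath a c N).
Proof.
move=> an cn Nac; rewrite /bpath; case: leqP => ac.
  by apply: pcat_walk (gbar_walk an cn); apply: Lpath_walk => //; lia.
rewrite addnC; apply: pcat_walk (gbar_walk an cn) _.
by apply: Lpath_walk => //; lia.
Qed.

Lemma Pset_bpath n a c g : (a <= n)%N -> (c <= n)%N ->
  g \in Pset n a c <-> exists2 N, (N <= maxdeg n a c)%N & g = bpath a c N.
Proof.
move=> an cn.
have plenL b N : (b <= n)%N -> (N <= b.*2)%N -> plen (Lpath b N) = N.
  by move=> bn Nb; have /andP[_ /eqP] := Lpath_walk bn Nb.
rewrite /Pset /bpath /maxdeg /dist; case: leqP => ac; split.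
- case/mapP => _ /[!mem_filter] /andP[/[swap] /mapP[N /[!mem_iota] NI ->]] + ->.
  by rewrite plenL // => le; exists N => //; lia.
- case=> N Nm ->; apply/mapP; exists (Lpath a N) => //.
  rewrite mem_filter plenL //; last by lia.
  by apply/andP; split; [lia|apply/mapP; exists N; rewrite ?mem_iota //; lia].
- case/mapP => _ /[!mem_filter] /andP[/[swap] /mapP[N /[!mem_iota] NI ->]] + ->.
  by rewrite plenL // => le; exists N => //; lia.
case=> N Nm ->; apply/mapP; exists (Lpath c N) => //.
rewrite mem_filter plenL //; last by lia.
by apply/andP; split; [lia|apply/mapP; exists N; rewrite ?mem_iota //; lia].
Qed.

(** * Linear algebra *)

(** Descending induction on the size: the leading coefficient of F_i occurs in
    no smaller F_j. *)
Lemma poly_indep (K : fieldType) (I : eqType) (r : seq I) (F : I -> {poly K})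
    (c : I -> K) : uniq r -> {in r, forall i, F i != 0} ->
    {in r &, injective (fun i => size (F i))} ->
    \sum_(i <- r) c i *: F i = 0 ->
  {in r, forall i, c i = 0}.
Proof.
move=> ur F0 Finj sum0; set M := \max_(i <- r) size (F i).
move=> i; have [d] := ubnP (M - size (F i)); elim: d i => // d IH i di ir.
have /eqP := congr1 (fun P : {poly K} => P`_(size (F i)).-1) sum0.
rewrite coef0 coef_sum (bigD1_seq i) //= big1_seq => [|j /andP[ji jr]].
  rewrite addr0 coefZ mulf_eq0 => /orP[/eqP //|].
  by rewrite -/(lead_coef _) lead_coef_eq0 (negPf (F0 i ir)).
rewrite coefZ; case: (ltngtP (size (F j)) (size (F i))) => [lt|gt|eq].
- by rewrite nth_default ?mulr0 //; case: (size (F i)) lt.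
- have jM : (size (F j) <= M)%N by apply: (@leq_bigmax_seq _ r xpredT (fun i => size (F i))) => //.
  rewrite IH ?mul0r //; move: (size (F j)) (size (F i)) gt jM di => x y.
  by clear; lia.
- by move: ji; rewrite (Finj j i jr ir eq) eqxx.
Qed.

Section Span.
Variables (K : fieldType) (V : lmodType K) (B : V -> Prop).

Definition in_span (w : V) : Prop := exists (r : seq V) (c : V -> K),
  [/\ uniq r, forall v, v \in r -> B v & w = \sum_(v <- r) c v *: v].

Lemma in_span0 : in_span 0.
Proof. by exists [::], (fun=> 0); split; rewrite ?big_nil. Qed.

Lemma in_span_cons w v t : in_span w -> B v -> in_span (w + t *: v).
Proof.
case=> r [c [ur rB ->]] Bv; pose c' u := (if u \in r then c u else 0) + (if u == v then t else 0).
have sumE (s : seq V) : uniq s -> v \in s -> {subset r <= s} ->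
    \sum_(u <- s) c' u *: u = \sum_(u <- r) c u *: u + t *: v.
  move=> us vs rs; under eq_bigr do rewrite scalerDl.
  rewrite big_split /= [X in _ + X](bigD1_seq v) //= eqxx.
  rewrite [X in _ + (_ + X)]big1 ?addr0 => [|u /negPf ->]; last by rewrite scale0r.
  congr (_ + _); rewrite (eq_bigr (fun u => if u \in r then c u *: u else 0)).
    rewrite -big_mkcond -big_filter; apply: perm_big; apply: uniq_perm => //.
      exact: filter_uniq.
    by move=> u; rewrite mem_filter; case: (boolP (u \in r)) => //= /rs.
  by move=> u _; case: ifP; rewrite ?scale0r.
case: (boolP (v \in r)) => vr.
  by exists r, c'; split=> //; rewrite sumE.
exists (v :: r), c'; split=> [|u|]; first by rewrite /= vr.
  by rewrite inE => /predU1P[->|/rB].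
by rewrite sumE //= ?vr ?mem_head // => u ur'; rewrite inE ur' orbT.
Qed.

Lemma in_spanZD t u w : in_span u -> in_span w -> in_span (w + t *: u).
Proof.
case=> r [c [_ rB ->]] Sw; elim: r rB => [|v r IH] rB.
  by rewrite big_nil scaler0 addr0.
rewrite big_cons scalerDr [X in _ + X]addrC addrA scalerA.
apply: in_span_cons; last by apply: rB; rewrite mem_head.
by apply: IH => x xr; apply: rB; rewrite inE xr orbT.
Qed.

Lemma in_spanD u w : in_span u -> in_span w -> in_span (u + w).
Proof. by move=> Su Sw; rewrite -[w]scale1r; apply: in_spanZD. Qed.

Lemma in_spanZ t u : in_span u -> in_span (t *: u).
Proof. by move=> Su; rewrite -[_ *: _]add0r; apply: in_spanZD in_span0. Qed.

Lemma in_span_sum (I : eqType) (r : seq I) (F : I -> V) :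
  {in r, forall i, in_span (F i)} -> in_span (\sum_(i <- r) F i).
Proof.
by move=> SF; rewrite big_seq; elim/big_ind: _ => //; [exact: in_span0|exact: in_spanD].
Qed.

End Span.

(** * The basis of a model *)

Section Basis.
Variables (K : fieldType) (q : K) (n : nat) (A : algType K).
Variables (s1 s2 i1 k g3 : A).
Hypotheses (qf : qfree q) (M : model q n s1 s2 i1 k g3).
Hypothesis large : forall m, (m <= n)%N ->
  has_rep q n s1 s2 k (chi q (n + m.*2)) m n.
Hypothesis small : forall m, (m.*2 <= n)%N ->
  has_rep q n s1 s2 k (chi q (n - m.*2)) m (n - m).

Local Notation e p := (horner_alg s1 (lag (qp q) n p)).
Local Notation g2 := (cas q n s2).
Local Notation ev := (horner_alg k).
Local Notation xg := (xg q n s1 s2).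
Local Notation xp := (xp q n s1 s2).
Local Notation W a c N := (ppoly q n c (bpath a c N)).
Let D := mdl_awdata qf M.

Definition path_elt (x : A) : Prop := exists a c N,
  [/\ (a <= n)%N, (c <= n)%N, (N <= maxdeg n a c)%N & x = xp (bpath a c N)].

Lemma bpath_elt a c N : (a <= n)%N -> (c <= n)%N -> (N <= maxdeg n a c)%N ->
  xp (bpath a c N) = ev (W a c N) * xg a c /\ size (W a c N) = N.+1.
Proof.
move=> an cn Nm; have Nac : (N <= (minn a c).*2)%N by move: Nm; rewrite /maxdeg; lia.
have /walkP[t [-> lt nt pt st]] := bpath_walk an cn Nac.
split; first exact: (path_red qf M).
by have := size_ppoly qf nt pt lt; rewrite st -addSn => /eqP; rewrite eqn_add2r => /eqP.
Qed.

(** Multiplication by e_a and e_c isolates the paths from a to c; what remains is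
    a polynomial in kappa on a shortest path, with terms of distinct degrees. *)
Lemma path_elt_indep (r : seq A) (c : A -> K) : uniq r ->
    (forall v, v \in r -> path_elt v) -> \sum_(v <- r) c v *: v = 0 ->
  forall v, v \in r -> c v = 0.
Proof.
move=> ur rB sum0.
have /choice[idx idxP] : forall v, exists i : nat * nat * nat, v \in r ->
    [/\ (i.1.1 <= n)%N, (i.1.2 <= n)%N, (i.2 <= maxdeg n i.1.1 i.1.2)%N
      & v = xp (bpath i.1.1 i.1.2 i.2)].
  move=> v; case: (boolP (v \in r)) => [/rB[a [c' [N H]]]|_]; last by exists (0, 0, 0)%N.
  by exists (a, c', N).
move=> v0 v0r; have [a0n c0n _ _] := idxP v0 v0r.
set a0 := (idx v0).1.1 in a0n; set c0 := (idx v0).1.2 in c0n.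
pose r' := [seq v <- r | (idx v).1 == (a0, c0)].
have r'P v : v \in r' -> [/\ v \in r, (idx v).1.1 = a0, (idx v).1.2 = c0,
    ((idx v).2 <= maxdeg n a0 c0)%N & v = xp (bpath a0 c0 (idx v).2)].
  rewrite mem_filter => /andP[/eqP iv vr]; have [_ _] := idxP v vr.
  by rewrite iv.
apply: (@poly_indep K A r' (fun v => W a0 c0 (idx v).2) c); last 2 first.
- apply: (small_kill qf M large small a0n c0n); last first.
    rewrite (leq_trans (size_sum _ _ _)) //; apply/bigmax_leqP_seq => v vr' _.
    have [_ _ _ Nm _] := r'P v vr'; rewrite (leq_trans (size_scale_leq _ _)) //.
    by have [_ ->] := bpath_elt a0n c0n Nm.
  have := congr1 (fun u => e a0 * u * e c0) sum0.
  rewrite mulr0 mul0r mulr_sumr mulr_suml => <-.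
  rewrite raddf_sum mulr_suml /r' big_filter big_mkcond /=.
  rewrite !big_seq; apply: eq_bigr => v vr.
  have [an cn Nm vE] := idxP v vr; have [xE _] := bpath_elt an cn Nm.
  have kc P := horner_alg_central P (k_comm M).
  have sandwich : e a0 * v * e c0
      = if (idx v).1 == (a0, c0) then ev (W a0 c0 (idx v).2) * xg a0 c0 else 0.
    rewrite {1}vE xE mulrA -kc -mulrA -mulrA.
    rewrite -(e_xg qf M) -(xg_e qf M _ (idx v).1.2) -!mulrA (awd_orth D).
    rewrite !mulrA -[_ * e _ * e _]mulrA (awd_orth D).
    case: (idx v).1 => a c' /=; rewrite xpair_eqE eq_sym.
    case: eqP => [->|_] /=; last by rewrite mulr0 !mul0r.
    case: eqP => [->|_] /=; last by rewrite mulr0.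
    by rewrite -!mulrA (xg_e qf M) (e_xg qf M).
  rewrite -scalerAr -scalerAl sandwich; case: ifP => _; last by rewrite scaler0.
  by rewrite horner_algZ -scalerAl.
- by rewrite mem_filter v0r /a0 /c0 -surjective_pairing eqxx.
- exact: filter_uniq.
- move=> v vr'; have [_ _ _ Nm _] := r'P v vr'.
  by rewrite -size_poly_gt0; have [_ ->] := bpath_elt a0n c0n Nm.
move=> u v ur' vr' /=; have [_ _ _ Nu uE] := r'P u ur'; have [_ _ _ Nv vE] := r'P v vr'.
have [_ ->] := bpath_elt a0n c0n Nu; have [_ ->] := bpath_elt a0n c0n Nv.
by case=> uv; rewrite uE vE uv.
Qed.

Local Notation Sp := (in_span path_elt).

(** Modulo the annihilator Q may be taken of degree at most maxdeg, hence is a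
    combination of the polynomials of the paths in P_s^(a,c). *)
Lemma poly_xg_span Q a c : (a <= n)%N -> (c <= n)%N -> Sp (ev Q * xg a c).
Proof.
move=> an cn; have [P sP P0] := annihilator qf M large small an cn.
have low d : (d <= (maxdeg n a c).+1)%N -> forall R : {poly K}, (size R <= d)%N ->
    Sp (ev R * xg a c).
  elim: d => [_ R|d IH dm R sR].
    by rewrite size_poly_leq0 => /eqP ->; rewrite rmorph0 mul0r; apply: in_span0.
  have [xE sW] := bpath_elt an cn dm.
  pose t := R`_d / (W a c d)`_d.
  have lW : (W a c d)`_d != 0.
    have : lead_coef (W a c d) != 0 by rewrite lead_coef_eq0 -size_poly_gt0 sW.
    by rewrite lead_coefE sW.
  have -> : R = (R - t *: W a c d) + t *: W a c d by rewrite subrK.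
  rewrite rmorphD /= horner_algZ mulrDl -scalerAl -xE.
  apply: in_span_cons; last by exists a, c, d.
  apply: (IH (ltnW dm)); apply/leq_sizeP => j; rewrite leq_eqVlt => /predU1P[<-|dj].
    by rewrite coefB coefZ /t divfK // subrr.
  rewrite coefB coefZ !nth_default ?mulr0 ?subrr ?sW //.
  exact: leq_trans sR dj.
have P_neq0 : P != 0 by rewrite -size_poly_gt0 sP.
rewrite (divp_eq Q P) rmorphD rmorphM /= mulrDl -mulrA P0 mulr0 add0r.
by apply: (low _ (leqnn _)); rewrite -ltnS -sP ltn_modp.
Qed.

Definition stab (x : A) : Prop := forall w, Sp w -> Sp (x * w).

Lemma stab_xg (x : A) :
    (forall Q a c, (a <= n)%N -> (c <= n)%N -> Sp (ev Q * (x * xg a c))) ->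
  stab x.
Proof.
move=> xS _ [r [c [_ rB ->]]]; rewrite mulr_sumr; apply: in_span_sum => v vr.
rewrite -scalerAr; apply: in_spanZ; have [a [c' [N [an cn Nm ->]]]] := rB v vr.
have [-> _] := bpath_elt an cn Nm.
by rewrite mulrA -(horner_alg_central _ (k_comm M)) -mulrA; apply: xS.
Qed.

Lemma stabD x y : stab x -> stab y -> stab (x + y).
Proof. by move=> Sx Sy w Sw; rewrite mulrDl; apply: in_spanD; [apply: Sx|apply: Sy]. Qed.

Lemma stabM x y : stab x -> stab y -> stab (x * y).
Proof. by move=> Sx Sy w Sw; rewrite -mulrA; apply/Sx/Sy. Qed.

Lemma stabZ t x : stab x -> stab (t *: x).
Proof. by move=> Sx w Sw; rewrite -scalerAl; apply/in_spanZ/Sx. Qed.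

Lemma stab1 : stab 1. Proof. by move=> w; rewrite mul1r. Qed.

Lemma stab_s1 : stab s1.
Proof.
apply: stab_xg => Q a c an cn; rewrite -(e_xg qf M) [s1 * _]mulrA.
rewrite (lag_eigenX _ (mdl_nodes1 M)) //; last by move=> ? ? _ _; apply: (qp_inj qf).
by rewrite -scalerAl -scalerAr (e_xg qf M); apply/in_spanZ/poly_xg_span.
Qed.

Lemma stab_g2 : stab g2.
Proof.
apply: stab_xg => Q a c an cn.
rewrite -[g2 * _]mul1r -(awd_sum D) mulr_suml mulr_sumr.
apply: in_span_sum => b; rewrite mem_index_iota => bn.
case: (boolP (step b a)) => [st|nst].
  by rewrite mulrA (step_red qf M) // mulrA -rmorphM; apply: poly_xg_span.
rewrite -(e_xg qf M) !mulrA -[_ * e b * g2]mulrA -[_ * e a]mulrA (back_far qf M).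
- by rewrite mulr0 mul0r; apply: in_span0.
- by move: nst; rewrite /step; lia.
- by move: nst; rewrite /step; lia.
- by move: nst; rewrite /step; lia.
Qed.

Lemma stab_s2 : stab s2.
Proof.
have Sg P : stab (horner_alg g2 P).
  elim/poly_ind: P => [|P c IH]; first by move=> w _; rewrite raddf0 mul0r; apply: in_span0.
  rewrite rmorphD rmorphM /= horner_algX horner_algC.
  by apply: stabD; [apply: stabM IH stab_g2|apply: stabZ stab1].
move=> w Sw; rewrite -[s2](horner_algX s2) (horner_alg_lag _ (mdl_nodes2 M)); last first.
  by move=> ? ? _ _; apply: (qp_inj qf).
rewrite mulr_suml; apply: in_span_sum => p _; rewrite -scalerAl.
by apply: in_spanZ; rewrite (f_horner qf M); apply: Sg.
Qed.

Hypothesis generated : forall P : A -> Prop, P 1 -> P s1 -> P s2 ->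
  (forall u v, P u -> P v -> P (u + v)) -> (forall u v, P u -> P v -> P (u * v)) ->
  (forall t u, P u -> P (t *: u)) -> forall u, P u.

Lemma path_elt_span w : Sp w.
Proof.
have Sw : stab w.
  by apply: (@generated stab); [exact: stab1|exact: stab_s1|exact: stab_s2|exact: stabD
                       |exact: stabM|exact: stabZ].
rewrite -[w]mulr1; apply: Sw; rewrite -(awd_sum D); apply: in_span_sum => a.
rewrite mem_index_iota => an; rewrite -(xg_diag q n s1 s2) -[xg a a]mul1r.
by rewrite -(rmorph1 ev); apply: poly_xg_span.
Qed.

End Basis.

(** * The basis of A_s *)

Section AsBasis.
Variables (K : fieldType) (q : K) (n : nat) (qf : qfree q).
Local Notation A := (@As_alg K q n qf).
Local Notation s1 := (@to_alg K q n qf (sigma1 (As_rel q n))).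
Local Notation s2 := (@to_alg K q n qf (sigma2 (As_rel q n))).
Local Notation k := (@to_alg K q n qf (kappa q n (As_rel q n))).

Let M := As_is_model n qf.

Lemma As_large m : (m <= n)%N -> has_rep q n s1 s2 k (chi q (n + m.*2)) m n.
Proof. by move=> mn; apply/good_has_rep/good_large. Qed.

Lemma As_small m : (m.*2 <= n)%N -> has_rep q n s1 s2 k (chi q (n - m.*2)) m (n - m).
Proof. by move=> mn; apply/good_has_rep/good_small. Qed.

Lemma As_generated (P : A -> Prop) : P 1 -> P s1 -> P s2 ->
  (forall u v, P u -> P v -> P (u + v)) -> (forall u v, P u -> P v -> P (u * v)) ->
  (forall t u, P u -> P (t *: u)) -> forall u, P u.
Proof.
move=> P1 Ps1 Ps2 PD PM PZ; apply: presented_ind => // i.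
by case: (unliftP 0 i) => [j|] ->; rewrite ?ord1 // (_ : lift 0 0 = 1) //; apply: val_inj.
Qed.

Lemma xpath_xp a t :
  @to_alg K q n qf (xpath q n (As_rel q n) (a :: t)) = xp q n s1 s2 (a :: t).
Proof.
exact: (theta_xpath q n (@to_alg_scalable K q n qf) a t).
Qed.

Lemma xpath_bpath a c N : (a <= n)%N -> (c <= n)%N -> (N <= maxdeg n a c)%N ->
  @to_alg K q n qf (xpath q n (As_rel q n) (bpath a c N)) = xp q n s1 s2 (bpath a c N).
Proof.
move=> an cn Nm; have Nac : (N <= (minn a c).*2)%N by move: Nm; rewrite /maxdeg; lia.
by have /walkP[t [-> _ _ _ _]] := bpath_walk an cn Nac; apply: xpath_xp.
Qed.

Lemma to_alg_inj : injective (@to_alg K q n qf). Proof. by []. Qed.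

Lemma path_eltE (x : presented (As_rel q n)) :
  path_elt q n s1 s2 (@to_alg K q n qf x) <->
  exists a c gamma, [/\ (a <= n)%N, (c <= n)%N, gamma \in Pset n a c
      & x = xpath q n (As_rel q n) gamma].
Proof.
split=> [[a [c [N [an cn Nm xE]]]]|[a [c [g [an cn /(Pset_bpath _ an cn)[N Nm ->] ->]]]]].
  exists a, c, (bpath a c N); split; [by []|by []| |].
    by apply/(Pset_bpath _ an cn); exists N.
  by apply: to_alg_inj; rewrite xE xpath_bpath.
exists a, c, N; split; [by []|by []|by []|].
exact: xpath_bpath.
Qed.

Lemma As_basis : is_basis [set x : As q n |
    exists a c gamma, [/\ (a <= n)%N, (c <= n)%N, gamma \in Pset n a c
      & x = xpath q n (As_rel q n) gamma]]%classic.
Proof.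
split=> [r c ur rB sum0|w].
  apply: (path_elt_indep qf M As_large As_small ur _ sum0) => v vr.
  exact/path_eltE/rB.
have [r [c [_ rB wE]]] := path_elt_span qf M As_large As_small As_generated w.
by exists r, c; split=> // v vr; apply/path_eltE/rB.
Qed.

End AsBasis.

Lemma qfree_qvar (R : realType) : qfree (qvar R).
Proof.
have tf0 (P : {poly R[i]}) : (tofrac P == 0) = (P == 0).
  by rewrite -tofrac0 tofrac_eq.
split=> [||m m0].
- by rewrite tf0 polyX_eq0.
- rewrite -(rmorph_nat (@tofrac _)) tf0 -polyC_natr polyC_eq0.
  by rewrite Num.Theory.pnatr_eq0.
rewrite /qvar -rmorphXn -(rmorph1 (@tofrac _)) tofrac_eq.
apply/eqP => /(congr1 (fun P : {poly R[i]} => size P)).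
by rewrite size_polyXn size_poly1; case: m m0.
Qed.

Local Open Scope classical_set_scope.

(* [n] is 2s, so that s ranges over the positive half-integers. *)
Theorem mainTheorem3 (R : realType) (n : nat) (hn : (0 < n)%N) :
  is_basis [set x : As (qvar R) n |
    exists a c gamma, [/\ (a <= n)%N, (c <= n)%N, gamma \in Pset n a c
      & x = xpath (qvar R) n (As_rel (qvar R) n) gamma]].
Proof. exact: (As_basis n (qfree_qvar R)). Qed.
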